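(* Let $G$ be an $n$-vertex, $K_{r+1}$-free graph where $r \ge 3$. Let $t \ge 2$. (a) If $G$ is not traceable and $n\ge 20$ if $r=3$, $n\ge 1$ if $r\ge 4$, then $k^t(G) \leq k^t(G^{-1*}_{n,r})$. Equality holds if $G \cong G^{-1*}_{n,r}$, which is $T_r(n-1)$ plus an isolated vertex. (b) If $G$ is not Hamiltonian (or, for $n\ge 4$, if $G$ is not chorded pancyclic) and $n \ge 26$ if $r=3$, $n\ge 11$ if $r=4$, $n\ge 2$ if $r \ge 5$, then $k^t(G) \leq k^t(G^{0*}_{n,r})$. Equality holds if $G \cong G^{0*}_{n,r}$, which is $T_r(n-1)$ plus a vertex of degree $1$. (c) If $G$ is not Hamiltonian-connected and $n \ge 32$ if $r=3$, $n\ge 16$ if $r=4$, $n\ge 10$ if $r=5$, $n\ge 4$ if $r \ge 6$, then $k^t(G) \leq k^t(G^{1*}_{n,r})$. Equality holds if $G \cong G^{1*}_{n,r}$, which is $T_r(n-1)$ plus a vertex of degree $2$ whose neighbors are adjacent. (d) For $k\ge 0$, if $G$ is not $k$-path Hamiltonian and $n \ge 6k+26$ if $r=3$, $n\ge 5k+11$ if $4 \le r \le 7$, $n\ge k+5+ 4(k+4)/(r-4)$ if $r \ge 8$, then $k^t(G) \leq k^t(G^{k*}_{n,r})$. Equality holds if $G \cong G^{k*}_{n,r}$. (e) For $k\ge 0$, if $G$ is not $k$-Hamiltonian and $n \ge 6k+26$ if $r=3$, $n\ge 5k+11$ if $4 \le r \le 7$, $n\ge k+5+ 4(k+4)/(r-4)$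 if $r \ge 8$, then $k^t(G) \leq k^t(G^{k*}_{n,r})$. Equality holds if $G \cong G^{k*}_{n,r}$. (f) For $k\ge 1$, if $G$ is not $k$-Hamiltonian-connected and $n \ge 6k+26$ if $r=3$, $n\ge 5k+11$ if $r=4$, $n\ge 3k+7$ if $5 \le r \le 7$, $n\ge k+5+4(k+4)/(r-4)$ if $r \ge 8$, then $k^t(G) \leq k^t(G^{k*}_{n,r})$. Equality holds if $G \cong G^{k*}_{n,r}$. (g) For $k\ge 1$, if $G$ is not $k$-connected and $n \ge 6k+14$ if $r=3$, $n\ge 5k+1$ if $4 \le r \le 7$, $n\ge 2k+5$ if $r \ge 8$, then $k^t(G) \leq k^t(G^{(k-2)*}_{n,r})$. Equality holds if $G \cong G^{(k-2)*}_{n,r}$.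
   Context: Graphs are simple. $e(G)$ is the number of edges of $G$; $k^t(G)$ (superscript $t$) is the number of $t$-cliques of $G$ (sets of $t$ pairwise adjacent vertices), not to be confused with the integer parameter $k$. $T_r(n)$ is the Turán graph: the $n$-vertex complete $r$-partite graph with parts as balanced as possible (so $T_r(n)=K_n$ if $n\le r$). For $-1 \le \ell \le \lfloor (r-1)n/r\rfloor - 1$, $G^{\ell *}_{n,r}$ is the $n$-vertex $r$-partite colex Turán graph with $m = e(T_r(n-1))+\ell+1$ edges: its vertex set is $\{1,\dots,n\}$ and its edges are the first $m$ pairs $\{i,j\}$ of positive integers with $i\not\equiv j \pmod r$ in colexicographic order ($A<_C B$ iff $\max(A\triangle B)\in B$). Equivalently, $\{1,\dots,n-1\}$ with classes mod $r$ forms $T_r(n-1)$ and vertex $n$ is adjacent to exactly the $\ell+1$ smallest $i<n$ with $i\not\equiv n \pmod r$ (vertex $n$ is isolated if $\ell=-1$). A graph is traceable if it has a Hamiltonian path, Hamiltonian if it has a Hamiltonian cycle, and Hamiltonian-connected if every pair of vertices is connected by a Hamiltonian path. A graph on $n\ge 4$ vertices is chorded pancyclic if for every $4\le p\le n$ it contains a cycle of length $p$ that has a chord. An $n$-vertex graph $G$ is: $k$-path Hamiltonian ($0\le k\le n-2$) if every path of length at most $k$ is contained in a Hamiltonian cycle; $k$-Hamiltonian ($0\le k\le n-3$) if $G-S$ is Hamiltonian for each set $S$ of at most $k$ vertices; $k$-Hamiltonian-connected ($1\le k\le n-2$) if $G-S$ is Hamiltonian-connected for each set $S$ of fewer than $k$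 vertices; $k$-connected ($1\le k\le n-1$) if $G-S$ is connected for each set $S$ of fewer than $k$ vertices. *)

(* Defs.v *)
From mathcomp Require Import all_boot all_order all_algebra.

Set Implicit Arguments.
Unset Strict Implicit.
Unset Printing Implicit Defensive.

Record sgraph (T : finType) := SGraph {
  adj :> rel T;
  adj_sym : symmetric adj;
  adj_irr : irreflexive adj
}.

Definition isomorphic (T U : finType) (G : sgraph T) (H : sgraph U) : Prop :=
  exists2 f : T -> U, bijective f & forall x y, H (f x) (f y) = G x y.

Section Graph.
Variables (T : finType) (G : sgraph T).

Definition edges : {set {set T}} :=
  [set [set u.1; u.2] | u : T * T & G u.1 u.2].

Definition is_clique (S : {set T}) : bool :=
  [forall x in S, forall y in S, (x != y) ==> G x y].

Definition nb_cliques (t : nat) : nat :=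
  #|[set S : {set T} | (#|S| == t) && is_clique S]|.

Definition clique_free (s : nat) : Prop :=
  forall S : {set T}, is_clique S -> #|S| <> s.

(* [x :: p] lists the vertices of a path in order; its length is [size p]. *)
Definition is_path (x : T) (p : seq T) : bool := path G x p && uniq (x :: p).

Definition is_cycle (c : seq T) : bool := [&& 2 < size c, cycle G c & uniq c].

Definition ham_path (x : T) (p : seq T) : bool :=
  is_path x p && (size (x :: p) == #|T|).

Definition ham_cycle (c : seq T) : bool := is_cycle c && (size c == #|T|).

Definition cycle_edge (c : seq T) : rel T :=
  [rel x y | [&& x \in c, y \in c & (next c x == y) || (next c y == x)]].

Definition has_chord (c : seq T) : Prop :=
  exists x y, [/\ x \in c, y \in c, G x y & ~~ cycle_edge c x y].

Definition traceable : Prop := exists x p, ham_path x p.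

(* In particular graphs on at most two vertices are not Hamiltonian. *)
Definition hamiltonian : Prop := exists c, ham_cycle c.

Definition ham_connected : Prop :=
  forall x y, x != y -> exists2 p, ham_path x p & last x p = y.

Definition chorded_pancyclic : Prop :=
  forall p, 4 <= p <= #|T| ->
    exists c, [/\ is_cycle c, size c = p & has_chord c].

Definition connected : Prop := forall x y, connect G x y.

Definition path_hamiltonian (k : nat) : Prop :=
  forall x p, is_path x p -> size p <= k ->
    exists c, [/\ ham_cycle c, x \in c & path (cycle_edge c) x p].

End Graph.

Section Delete.
Variables (T : finType) (G : sgraph T) (S : {set T}).

Let del_adj : rel {x : T | x \notin S} := fun x y => G (val x) (val y).

Fact del_sym : symmetric del_adj.
Proof. by move=> x y; apply: adj_sym. Qed.

Fact del_irr : irreflexive del_adj.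
Proof. by move=> x; apply: adj_irr. Qed.

Definition del_verts : sgraph {x : T | x \notin S} := SGraph del_sym del_irr.

End Delete.

Section DeletionProperties.
Variables (T : finType) (G : sgraph T) (k : nat).

Definition k_hamiltonian : Prop :=
  forall S : {set T}, #|S| <= k -> hamiltonian (del_verts G S).

Definition k_ham_connected : Prop :=
  forall S : {set T}, #|S| < k -> ham_connected (del_verts G S).

Definition k_connected : Prop :=
  forall S : {set T}, #|S| < k -> connected (del_verts G S).

End DeletionProperties.

Section AddVertex.
Variables (T : finType) (G : sgraph T) (N : {set T}).

Let add_adj : rel (option T) := fun x y =>
  match x, y with
  | Some a, Some b => G a b
  | Some a, None | None, Some a => a \in N
  | None, None => false
  end.

Fact add_sym : symmetric add_adj.
Proof. by move=> [x|] [y|] //=; apply: adj_sym. Qed.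

Fact add_irr : irreflexive add_adj.
Proof. by move=> [x|] //=; apply: adj_irr. Qed.

(* G plus one new vertex, [None], whose neighbourhood is N. *)
Definition add_vertex : sgraph (option T) := SGraph add_sym add_irr.

End AddVertex.

Section Turan.
Variables (n r : nat).

Let turan_adj : rel 'I_n := fun i j => i %% r != j %% r.

Fact turan_sym : symmetric turan_adj.
Proof. by move=> i j; rewrite /turan_adj eq_sym. Qed.

Fact turan_irr : irreflexive turan_adj.
Proof. by move=> i; rewrite /turan_adj eqxx. Qed.

(* T_r(n), for r > 0; the parts are the residue classes mod r. *)
Definition turan : sgraph 'I_n := SGraph turan_sym turan_irr.

End Turan.

(* A <_C B iff max (A \triangle B) belongs to B. *)
Definition colex_lt (n : nat) (A B : {set 'I_n}) : bool :=
  [exists x in B :\: A, forall y in (A :\: B) :|: (B :\: A), y <= x].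

Section ColexTuran.
Variables (n r : nat) (l : int).

(* For l >= -1 the absolute value is l + 1 itself. *)
Definition colex_size : nat := #|edges (turan n.-1 r)| + `|(l + 1)%R|%N.

(* Vertices are numbered from 0 instead of 1, which affects neither
   congruences nor the order. {i, j} is among the first [colex_size] pairs iff
   fewer than [colex_size] pairs precede it; restricting to pairs inside 'I_n
   is harmless since every colex predecessor of a pair inside 'I_n is itself
   inside 'I_n. *)
Let colex_adj : rel 'I_n := fun i j =>
  (i %% r != j %% r) &&
  (#|[set A in edges (turan n r) | colex_lt A [set i; j]]| < colex_size).

Fact colex_sym : symmetric colex_adj.
Proof. by move=> i j; rewrite /colex_adj eq_sym setUC. Qed.

Fact colex_irr : irreflexive colex_adj.
Proof. by move=> i; rewrite /colex_adj eqxx. Qed.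

(* G^{l*}_{n,r}, for -1 <= l <= floor ((r - 1) n / r) - 1. *)
Definition colex_turan : sgraph 'I_n := SGraph colex_sym colex_irr.

End ColexTuran.

Arguments colex_turan (n r)%_N l%_R.

(* Main.v *)
Require Import Defs.
From mathcomp Require Import all_boot all_order all_algebra.
From mathcomp Require Import zify.

(** Let [E m] be the number of edges of the Turan graph with [r] classes on [m]
    vertices, and let [s] be [0], [1], [2], [k + 1], [k + 1], [k + 1], [k - 1] in
    the seven parts. The extremal graph is the Turan graph on [n - 1] vertices
    plus a vertex whose [s] neighbours span a Turan graph with [r - 1] classes
    ([colex_structure], [initial_segment_cl]), so it has [E (n - 1) + s] edges.
    Each upper bound is obtained in three steps.

    From the property to degrees. Hamiltonian cycles, and Hamiltonian paths with
    given ends, persist when an edge between vertices of large degree sum is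
    removed. So the closure argument of Bondy and Chvatal ([stable_low_degrees])
    shows that a graph without them has, for some [h] below half of [n + s], at
    least [h + 1 - s] vertices of degree at most [h]. Traceability reduces to
    Hamiltonicity of the cone, properties defined by deleting vertices reduce to
    the remaining graph, a path is extended to a Hamiltonian cycle by a
    Hamiltonian path between its ends in the graph without its interior, and in a
    disconnected graph a small component supplies the low degrees.

    From degrees to edges. Deleting these vertices and applying Turan's theorem
    to the rest bounds the number of edges by [E (n - 1) + s] when [n] is large
    enough ([low_degrees_few_edges]). For [r = 3] this is too weak when [h] is
    close to [n / 2]; there Erdos's majorisation of the degrees by those of a
    complete tripartite graph is used instead.

    From edges to cliques. A graph without cliques of [r + 1] vertices and with at
    most [E N + s] edges has at most as many [t]-cliques as the Turan graph on
    [N] vertices with a vertex attached as above ([edges_bound_cliques]). The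
    proof deletes a vertex of minimum degree. This works unless the minimum
    degree is exceptionally large, in which case the complement has a small
    component that is as large as its independence number permits, and this
    component can be replaced by Turan graphs.

    A Hamiltonian graph with more than [E (n - 1) + 1] edges is chorded
    pancyclic: it has cycles of all lengths by an argument of Bondy, and a cycle
    without a chord would allow too few edges ([chorded_pancyclic_of_edges]).
    Together with the bound for graphs that are not Hamiltonian this settles
    the pancyclic part.

    That the extremal graphs lack the properties is seen at the extra vertex,
    whose neighbours can be arranged along a path since [r] is at least 3: a
    Hamiltonian cycle through this path would be closed by the extra vertex too
    early, and deleting all but one, two or none of the neighbours refutes the
    other properties. *)

Set Implicit Arguments.
Unset Strict Implicit.
Unset Printing Implicit Defensive.

(** * Clique numbers of Turan graphs *)

(** The number of smaller neighbours of [m] in the graph on the naturals that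
    joins numbers in different residue classes modulo [r]. *)
Definition back_deg (r m : nat) : nat := m - m %/ r.

(** The number of [t]-cliques of the [r]-partite Turan graph on [n] vertices,
    counted by their last vertex [m]: its smaller neighbours again span a
    balanced complete multipartite graph, with one class less. *)
Fixpoint turan_cl (t r n : nat) : nat :=
  if t is t'.+1 then \sum_(m < n) turan_cl t' r.-1 (back_deg r m) else 1.

Lemma turan_clS t r n :
  turan_cl t.+1 r n.+1 = turan_cl t.+1 r n + turan_cl t r.-1 (back_deg r n).
Proof. by rewrite /= big_ord_recr. Qed.

Lemma turan_cl0 t r : turan_cl t.+1 r 0 = 0.
Proof. by rewrite /= big_ord0. Qed.

Lemma turan_cl1 r n : turan_cl 1 r n = n.
Proof. by rewrite /= sum1_card card_ord. Qed.

Arguments turan_cl : simpl never.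

Lemma back_degS r m : back_deg r m <= back_deg r m.+1 <= (back_deg r m).+1.
Proof.
rewrite /back_deg; case: r => [|r]; first by rewrite !divn0; lia.
have h1 : m %/ r.+1 <= m.+1 %/ r.+1 by apply: leq_div2r.
have h2 : m.+1 %/ r.+1 <= (m %/ r.+1).+1.
  by rewrite -ltnS -addn2 ltn_divLR //; have := ltn_ceil m (ltn0Sn r); lia.
have := leq_div m r.+1; lia.
Qed.

Lemma leq_back_deg r m n : m <= n -> back_deg r m <= back_deg r n.
Proof.
by apply: (homo_leq leqnn leq_trans) => {}m; case/andP: (back_degS r m).
Qed.

Lemma back_deg_lip r m d : back_deg r (m + d) <= back_deg r m + d.
Proof.
elim: d => [|d IH]; first by rewrite !addn0.
by rewrite !addnS; case/andP: (back_degS r (m + d)) => _ h; lia.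
Qed.

Lemma leq_back_degr r q m : 0 < q <= r -> back_deg q m <= back_deg r m.
Proof. by case/andP=> h1 h2; apply: leq_sub2l; apply: leq_div2l. Qed.

Lemma back_deg_le r m : back_deg r m <= m.
Proof. exact: leq_subr. Qed.

Lemma leq_turan_cl t r m n : m <= n -> turan_cl t r m <= turan_cl t r n.
Proof.
case: t => [//|t]; apply: (homo_leq leqnn leq_trans) => {}m.
by rewrite turan_clS leq_addr.
Qed.

(** Adding [d] vertices to a larger Turan graph creates at least as many new
    cliques, because the degree at which they attach is nondecreasing. *)
Lemma turan_cl_convex t r x y d : x <= y ->
  turan_cl t r (x + d) + turan_cl t r y <= turan_cl t r x + turan_cl t r (y + d).
Proof.
move=> xy; case: t => [//|t].
elim: d => [|d IH]; first by rewrite !addn0.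
rewrite !addnS !turan_clS.
have := @leq_turan_cl t r.-1 _ _ (leq_back_deg r (_ : x + d <= y + d)).
by rewrite leq_add2r => /(_ xy); lia.
Qed.

(** * Cliques inside a vertex set *)

Section Cliques.
Variables (T : finType) (G : sgraph T).
Implicit Types (A B S : {set T}) (v : T).

Definition nbh A v : {set T} := [set u in A | G v u].

Definition cl A t : nat :=
  #|[set S : {set T} | [&& S \subset A, #|S| == t & is_clique G S]]|.

Definition omega_le A r : Prop :=
  forall S, S \subset A -> is_clique G S -> #|S| <= r.

Lemma is_cliqueP S :
  reflect {in S &, forall x y, x != y -> G x y} (is_clique G S).
Proof.
apply: (iffP forall_inP) => [h x y xS yS|h x xS].
  by move/forall_inP: (h x xS) => /(_ y yS) /implyP.
by apply/forall_inP => y yS; apply/implyP; apply: h.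
Qed.

Lemma nbh_sub A v : nbh A v \subset A.
Proof. by apply/subsetP => u; rewrite inE => /andP[]. Qed.

Lemma nbhS A B v : A \subset B -> nbh A v \subset nbh B v.
Proof.
by move=> /subsetP AB; apply/subsetP => u; rewrite !inE => /andP[/AB -> ->].
Qed.

Lemma clique_setU1 S v : is_clique G S -> {in S, forall u, G v u} ->
  is_clique G (v |: S).
Proof.
move=> /is_cliqueP hS hv; apply/is_cliqueP => x y.
case/setU1P=> [->|xS]; case/setU1P=> [->|yS]; rewrite ?eqxx //.
- by move=> _; apply: hv.
- by move=> _; rewrite adj_sym; apply: hv.
- exact: hS.
Qed.

Lemma sub_clique S S' : S \subset S' -> is_clique G S' -> is_clique G S.
Proof.
move=> /subsetP h /is_cliqueP h'; apply/is_cliqueP => x y xS yS.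
by apply: h'; apply: h.
Qed.

(** Cliques either avoid [v] or arise from a clique in its neighbourhood. This
    recursion, parallel to the one defining [turan_cl], drives all inductions on
    clique counts. *)
Lemma clS A v t : v \in A ->
  cl A t.+1 = cl (A :\ v) t.+1 + cl (nbh A v) t.
Proof.
move=> vA; rewrite /cl.
set X := [set S | _].
rewrite -(cardsID [set S : {set T} | v \in S] X) addnC; congr (_ + _).
  apply: eq_card => /= S; rewrite !inE subsetD1.
  by case: (v \in (S : {set T})); rewrite ?andbF ?andbT //=.
have inj : {in [set S : {set T} | [&& S \subset nbh A v, #|S| == t & is_clique G S]] &,
    injective (fun S : {set T} => v |: S)}.
  move=> S S'; rewrite !inE => /and3P[/subsetP hS _ _] /and3P[/subsetP hS' _ _] eq.
  have nS : v \notin S by apply/negP => /hS; rewrite inE adj_irr andbF.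
  have nS' : v \notin S' by apply/negP => /hS'; rewrite inE adj_irr andbF.
  by rewrite -(setU1K nS) eq setU1K.
rewrite -(card_in_imset inj); apply: eq_card => S; rewrite !inE.
apply/idP/imsetP => [/andP[/and3P[SA cS qS] vS]|[S' ]].
  exists (S :\ v); last by rewrite setD1K.
  rewrite inE; apply/and3P; split.
  - apply/subsetP => u /setD1P[uv uS]; rewrite inE (subsetP SA) //=.
    by move/is_cliqueP: qS; apply=> //; rewrite eq_sym.
  - by move: cS; rewrite (cardsD1 v) vS.
  - by apply: sub_clique qS; apply: subD1set.
rewrite inE => /and3P[/subsetP hS' cS' qS'] ->.
have nS' : v \notin S' by apply/negP => /hS'; rewrite inE adj_irr andbF.
rewrite setU11 andbT cardsU1 nS' add1n eqSS cS' /=; apply/andP; split.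
  by rewrite subUset sub1set vA; apply/subsetP => u /hS'; rewrite inE => /andP[].
by apply: clique_setU1 => // u /hS'; rewrite inE => /andP[].
Qed.

Lemma cl0 A : cl A 0 = 1.
Proof.
apply/eqP/cards1P; exists set0; apply/setP => S; rewrite !inE cards_eq0.
apply/and3P/eqP => [[_ /eqP -> //]|->]; split=> //; first exact: sub0set.
by apply/is_cliqueP => x; rewrite inE.
Qed.

Lemma cl_set0 t : cl set0 t.+1 = 0.
Proof.
apply/eqP; rewrite cards_eq0; apply/eqP/setP => S; rewrite !inE subset0.
by case: eqP => // ->; rewrite cards0.
Qed.

Lemma setD1_ind (P : {set T} -> Prop) : P set0 ->
  (forall A v, v \in A -> P (A :\ v) -> P A) -> forall A, P A.
Proof.
move=> P0 PS A; elim: {A}_.+1 {-2}A (ltnSn #|A|) => // n IH A hA.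
have [->//|/set0Pn[v vA]] := eqVneq A set0.
by apply: (PS A v vA); apply: IH; rewrite (cardsD1 v) vA in hA.
Qed.

Lemma cl1 A : cl A 1 = #|A|.
Proof.
elim/setD1_ind: A => [|A v vA IH]; first by rewrite cl_set0 cards0.
by rewrite (clS _ vA) cl0 IH (cardsD1 v A) vA addn1.
Qed.

Lemma clique_nb_cliques t : nb_cliques G t = cl setT t.
Proof. by apply: eq_card => S; rewrite !inE subsetT. Qed.

Lemma edgeS A v : v \in A -> cl A 2 = cl (A :\ v) 2 + #|nbh A v|.
Proof. by move=> vA; rewrite (clS _ vA) cl1. Qed.

Lemma nbhD1 A v u : v \in A ->
  #|nbh A u| = #|nbh (A :\ v) u| + G u v.
Proof.
move=> vA; rewrite (cardsD1 v (nbh A u)) inE vA /= addnC; congr (_ + _).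
by apply: eq_card => x; rewrite !inE andbA.
Qed.

Lemma handshake A : \sum_(v in A) #|nbh A v| = 2 * cl A 2.
Proof.
elim/setD1_ind: A => [|A v vA IH]; first by rewrite big_set0 cl_set0.
rewrite (big_setD1 v vA) /= (edgeS vA) mulnDr -IH.
rewrite (eq_bigr (fun u => #|nbh (A :\ v) u| + G u v)); last first.
  by move=> u _; apply: nbhD1.
rewrite big_split /=.
suff -> : \sum_(i in A :\ v) G i v = #|nbh A v| by lia.
rewrite (nbhD1 _ vA) adj_irr addn0 -sum1_card big_mkcond /=.
rewrite [RHS]big_mkcond /=; apply: eq_bigr => u _.
by rewrite !inE (adj_sym G u); case: (_ && _) => //=; case: (G v u).
Qed.

Lemma omega_nbh A v r : omega_le A r -> v \in A -> 0 < r /\ omega_le (nbh A v) r.-1.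
Proof.
move=> h vA; split.
  have := h [set v]; rewrite cards1 sub1set; apply=> //.
  by apply/is_cliqueP => x y /set1P-> /set1P->; rewrite eqxx.
move=> S /subsetP hS qS.
have nS : v \notin S by apply/negP => /hS; rewrite inE adj_irr andbF.
have := h (v |: S); rewrite cardsU1 nS subUset sub1set vA.
have -> : S \subset A by apply/subsetP => u /hS; rewrite inE => /andP[].
have qvS : is_clique G (v |: S).
  by apply: clique_setU1 => // u /hS; rewrite inE => /andP[].
by move=> /(_ isT qvS); case: (r) => //.
Qed.

Lemma omega_sub A B r : A \subset B -> omega_le B r -> omega_le A r.
Proof. by move=> AB h S SA; apply: h; apply: subset_trans AB. Qed.

Lemma omega0 A : omega_le A 0 -> A = set0.
Proof.
move=> h; apply/eqP; apply: contraT => /set0Pn[v vA].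
by have [] := omega_nbh h vA.
Qed.

Lemma nbh_card A v : v \in A -> #|nbh A v| < #|A|.
Proof.
move=> vA; apply: proper_card; rewrite properEneq nbh_sub andbT.
by apply/eqP => eq; rewrite -eq inE adj_irr andbF in vA.
Qed.

(** If every vertex of [A] misses at most [z] vertices, one can build a clique
    vertex by vertex, each step giving up at most [z] candidates. *)
Lemma omega_card A z r : omega_le A r ->
  {in A, forall v, #|A| <= #|nbh A v| + z} -> #|A| <= r * z.
Proof.
elim: r A => [|r IH] A om hz; first by rewrite (omega0 om) cards0.
have [->|/set0Pn[v vA]] := eqVneq A set0; first by rewrite cards0.
have [_ omN] := omega_nbh om vA.
suff hN : #|nbh A v| <= r * z by have := hz v vA; rewrite mulSn; lia.
apply: IH => // u uN; have uA := subsetP (nbh_sub A v) u uN.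
rewrite -(cardsID (nbh A u) (nbh A v)).
have -> : nbh A v :&: nbh A u = nbh (nbh A v) u.
  by apply/setP => x; rewrite !inE; case: (x \in A) => //=.
rewrite leq_add2l; apply: (@leq_trans #|A :\: nbh A u|).
  by apply/subset_leq_card/setSD/nbh_sub.
by rewrite cardsDS ?nbh_sub // leq_subLR hz.
Qed.

Lemma turan_min_deg A r : omega_le A r -> A != set0 ->
  exists2 v, v \in A & #|nbh A v| <= back_deg r #|A|.-1.
Proof.
move=> om A0; apply/exists_inP; apply: contraT; rewrite negb_exists_in => /forall_inP h.
have A1 : 0 < #|A| by rewrite card_gt0.
have : #|A| <= r * (#|A|.-1 %/ r).
  apply: omega_card om _ => v vA; move: (h v vA); rewrite -ltnNge /back_deg.
  by have := nbh_card vA; lia.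
by rewrite mulnC; have := leq_trunc_div #|A|.-1 r; lia.
Qed.

(** Zykov's theorem. A vertex of minimum degree has at most as many neighbours
    as the last vertex of the Turan graph, so deleting it gives the same
    recursion as for the Turan graph, with inequality. *)
Lemma zykov A r t : omega_le A r -> cl A t <= turan_cl t r #|A|.
Proof.
elim: {A}_.+1 {-2}A (ltnSn #|A|) r t => // n IH A hA r [|t] om.
  by rewrite cl0.
have [->|A0] := eqVneq A set0; first by rewrite cl_set0.
have [v vA dv] := turan_min_deg om A0.
have [_ omN] := omega_nbh om vA.
have cA : #|A| = #|A :\ v|.+1 by rewrite (cardsD1 v) vA.
rewrite (clS _ vA) cA turan_clS; apply: leq_add.
  by apply: IH; [rewrite -ltnS -cA | apply: omega_sub om; apply: subD1set].
apply: leq_trans (leq_turan_cl _ _ (_ : _ <= _)).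
  by apply: IH omN; have := nbh_card vA; lia.
by move: dv; rewrite cA.
Qed.

End Cliques.

(** * Edge numbers of Turan graphs *)

Lemma back_degE p q j : j <= p -> back_deg p.+1 (q * p.+1 + j) = q * p + j.
Proof. by move=> jp; rewrite /back_deg divnMDl // divn_small // mulnS; lia. Qed.

Lemma turan_edgesS r n : turan_cl 2 r n.+1 = turan_cl 2 r n + back_deg r n.
Proof. by rewrite turan_clS turan_cl1. Qed.

(** The closed form stays valid at [j = p.+1], where it agrees with the form
    for the next quotient; the induction over [q] uses this overlap. *)
Lemma turan_edgesE p q j : j <= p.+1 ->
  2 * turan_cl 2 p.+1 (q * p.+1 + j) = q * q * p.+1 * p + 2 * q * j * p + j * j.-1.
Proof.
elim: q j => [|q IHq]; elim=> [|j IHj] hj.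
- by rewrite turan_cl0.
- rewrite addnS turan_edgesS back_degE // mulnDr IHj; last by lia.
  by case: j {IHj} hj => [|j] hj; nia.
- have -> : q.+1 * p.+1 + 0 = q * p.+1 + p.+1 by rewrite mulSn; lia.
  by rewrite IHq // /=; nia.
- rewrite addnS turan_edgesS back_degE // mulnDr IHj; last by lia.
  by case: j {IHj} hj => [|j] hj; nia.
Qed.

(** * Joins *)

Lemma setU_setD (T : finType) (C X : {set T}) : C \subset X -> C :|: (X :\: C) = X.
Proof. by move=> /setIidPr CX; rewrite -{1}CX setID. Qed.

Section Join.
Variables (T : finType) (G : sgraph T).
Implicit Types (C D S : {set T}).

Definition joined C D : Prop := {in C & D, forall x y, G x y}.

Lemma joined_disjoint C D : joined C D -> [disjoint C & D].
Proof.
move=> j; rewrite -setI_eq0; apply/eqP/setP => x; rewrite !inE.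
by apply/negP => /andP[xC xD]; have := j _ _ xC xD; rewrite adj_irr.
Qed.

Lemma nbh_join C D v : joined C D -> v \in D -> nbh G (C :|: D) v = C :|: nbh G D v.
Proof.
move=> j vD; apply/setP => x; rewrite !inE andb_orl; congr (_ || _).
by case xC: (x \in C) => //=; rewrite adj_sym j.
Qed.

Lemma cl_join C D t : joined C D ->
  cl G (C :|: D) t = \sum_(i < t.+1) cl G C i * cl G D (t - i).
Proof.
elim: {D}_.+1 {-2}D (ltnSn #|D|) t => // n IH D hD t j.
have [->|/set0Pn[v vD]] := eqVneq D set0.
  rewrite setU0 big_ord_recr /= subnn cl0 muln1 big1 // => i _.
  have -> : t - i = (t - i).-1.+1 by have := ltn_ord i; lia.
  by rewrite cl_set0 muln0.
case: t => [|t]; first by rewrite big_ord1 !cl0.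
have vC : v \notin C by apply/negP => vC; have := j _ _ vC vD; rewrite adj_irr.
have hcard : #|D :\ v| < n by rewrite (cardsD1 v) vD in hD.
have jD (B : {set T}) : B \subset D -> joined C B by move=> /subsetP h x y xC /h; apply: j.
have vCD : v \in C :|: D by rewrite inE vD orbT.
rewrite (clS G _ vCD) nbh_join //.
have -> : (C :|: D) :\ v = C :|: (D :\ v).
  by apply/setP => x; rewrite !inE; case: eqP => [->|] //=; rewrite (negPf vC).
rewrite !IH //; first last.
- exact/jD/subD1set.
- exact/jD/nbh_sub.
- by have := nbh_card G vD; lia.
rewrite big_ord_recr [in RHS]big_ord_recr /= subnn !cl0 addnAC; congr (_ + _).
rewrite -big_split /=; apply: eq_bigr => i _.
by rewrite -mulnDr subSn ?(clS G _ vD) // -ltnS.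
Qed.

Lemma join_edges C D : joined C D ->
  cl G (C :|: D) 2 = cl G C 2 + #|C| * #|D| + cl G D 2.
Proof.
by move=> j; rewrite cl_join // !big_ord_recr big_ord0 /= -[2 - 0]/2 -[2 - 1]/1 -[2 - 2]/0 !cl0 !cl1; lia.
Qed.

Lemma card_join C D : joined C D -> #|C :|: D| = #|C| + #|D|.
Proof. by move/joined_disjoint => h; rewrite cardsU (disjoint_setI0 h) cards0 subn0. Qed.

Lemma omega_join C D a b : omega_le G C a -> omega_le G D b ->
  omega_le G (C :|: D) (a + b).
Proof.
move=> hC hD S SCD qS.
have -> : S = (S :&: C) :|: (S :&: D) by rewrite -setIUr (setIidPl SCD).
apply: leq_trans (leq_card_setU _ _) _; apply: leq_add.
- by apply: hC; [apply: subsetIr | apply: sub_clique qS; apply: subsetIl].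
- by apply: hD; [apply: subsetIr | apply: sub_clique qS; apply: subsetIl].
Qed.

Lemma clique_join C D S S' : joined C D -> S \subset C -> S' \subset D ->
  is_clique G S -> is_clique G S' -> is_clique G (S :|: S').
Proof.
move=> j /subsetP SC /subsetP SD /is_cliqueP qS /is_cliqueP qS'.
apply/is_cliqueP => x y; case/setUP=> hx; case/setUP=> hy nxy.
- exact: qS.
- by apply: j; [apply: SC | apply: SD].
- by rewrite adj_sym; apply: j; [apply: SC | apply: SD].
- exact: qS'.
Qed.

Lemma omega_joinD C D S w : joined C D -> omega_le G (C :|: D) w ->
  S \subset C -> is_clique G S -> omega_le G D (w - #|S|).
Proof.
move=> j om SC qS R RD qR.
have dis : #|S :|: R| = #|S| + #|R|.
  by apply: card_join => x y /(subsetP SC) xC /(subsetP RD); apply: j.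
rewrite leq_subRL -?dis; first by apply: om; [apply: setUSS|apply: clique_join j _ _ _ _].
by apply: om => //; apply: subset_trans SC (subsetUl _ _).
Qed.

End Join.

(** The clique sequence of a join only depends on those of its two sides. *)
Lemma cl_join_replace (T T1 T2 : finType) (G : sgraph T) (G1 : sgraph T1)
    (G2 : sgraph T2) (C D : {set T}) (C1 D1 : {set T1}) (C2 D2 : {set T2}) t :
  joined G C D -> joined G1 C1 D1 -> joined G2 C2 D2 ->
  (forall i, cl G1 D1 i = cl G D i) -> (forall i, cl G2 D2 i = cl G D i) ->
  (forall i, cl G C i.+1 <= cl G1 C1 i.+1 + cl G2 C2 i) ->
  cl G (C :|: D) t.+1 <= cl G1 (C1 :|: D1) t.+1 + cl G2 (C2 :|: D2) t.
Proof.
move=> j j1 j2 e1 e2 h; rewrite !cl_join // big_ord_recl [in leqRHS]big_ord_recl /=.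
rewrite !cl0 e1 -addnA leq_add2l -big_split /=; apply: leq_sum => i _.
rewrite /bump /= !add1n e1 e2 -mulnDl.
by rewrite leq_mul2r h orbT.
Qed.

Lemma cl_inj (T U : finType) (G : sgraph T) (H : sgraph U) (f : T -> U) (A : {set T}) t :
  injective f -> {in A &, forall x y, H (f x) (f y) = G x y} ->
  cl H (f @: A) t = cl G A t.
Proof.
move=> fi hf; elim: {A}_.+1 {-2}A (ltnSn #|A|) t hf => // n IH A hA t hf.
have [->|/set0Pn[v vA]] := eqVneq A set0.
  by rewrite imset0; case: t => [|t]; rewrite ?cl0 ?cl_set0.
case: t => [|t]; first by rewrite !cl0.
rewrite (clS G _ vA) (clS H _ (imset_f f vA)).
have hfS (B : {set T}) : B \subset A -> {in B &, forall x y, H (f x) (f y) = G x y}.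
  by move=> /subsetP s x y /s xA /s yA; apply: hf.
rewrite -(IH (A :\ v)); first last.
- exact/hfS/subD1set.
- by rewrite (cardsD1 v) vA in hA.
rewrite -(IH (nbh G A v)); first last.
- exact/hfS/nbh_sub.
- by have := nbh_card G vA; lia.
congr (cl H _ _ + cl H _ _).
  apply/setP => y; rewrite !inE; apply/andP/imsetP => [[nyv /imsetP[x xA ey]]|[x]].
    by exists x; rewrite // !inE xA andbT; apply: contra nyv => /eqP <-; rewrite ey.
  by rewrite !inE => /andP[nxv xA] ->; rewrite imset_f // inj_eq // nxv.
apply/setP => y; rewrite inE; apply/andP/imsetP => [[/imsetP[x xA ->]]|[x]].
  by rewrite hf // => gvx; exists x; rewrite // inE xA.
by rewrite inE => /andP[xA gvx] ->; rewrite imset_f // hf.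
Qed.

(** The join of a Turan graph with a graph [G], on a disjoint union of vertex
    types. It realises the two graphs that replace one side of a join in
    [cl_join_replace]. *)
Section TuranJoin.
Variables (n q : nat) (T : finType) (G : sgraph T).
Implicit Types (D : {set T}).

Let tj_adj : rel ('I_n + T) := fun x y =>
  match x, y with
  | inl i, inl j => turan n q i j
  | inr a, inr b => G a b
  | _, _ => true
  end.

Fact tj_sym : symmetric tj_adj.
Proof. by move=> [x|x] [y|y] //=; [rewrite eq_sym | apply: adj_sym]. Qed.

Fact tj_irr : irreflexive tj_adj.
Proof. by move=> [x|x] /=; [rewrite eqxx | apply: adj_irr]. Qed.

Definition turan_join : sgraph ('I_n + T)%type := SGraph tj_sym tj_irr.

Definition tj_left : {set 'I_n + T} := inl @: [set: 'I_n].
Definition tj_right (D : {set T}) : {set 'I_n + T} := inr @: D.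

Lemma tj_joined D : joined turan_join tj_left (tj_right D).
Proof. by move=> x y /imsetP[i _ ->] /imsetP[d _ ->]. Qed.

Lemma inl_injT : injective (@inl 'I_n T). Proof. by move=> x y []. Qed.
Lemma inr_injT : injective (@inr 'I_n T). Proof. by move=> x y []. Qed.

Lemma tj_cl_right D t : cl turan_join (tj_right D) t = cl G D t.
Proof. exact: (cl_inj _ inr_injT). Qed.

Lemma tj_cl_left t : cl turan_join tj_left t = cl (turan n q) setT t.
Proof. exact: (cl_inj _ inl_injT). Qed.

Lemma card_tj_left : #|tj_left| = n.
Proof. by rewrite card_imset ?cardsT ?card_ord //; apply: inl_injT. Qed.

Lemma card_tj_right D : #|tj_right D| = #|D|.
Proof. by rewrite card_imset //; apply: inr_injT. Qed.

End TuranJoin.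

Lemma omega_imset (T U : finType) (G : sgraph T) (H : sgraph U) (f : T -> U) (A : {set T}) r :
  injective f -> {in A &, forall x y, H (f x) (f y) = G x y} ->
  omega_le G A r -> omega_le H (f @: A) r.
Proof.
move=> fi hf om S SA qS.
have eS : S = f @: (A :&: f @^-1: S).
  apply/setP => y; apply/idP/imsetP => [yS|[x]]; last by rewrite !inE => /andP[_ h] ->.
  by have /imsetP[x xA e] := subsetP SA y yS; exists x; rewrite // !inE xA -e.
rewrite eS card_imset //; apply: om; first exact: subsetIl.
apply/is_cliqueP => x y; rewrite !inE => /andP[xA xS] /andP[yA yS] nxy.
rewrite -hf //; move/is_cliqueP: qS; apply=> //.
by apply: contra nxy => /eqP/fi->.
Qed.

Lemma omega_turan n q : (q = 0 -> n = 0) -> omega_le (turan n q) setT q.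
Proof.
case: q => [|q] h S _ qS.
  by rewrite -[leqRHS](h erefl) -[leqRHS]card_ord max_card.
have inj : {in S &, injective (fun i : 'I_n => inord (i %% q.+1) : 'I_q.+1)}.
  move=> i j iS jS /(congr1 val) /=; rewrite !inordK ?ltn_mod // => e.
  apply/eqP; apply: contraT => nij.
  by move/is_cliqueP: qS => /(_ i j iS jS nij) /=; rewrite e eqxx.
by rewrite -(card_in_imset inj) -[leqRHS]card_ord max_card.
Qed.

Lemma omega_tj n q (T : finType) (G : sgraph T) (D : {set T}) b : (q = 0 -> n = 0) ->
  omega_le G D b -> omega_le (turan_join n q G) (tj_left n T :|: tj_right n D) (q + b).
Proof.
move=> h hD; apply: omega_join.
  by apply: (omega_imset _ _ (omega_turan h)); [apply: inl_injT|].
by apply: (omega_imset _ _ hD); [apply: inr_injT|].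
Qed.

(** * Balanced complete multipartite graphs *)

Lemma sum_const_seq (I : Type) (s : seq I) m : \sum_(i <- s) m = size s * m.
Proof. by rewrite big_const_seq count_predT iter_addn_0 mulnC. Qed.

Section Balanced.
Variables (T : finType) (G : sgraph T) (f : T -> nat).
Implicit Types (A : {set T}) (C : seq nat).

Definition color_class A c : {set T} := [set x in A | f x == c].

(** Given by a colouring and a list of colours instead of a partition, so that
    classes may be empty, as for a Turan graph with fewer vertices than
    classes. *)
Record balanced A C : Prop := Balanced {
  bal_uniq : uniq C;
  bal_adj : {in A &, forall x y, G x y = (f x != f y)};
  bal_col : {in A, forall x, f x \in C};
  bal_size : {in C &, forall c d, #|color_class A c| <= #|color_class A d|.+1} }.

Lemma card_classes A C : uniq C -> {in A, forall x, f x \in C} ->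
  #|A| = \sum_(c <- C) #|color_class A c|.
Proof.
move=> uC hC; rewrite -sum1_card.
rewrite (eq_bigr (fun x => \sum_(c <- C) (f x == c))); last first.
  move=> x xA; rewrite (bigD1_seq (f x)) //= ?hC // eqxx big1 // => c.
  by rewrite eq_sym => /negPf->.
rewrite exchange_big /=; apply: eq_bigr => c _; rewrite -sum1_card big_mkcond /=.
by rewrite [RHS]big_mkcond /=; apply: eq_bigr => x _; rewrite inE; case: (x \in A); case: eqP.
Qed.

Lemma max_class A v : v \in A -> exists2 w, w \in A &
  {in A, forall x, #|color_class A (f x)| <= #|color_class A (f w)|}.
Proof.
move=> vA; pose w := [arg max_(x > v in A) #|color_class A (f x)|].
by exists w; rewrite /w; case: arg_maxnP => // x xA h y; apply: h.
Qed.

(** The largest class has the size that [back_deg] predicts for the class of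
    the last vertex. *)
Lemma balanced_largest A C w : balanced A C -> w \in A ->
  {in A, forall x, #|color_class A (f x)| <= #|color_class A (f w)|} ->
  #|A|.-1 %/ size C = #|color_class A (f w)|.-1.
Proof.
move=> b wA hw; set m := #|color_class A (f w)|.
have m0 : 0 < m by apply/card_gt0P; exists w; rewrite inE wA eqxx.
have hm c : c \in C -> m.-1 <= #|color_class A c| <= m.
  move=> cC; apply/andP; split.
    by have := bal_size b (bal_col b wA) cC; rewrite -/m; lia.
  have [->|/set0Pn[x]] := eqVneq (color_class A c) set0; first by rewrite cards0.
  by rewrite inE => /andP[xA /eqP <-]; apply: hw.
have eA := card_classes (bal_uniq b) (bal_col b).
have wC := bal_col b wA.
have up : #|A| <= size C * m.
  rewrite eA big_seq -sum_const_seq [X in _ <= X]big_seq.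
  by apply: leq_sum => c /hm/andP[].
have lo : size C * m.-1 < #|A|.
  rewrite eA (bigD1_seq _ wC (bal_uniq b)) /= -/m.
  have -> : size C * m.-1 = m.-1 + \sum_(c <- C | c != f w) m.-1.
    by rewrite -sum_const_seq (bigD1_seq _ wC (bal_uniq b)).
  rewrite -addSn prednK // leq_add2l big_seq_cond [X in _ <= X]big_seq_cond.
  by apply: leq_sum => c /andP[/hm/andP[]].
have sC : 0 < size C by case: (C) wC.
by apply/eqP; rewrite eqn_leq -ltnS ltn_divLR // leq_divRL //; nia.
Qed.

Lemma class_D1 A w c :
  color_class (A :\ w) c = if c == f w then color_class A c :\ w else color_class A c.
Proof.
apply/setP => x; case: eqP => [->|nc]; rewrite !inE ?andbA //.
by case: eqP => [->|] //=; case: eqP nc => [->|]; rewrite ?andbF.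
Qed.

(** Delete a vertex [w] of a largest class: the rest stays balanced, and its
    neighbourhood is balanced in the remaining colours. *)
Lemma balanced_cl A C t : balanced A C -> cl G A t = turan_cl t (size C) #|A|.
Proof.
elim: {A}_.+1 {-2}A (ltnSn #|A|) C t => // n IH A hA C t b.
have [->|/set0Pn[v vA]] := eqVneq A set0.
  by rewrite cards0; case: t => [|t]; rewrite ?cl0 // cl_set0 turan_cl0.
case: t => [|t]; first by rewrite cl0.
have [w wA hw] := max_class vA.
have q1 := balanced_largest b wA hw.
have wC := bal_col b wA.
have m0 : 0 < #|color_class A (f w)| by apply/card_gt0P; exists w; rewrite inE wA eqxx.
have eN : nbh G A w = A :\: color_class A (f w).
  apply/setP => x; rewrite !inE; case xA: (x \in A) => //=; rewrite ?andbF //.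
  by rewrite (bal_adj b) // andbT eq_sym.
have cN : #|nbh G A w| = back_deg (size C) #|A|.-1.
  rewrite eN cardsDS; last by apply/subsetP => x; rewrite inE => /andP[].
  by rewrite /back_deg q1; lia.
have cA : #|A| = #|A :\ w|.+1 by rewrite (cardsD1 w) wA.
rewrite (clS G _ wA) cA turan_clS; congr (_ + _).
  apply: IH; first by rewrite -ltnS -cA.
  case: b => b1 b2 b3 b4; split=> //.
  - by move=> x y /setD1P[_ xA] /setD1P[_ yA]; apply: b2.
  - by move=> x /setD1P[_ xA]; apply: b3.
  - move=> c d cC dC; rewrite !class_D1.
    have e1 : #|color_class A (f w)| = #|color_class A (f w) :\ w|.+1.
      by rewrite (cardsD1 w) inE wA eqxx.
    have hc e : e \in C -> #|color_class A e| <= #|color_class A (f w)|.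
      move=> eC; have [->|/set0Pn[x]] := eqVneq (color_class A e) set0; first by rewrite cards0.
      by rewrite inE => /andP[xA /eqP <-]; apply: hw.
    have := b4 _ _ cC dC; have := hc c cC.
    by case: (c =P f w) => [->|_]; case: (d =P f w) => [->|_]; lia.
have -> : (size C).-1 = size (rem (f w) C) by rewrite size_rem.
have -> : back_deg (size C) #|A :\ w| = #|nbh G A w| by rewrite cN cA.
apply: IH; first by have := nbh_card G wA; lia.
case: b => b1 b2 b3 b4.
have hcls c : c != f w -> color_class (nbh G A w) c = color_class A c.
  move=> nc; apply/setP => x; rewrite eN !inE; case: (x \in A) => //=; rewrite ?andbT ?andbF //.
  by case: (f x =P c) => [->|]; rewrite ?andbF // nc.
split.
- exact: rem_uniq.
- by move=> x y /(subsetP (nbh_sub _ _ _)) xA /(subsetP (nbh_sub _ _ _)) yA; apply: b2.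
- move=> x; rewrite eN !inE => /andP[/nandP[/negP//|nx] xA].
  by rewrite mem_rem_uniq // inE nx b3.
- move=> c d; rewrite !mem_rem_uniq // !inE => /andP[nc cC] /andP[nd dC].
  by rewrite !hcls //; apply: b4.
Qed.

End Balanced.

Lemma count_residue r c n : c < r ->
  #|[set i : 'I_n | i %% r == c]| = (n + r.-1 - c) %/ r.
Proof.
move=> cr; elim: n => [|n IH].
  rewrite divn_small; last by lia.
  by apply/eqP; rewrite cards_eq0; apply/eqP/setP => -[].
rewrite -sum1_card big_mkcond big_ord_recr /= inE /=.
rewrite (eq_bigr (fun i : 'I_n => if i \in [set i : 'I_n | i %% r == c] then 1 else 0)); last first.
  by move=> i _; rewrite !inE.
rewrite -big_mkcond sum1_card IH.
have en := divn_eq n r.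
have := ltn_pmod n (leq_ltn_trans (leq0n c) cr); move: en; set m := n %% r; set q := n %/ r => en hm.
have -> : n + r.-1 - c = q * r + (m + r.-1 - c) by lia.
have -> : n.+1 + r.-1 - c = q * r + (m + r - c) by lia.
rewrite !divnMDl; try lia.
case: eqP => [<-|nmc].
  rewrite [m + r - m](_ : _ = r); last by lia.
  by rewrite divnn (leq_ltn_trans _ cr) // divn_small //; lia.
have [lt|ge] := ltnP m c; first by rewrite !divn_small //; lia.
have -> : m + r.-1 - c = 1 * r + (m - c.+1) by lia.
have -> : m + r - c = 1 * r + (m - c) by lia.
by rewrite !divnMDl ?divn_small //; lia.
Qed.

Lemma leq_residue r c d n : c < r -> d < r ->
  #|[set i : 'I_n | i %% r == c]| <= #|[set i : 'I_n | i %% r == d]|.+1.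
Proof.
move=> cr dr; rewrite !count_residue //.
apply: (@leq_trans ((n + r.-1 - d + 1 * r) %/ r)); first by apply: leq_div2r; lia.
by rewrite [X in X %/ r]addnC divnMDl ?add1n //; lia.
Qed.

Lemma turan_nb_cliques n q t : (q = 0 -> n = 0) ->
  nb_cliques (turan n q) t = turan_cl t q n.
Proof.
move=> hq; rewrite clique_nb_cliques.
rewrite (@balanced_cl _ _ (fun i : 'I_n => i %% q) _ (iota 0 q)).
  by rewrite size_iota cardsT card_ord.
case: q hq => [|q] hq.
  by rewrite hq //; split=> //; case.
split=> //.
- exact: iota_uniq.
- by move=> x _; rewrite mem_iota add0n ltn_mod.
- move=> c d; rewrite !mem_iota !add0n => /= hc hd.
  have e x : color_class (fun i : 'I_n => i %% q.+1) setT x = [set i : 'I_n | i %% q.+1 == x].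
    by apply/setP => i; rewrite !inE.
  by rewrite !e leq_residue.
Qed.

(** * Splitting off a component of the complement *)

Section Components.
Variables (T : finType) (G : sgraph T) (A : {set T}) (q : nat).
Hypothesis miss : {in A, forall v, #|A :\: nbh G A v| <= q.+1}.
Implicit Types (C S X : {set T}).

(** In the complement graph, [X] is a union of connected components. *)
Definition detached X : Prop := X \subset A /\ joined G X (A :\: X).

Let non_nbh S : {set T} := \bigcup_(v in S) (A :\: nbh G A v).

Lemma omega_exact C : exists w, omega_le G C w /\
  exists S, [/\ S \subset C, is_clique G S & #|S| = w].
Proof.
have h0 : (set0 \subset C) && is_clique G set0.
  by rewrite sub0set; apply/is_cliqueP => x; rewrite inE.
case: (@arg_maxnP _ set0 (fun S => (S \subset C) && is_clique G S)
   (fun S => #|S|) h0) => S /andP[SC qS] hS.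
exists #|S|; split; last by exists S.
by move=> S' SC' qS'; apply: hS; rewrite SC'.
Qed.

(** Grow a clique [S] by vertices that have a non-neighbour among the
    non-neighbours of [S]: each new vertex brings at most [q] new
    non-neighbours, so when no such vertex is left the set of non-neighbours
    is detached and has at most [q * #|S| + 1] vertices. *)
Lemma greedy_detached X : detached X -> X != set0 ->
  exists C S, [/\ detached C, C \subset X, S \subset C, is_clique G S &
    0 < #|S| /\ #|C| <= q * #|S| + 1].
Proof.
case=> XA jX /set0Pn[x0 x0X].
pose P S := [&& S \subset X, is_clique G S, 0 < #|S| & #|non_nbh S| <= q * #|S| + 1].
have P0 : P [set x0].
  rewrite /P sub1set x0X cards1 /= /non_nbh big_set1 muln1 addn1 miss ?(subsetP XA) // andbT.
  by apply/is_cliqueP => x y /set1P-> /set1P->; rewrite eqxx.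
case: (@arg_maxnP _ [set x0] P (fun S => #|S|) P0) => S /and4P[SX qS S0 hS] maxS.
have inC x : reflect (exists2 v, v \in S & (x \in A) && ~~ G v x) (x \in non_nbh S).
  apply: (iffP bigcupP) => [[v vS]|[v vS]].
    by rewrite !inE negb_and => /andP[/orP[/negPf->//|nx] xA]; exists v; rewrite // xA.
  by move=> /andP[xA nx]; exists v; rewrite // !inE negb_and nx orbT.
have CX : non_nbh S \subset X.
  apply/subsetP => x /inC[v vS /andP[xA nx]]; apply: contraR nx => xX.
  by apply: jX; [apply: (subsetP SX) | rewrite inE xX].
have SC : S \subset non_nbh S.
  apply/subsetP => x xS; apply/inC; exists x => //.
  by rewrite adj_irr (subsetP XA) // (subsetP SX).
exists (non_nbh S), S; split=> //; split; first exact: subset_trans XA.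
move=> x y xC; rewrite inE => /andP[yC yA].
apply: contraR yC => nxy; apply: contraT => yC.
have yX : y \in X.
  apply: contraR nxy => yX; apply: jX; first exact: (subsetP CX).
  by rewrite inE yX.
have yS : y \notin S by apply: contra yC; apply: (subsetP SC).
have hy : {in S, forall u, G y u}.
  move=> u uS; apply: contraR yC => ngu; apply/inC; exists u => //.
  by rewrite yA adj_sym ngu.
have : P (y |: S).
  rewrite /P subUset sub1set yX SX clique_setU1 // cardsU1 yS /= add1n /=.
  have -> : non_nbh (y |: S) = non_nbh S :|: (A :\: nbh G A y) by rewrite /non_nbh big_setU1 //= setUC.
  have := cardsUI (non_nbh S) (A :\: nbh G A y).
  have : 0 < #|non_nbh S :&: (A :\: nbh G A y)|.
    apply/card_gt0P; exists x; rewrite inE xC !inE adj_sym (negPf nxy) andbF /=.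
    exact: (subsetP XA) (subsetP CX _ xC).
  by have := miss yA; rewrite mulnS; move: hS; clear; lia.
by move/maxS; rewrite /= cardsU1 yS add1n ltnn.
Qed.

Lemma detachedD X C : detached X -> detached C -> C \subset X -> detached (X :\: C).
Proof.
case=> XA jX [CA jC] CX; split; first exact: subset_trans (subsetDl _ _) XA.
move=> x y; rewrite !inE => /andP[xC xX] /andP[]; rewrite negb_and negbK => /orP[yC|yX] yA.
  by rewrite adj_sym jC // inE xC (subsetP XA).
by rewrite jX // inE yX.
Qed.

(** Cliques of detached sets add up, so a set larger than [q] times its clique
    number contains a piece with the same property that is a single greedy
    step. *)
Lemma tight_component X w : detached X -> omega_le G X w -> q * w < #|X| ->
  exists C a, [/\ detached C, C \subset X, omega_le G C a, #|C| = q * a + 1 &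
    exists S, [/\ S \subset C, is_clique G S & #|S| = a]].
Proof.
elim: {X}_.+1 {-2}X (ltnSn #|X|) w => // n IH X hX w dX oX hw.
have X0 : X != set0 by rewrite -card_gt0; lia.
have [C [S [dC CX SC qS [S0 hS]]]] := greedy_detached dX X0.
have [a [oC [S' [SC' qS' cS']]]] := omega_exact C.
have [lt|ge] := ltnP (q * a) #|C|.
  exists C, a; split=> //; last by exists S'.
  have : q * #|S| <= q * a by rewrite leq_mul2l (oC _ SC qS) orbT.
  by lia.
have dD := detachedD dX dC CX.
have cD : #|X :\: C| = #|X| - #|C| by rewrite cardsDS.
have aw : a <= w by rewrite -cS'; apply: oX => //; apply: subset_trans CX.
have C0 : 0 < #|C| by apply: leq_trans S0 (subset_leq_card SC).
have CX' := subset_leq_card CX.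
case: (IH (X :\: C) _ (w - a)) => //.
- by lia.
- have jCD : joined G C (X :\: C).
    by move=> x y xC /setDP[yX yC]; case: dC => _; apply; rewrite // inE yC; case: dX => /subsetP->.
  rewrite -cS'; apply: (omega_joinD jCD) => //.
  by rewrite setU_setD.
- have : q * a <= q * w by rewrite leq_mul2l aw orbT.
  by rewrite cD mulnBr; lia.
move=> C' [b [dC' CD oC' cC' hS']]; exists C', b; split=> //.
exact: subset_trans CD (subsetDl _ _).
Qed.

End Components.

(** * Cliques from edges *)

(** How the parameters of the bound change when a vertex of degree [d] is
    deleted. If [d] is at most [s], it is absorbed by [s]; otherwise the Turan
    part loses its last vertex, whose edges are redistributed. Convexity of the
    clique numbers makes both changes favourable. *)
Lemma delete_vertex_bound t r N s d :
  s <= back_deg r N -> d <= s \/ (s < d <= back_deg r N.-1 /\ 0 < N) ->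
  exists N' s', [/\ s' <= back_deg r N',
    turan_cl 2 r N + s = turan_cl 2 r N' + s' + d &
    turan_cl t.+2 r N' + turan_cl t.+1 r.-1 s' + turan_cl t.+1 r.-1 d
      <= turan_cl t.+2 r N + turan_cl t.+1 r.-1 s].
Proof.
move=> hs [ds|[/andP[sd]]].
  exists N, (s - d); split; [lia|lia|].
  have := @turan_cl_convex t.+1 r.-1 0 (s - d) d (leq0n _).
  by rewrite add0n turan_cl0 subnK //; lia.
case: N hs => // N hs /= dN _.
exists N, (back_deg r N + s - d); split; [lia|by rewrite turan_edgesS; lia|].
have := @turan_cl_convex t.+1 r.-1 s (back_deg r N + s - d) (d - s).
rewrite subnKC; last exact: ltnW.
have -> : back_deg r N + s - d + (d - s) = back_deg r N by lia.
by rewrite turan_clS; lia.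
Qed.

(** The case in which neither change of [delete_vertex_bound] is possible. Here
    the minimum degree [d] exceeds that of the Turan graph on [N] vertices,
    while there are fewer edges than in the next one. Comparing degree sums
    leaves exactly [N.+1] vertices and [d = N - q], so that no vertex has more
    than [q] non-neighbours besides itself. *)
Lemma large_min_deg p N s d M : 0 < N -> 0 < M -> s < d -> back_deg p.+1 N.-1 < d ->
  s < back_deg p.+1 N -> M * d <= 2 * (turan_cl 2 p.+1 N + s) ->
  d <= back_deg p.+1 M.-1 ->
  exists q j x, [/\ N = q * p.+1 + j, 0 < j < p, M = N.+1 /\ d = q * p + j,
    s = q * p + j - x & 0 < x <= q * p + j /\ 2 * x <= (p - j) * q].
Proof.
move=> N0 M0 sd Nd sN hM dM.
have NM : N < M.
  rewrite ltnNge; apply/negP => MN.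
  by have := @leq_back_deg p.+1 _ _ (_ : M.-1 <= N.-1); lia.
have eN := divn_eq N p.+1; have jp := ltn_pmod N (ltn0Sn p).
move: eN jp; set q := N %/ p.+1; set j := N %% p.+1; rewrite ltnS => eN jp.
have bN : back_deg p.+1 N = q * p + j by rewrite eN back_degE.
have e2 : 2 * turan_cl 2 p.+1 N = q * q * p.+1 * p + 2 * q * j * p + j * j.-1.
  by rewrite eN turan_edgesE //; lia.
have := leq_mul (leqnn M) Nd; rewrite mulnDr e2 in hM.
have [j0|j0] := posnP j.
  have q0 : 0 < q by rewrite lt0n; apply: contraTneq N0 => z; rewrite eN z j0.
  have -> : back_deg p.+1 N.-1 = q * p.
    have -> : N.-1 = q.-1 * p.+1 + p by rewrite eN j0; nia.
    by rewrite back_degE //; nia.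
  have : (q * p.+1).+1 * (q * p).+1 <= M * (q * p).+1 by rewrite leq_mul2r; lia.
  by rewrite j0 in hM bN; nia.
have b1 : back_deg p.+1 N.-1 = q * p + j.-1.
  have -> : N.-1 = q * p.+1 + j.-1 by lia.
  by rewrite back_degE //; lia.
rewrite b1 => _; exists q, j, (q * p + j - s).
have h1 : (q * p + j) * M <= M * d by rewrite mulnC leq_mul2l; lia.
have h2 : (q * p + j) * N.+1 <= (q * p + j) * M by rewrite leq_mul2l; lia.
have h3 : (q * p + j) * N.+1 =
   q * q * p.+1 * p + 2 * q * j * p + j * j.-1 + q * (p + j) + 2 * j.
  by rewrite eN; case: (j) j0 => // j' _ /=; clear; lia.
have h4 : 2 * s >= q * (p + j) + 2 * j by lia.
have jp' : 2 * (q * p + j - s) <= (p - j) * q.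
  have : j * q <= p * q by rewrite leq_mul2r jp orbT.
  by rewrite mulnBl; lia.
have eM : M = N.+1.
  apply/eqP; rewrite eqn_leq NM andbT leqNgt; apply/negP => MN.
  have : (q * p + j) * N.+2 <= (q * p + j) * M by rewrite leq_mul2l; lia.
  by rewrite mulnS; rewrite mulnBl in jp'; lia.
have ed : d = q * p + j.
  apply/eqP; rewrite eqn_leq; apply/andP; split; last by lia.
  rewrite leqNgt; apply/negP => ltd.
  have : (q * p + j).+1 * M <= M * d by rewrite mulnC leq_mul2l; lia.
  by rewrite mulSn; rewrite mulnBl in jp'; lia.
split=> //; [|by lia|by lia].
by rewrite j0 ltn_neqAle jp andbT; apply/eqP => e; rewrite e in jp' *; lia.
Qed.

(** The induction has to quantify over the vertex type, since parts of the graph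
    are replaced by Turan graphs. *)
Definition edges_bound_cliques_upto M : Prop :=
  forall (T : finType) (G : sgraph T) (A : {set T}) r t N s,
  #|A| < M -> omega_le G A r -> 1 < t -> cl G A 2 <= turan_cl 2 r N + s ->
  s <= back_deg r N -> cl G A t <= turan_cl t r N + turan_cl t.-1 r.-1 s.

Lemma min_deg_edges (T : finType) (G : sgraph T) (A : {set T}) d :
  {in A, forall v, d <= #|nbh G A v|} -> #|A| * d <= 2 * cl G A 2.
Proof. by move=> h; rewrite -handshake -sum_nat_const; apply: leq_sum. Qed.

Lemma turan_drop_part q a :
  turan_cl 2 a.+1 (q * a.+1) = turan_cl 2 a (q * a) + q * q * a.
Proof.
have := @turan_edgesE a q 0 isT; rewrite addn0.
case: a => [h|a]; first by rewrite [X in turan_cl 2 0 X]muln0 turan_cl0; lia.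
by have := @turan_edgesE a q 0 isT; rewrite addn0; nia.
Qed.

(** Removes a class of size [q.+1] from a Turan graph; on both sides the edges of
    the last vertex are split off. *)
Lemma turan_drop_large_part p q j : 0 < j -> j <= p.+1 ->
  turan_cl 2 p.+2 (q * p.+2 + j) + (q * p.+1 + j) =
  turan_cl 2 p.+1 (q * p.+1 + j.-1) + (q * p + j.-1) + q.+1 * (q * p.+1 + j).
Proof.
case: j => // j _ jp /=.
have := @turan_edgesE p.+1 q j.+1 (leqW jp); have := @turan_edgesE p q j (ltnW jp).
by case: j {jp} => [|j] /=; lia.
Qed.

(** The exceptional case. Some set [C], joined completely to the rest [D], has
    [q * a.+1 + 1] vertices and clique number [a.+1] (see [tight_component]).
    By induction its clique counts are at most those of the Turan graph with
    [a.+1] classes of size [q], plus those of a Turan graph with [a] classes on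
    some [s1] vertices, shifted by one. Substituting these for [C] in the join
    with [D] gives graphs [A1], one vertex smaller than [A], and [A2]. They
    play the roles of the rest and the neighbourhood when a vertex is deleted,
    and [A2] is no larger than the minimum degree. If it is smaller,
    [delete_vertex_bound] applies; if it is equal, the induction hypothesis
    applies to [A2] too and gains what is missing. *)
Lemma large_min_deg_bound M (IH : edges_bound_cliques_upto M)
    (T : finType) (G : sgraph T) (A : {set T}) (p q j x t : nat) :
  #|A| <= M -> #|A| = (q * p.+1 + j).+1 -> 0 < j < p -> omega_le G A p.+1 ->
  0 < x -> 2 * x <= (p - j) * q -> {in A, forall v, q * p + j <= #|nbh G A v|} ->
  cl G A 2 <= turan_cl 2 p.+1 (q * p.+1 + j) + (q * p + j - x) ->
  cl G A t.+3 <=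
  turan_cl t.+3 p.+1 (q * p.+1 + j) + turan_cl t.+2 p (q * p + j - x).
Proof.
move=> AM cA jp om x0 xq deg edges.
case/andP: jp => j0 jltp.
have miss : {in A, forall v, #|A :\: nbh G A v| <= q.+1}.
  by move=> v vA; rewrite cardsDS ?nbh_sub // cA; have := deg v vA; lia.
have dA : detached G A A by split=> // u v _; rewrite setDv inE.
have qA : q * p.+1 < #|A| by rewrite cA; lia.
have [C [a [[CA jCD] _ oC cC [S [SC qS cS]]]]] := tight_component miss dA om qA.
set D := A :\: C in jCD.
have eA : A = C :|: D by rewrite /D setU_setD.
have ap : a <= p.+1 by rewrite -cS; apply: om; rewrite // (subset_trans SC CA).
case: a oC cC cS ap => [|a] oC cC cS ap.
  by move: cC; rewrite (omega0 oC) cards0; lia.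
have qap : q * a.+1 <= q * p.+1 by rewrite leq_mul2l ap orbT.
have cD : #|D| = q * p.+1 + j - q * a.+1 by rewrite cardsDS // cA cC; lia.
have CM : #|C| < M by lia.
have oD : omega_le G D (p - a).
  by rewrite -subSS -cS; apply: (omega_joinD jCD) SC qS; rewrite -eA.
have e0 : turan_cl 2 a.+1 (q * a.+1) <= cl G C 2.
  have : #|C| * (q * a) <= 2 * cl G C 2.
    apply: min_deg_edges => v vC; have vA := subsetP CA v vC.
    have : #|nbh G A v| <= #|nbh G C v| + #|D|.
      apply: leq_trans (leq_card_setU _ _); apply: subset_leq_card.
      apply/subsetP => u; rewrite !inE => /andP[uA ->]; rewrite uA !andbT.
      by case: (u \in C).
    by have := deg v vA; rewrite cD; lia.
  by have := @turan_edgesE a q 0 isT; rewrite addn0 cC /=; nia.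
have e1 : cl G C 2 <= turan_cl 2 a.+1 (q * a.+1) + q * a.
  have := zykov 2 oC; rewrite cC addn1 turan_edgesS.
  by have := @back_degE a q 0 isT; rewrite !addn0 => ->.
set s1 := cl G C 2 - turan_cl 2 a.+1 (q * a.+1).
have s1E : cl G C 2 = turan_cl 2 a.+1 (q * a.+1) + s1 by rewrite /s1 subnKC.
have s1q : s1 <= q * a by rewrite /s1; lia.
pose G1 := turan_join (q * a.+1) a.+1 G.
pose A1 := tj_left (q * a.+1) T :|: tj_right (q * a.+1) D.
pose G2 := turan_join s1 a G.
pose A2 := tj_left s1 T :|: tj_right s1 D.
have h2 : a = 0 -> s1 = 0 by move=> z; rewrite z muln0 in s1q; lia.
have j1 : joined G1 (tj_left (q * a.+1) T) (tj_right (q * a.+1) D) by apply: tj_joined.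
have j2 : joined G2 (tj_left s1 T) (tj_right s1 D) by apply: tj_joined.
have cl1E i : cl G1 (tj_left (q * a.+1) T) i = turan_cl i a.+1 (q * a.+1).
  by rewrite tj_cl_left -clique_nb_cliques turan_nb_cliques.
have cl2E i : cl G2 (tj_left s1 T) i = turan_cl i a s1.
  by rewrite tj_cl_left -clique_nb_cliques turan_nb_cliques.
have split_cl : cl G A t.+3 <= cl G1 A1 t.+3 + cl G2 A2 t.+2.
  rewrite {1}eA; apply: cl_join_replace => // [i|i|i]; try exact: tj_cl_right.
  rewrite cl1E cl2E; case: i => [|i]; first by rewrite cl1 cC turan_cl1.
  apply: (IH _ _ _ _ _ _ _ CM oC) => //; first by rewrite s1E.
  by have := @back_degE a q 0 isT; rewrite !addn0 => ->.
apply: leq_trans split_cl _.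
have cA1 : #|A1| = q * a.+1 + #|D| by rewrite (card_join j1) card_tj_left card_tj_right.
have cA2 : #|A2| = s1 + #|D| by rewrite (card_join j2) card_tj_left card_tj_right.
have eG : cl G A 2 = cl G C 2 + (q * a.+1 + 1) * #|D| + cl G D 2.
  by rewrite {1}eA join_edges // cC.
have eG1 : cl G1 A1 2 = turan_cl 2 a.+1 (q * a.+1) + q * a.+1 * #|D| + cl G D 2.
  by rewrite join_edges // cl1E card_tj_left card_tj_right tj_cl_right.
have eG2 : cl G2 A2 2 = turan_cl 2 a s1 + s1 * #|D| + cl G D 2.
  by rewrite join_edges // cl2E card_tj_left card_tj_right tj_cl_right.
have oA1 : omega_le G1 A1 p.+1.
  have -> : p.+1 = a.+1 + (p - a) by lia.
  exact: omega_tj.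
have oA2 : omega_le G2 A2 p.
  have -> : p = a + (p - a) by lia.
  exact: omega_tj.
have A1M : #|A1| < M by rewrite cA1; lia.
have A2M : #|A2| < M by rewrite cA2; lia.
have b0 : back_deg p.+1 (q * p.+1 + j) = q * p + j by rewrite back_degE //; lia.
have N0 : q * p.+1 + j = (q * p.+1 + j.-1).+1 by lia.
have b1 : back_deg p.+1 (q * p.+1 + j.-1) = q * p + j.-1 by rewrite back_degE //; lia.
have [dlt|dge] := ltnP (s1 + #|D|) (q * p + j).
  case: (@delete_vertex_bound t.+1 p.+1 (q * p.+1 + j) (q * p + j - x) (s1 + #|D|)).
  - by rewrite b0; lia.
  - have [le|lt] := leqP (s1 + #|D|) (q * p + j - x); [by left|right].
    by split; [rewrite N0 /= b1; lia | lia].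
  move=> N' [s' [hs' eN' le]]; apply: leq_trans le; apply: leq_add; last first.
    by rewrite -cA2; apply: zykov.
  by apply: IH => //; lia.
have s1max : s1 = q * a.
  apply/eqP; rewrite eqn_leq s1q /=; rewrite cD in dge; lia.
have dE : #|A2| = q * p + j by rewrite cA2 cD s1max; lia.
have xb : x <= q * p.-1 + j.-1.
  have : (p - j) * q <= p.-1 * q by rewrite leq_mul2r; lia.
  by lia.
move=> {om deg cD oD qA dge}.
case: p j0 jltp xq xb cA edges ap qap b0 b1 N0 oA1 oA2 dE => // p' j0 jltp xq xb cA edges ap qap b0 b1 N0 oA1 oA2 dE.
have k1 : cl G1 A1 t.+3 <= turan_cl t.+3 p'.+2 (q * p'.+2 + j.-1)
    + turan_cl t.+2 p'.+1 (q * p'.+1 + j.-1 - x).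
  apply: IH => //; last by rewrite b1; lia.
  move: edges; rewrite N0 turan_edgesS b1; rewrite cA2 in dE; lia.
have b2 : back_deg p'.+1 (q * p'.+1 + j.-1) = q * p' + j.-1 by rewrite back_degE //; lia.
have k2 : cl G2 A2 t.+2 <= turan_cl t.+2 p'.+1 (q * p'.+1 + j.-1)
    + turan_cl t.+1 p' (q * p' + j.-1 - x).
  apply: IH => //; last by rewrite b2; lia.
  have := turan_drop_part q a; have := @turan_drop_large_part p' q j j0 (ltnW jltp).
  move: edges; rewrite eG eG2 s1max s1E.
  rewrite cA2 s1max in dE; have := congr1 (muln q) dE.
  rewrite mulnDr (mulnA q q a) => f1 f2 f3 f4; lia.
have xle : x <= q * p'.+1 + j.-1 by lia.
have -> : q * p'.+1 + j - x = (q * p'.+1 + j.-1 - x).+1 by lia.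
rewrite {1}N0 !turan_clS b1 /=.
have : turan_cl t.+1 p' (q * p' + j.-1 - x)
    <= turan_cl t.+1 p' (back_deg p'.+1 (q * p'.+1 + j.-1 - x)).
  apply: leq_turan_cl; rewrite leq_subLR -b2 [x + _]addnC.
  by have := back_deg_lip p'.+1 (q * p'.+1 + j.-1 - x) x; rewrite subnK.
by lia.
Qed.

(** Deleting a vertex of minimum degree [d] reduces the bound to a smaller
    graph, unless [d] exceeds both [s] and the minimum degree of the Turan graph
    on [N] vertices; the exceptional graphs have exactly [N.+1] vertices. *)
Lemma edges_bound_cliques_all M : edges_bound_cliques_upto M.
Proof.
elim: M => [|M IH] // T G A r t N s AM om t2 hE hs.
case: t t2 => [|[|t]] // _.
have [A0|A0] := eqVneq A set0; first by rewrite A0 cl_set0.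
case: t => [|t]; first by rewrite turan_cl1.
case: r om hE hs => [|p] om hE hs; first by rewrite (omega0 om) eqxx in A0.
have /set0Pn[v0 v0A] := A0.
have [v vA vmin] : exists2 v, v \in A & {in A, forall u, #|nbh G A v| <= #|nbh G A u|}.
  pose w := [arg min_(x < v0 in A) #|nbh G A x|].
  by exists w; rewrite /w; case: arg_minnP => // x xA h y; apply: h.
have dM : #|nbh G A v| <= back_deg p.+1 #|A|.-1.
  have [u uA hu] := turan_min_deg om A0.
  exact: leq_trans (vmin u uA) hu.
have [_ /= omN] := omega_nbh om vA.
have hsum := min_deg_edges vmin.
move: dM hsum; set d := #|nbh G A v| => dM hsum.
have A1 : 0 < #|A| by rewrite card_gt0.
have exceptional N' s' : 0 < N' -> s' < d -> back_deg p.+1 N'.-1 < d ->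
    s' < back_deg p.+1 N' -> cl G A 2 <= turan_cl 2 p.+1 N' + s' ->
    cl G A t.+3 <= turan_cl t.+3 p.+1 N' + turan_cl t.+2 p s'.
  move=> N0 sd Nd sN hE'.
  have hsum' : #|A| * d <= 2 * (turan_cl 2 p.+1 N' + s').
    by apply: leq_trans hsum _; rewrite leq_mul2l hE'.
  have [q [j [x [eN jp [cA ed] es [/andP[x0 xle] x2]]]]] :=
    large_min_deg N0 A1 sd Nd sN hsum' dM.
  rewrite eN es; apply: (large_min_deg_bound IH) => //.
  - by rewrite cA eN.
  - by move=> u uA; rewrite -ed; apply: vmin.
  - by rewrite -eN -es.
have [good|bad] := boolP ((d <= s) || ((s < d <= back_deg p.+1 N.-1) && (0 < N))).
  case: (@delete_vertex_bound t.+1 p.+1 N s d hs).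
    by case/orP: good => [|/andP[]]; [left|right].
  move=> N' [s' [hs' eN le]]; apply: leq_trans le; rewrite (clS G _ vA); apply: leq_add.
    apply: IH => //; first by rewrite (cardsD1 v) vA in AM.
    - by apply: omega_sub om; apply: subD1set.
    - by move: hE; rewrite (edgeS G vA) -/d; lia.
  exact: zykov.
move: bad; rewrite negb_or -ltnNge => /andP[sd]; rewrite sd /= negb_and -!ltnNge.
have [N0|N0] := posnP N.
  move: hE hs; rewrite N0 turan_cl0 /back_deg div0n subn0 leqn0 => hE /eqP s0.
  by rewrite s0 addn0 leqn0 in hE; rewrite (eqP hE) in hsum; nia.
case/orP=> [Nd|]; last by lia.
move: (hs); rewrite leq_eqVlt => /orP[/eqP eq|sN]; last exact: exceptional.
(* The extra vertex has full degree: it is the last one of the next Turan graph. *)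
have -> : turan_cl t.+3 p.+1 N + turan_cl t.+3.-1 p.+1.-1 s
    = turan_cl t.+3 p.+1 N.+1 + turan_cl t.+2 p 0.
  by rewrite turan_clS turan_cl0 eq addn0.
apply: exceptional => //=.
- by lia.
- by rewrite -eq.
- clear - dM sd; case: p dM => [|p] dM.
    by move: dM; rewrite /back_deg divn1; lia.
  by rewrite /back_deg; have := ltn_Pdiv (isT : 1 < p.+2) (ltn0Sn N); lia.
- by rewrite turan_edgesS addn0 -eq.
Qed.

(** A Kruskal-Katona theorem for graphs with bounded clique number. The right
    side counts the [t]-cliques of a Turan graph on [N] vertices with one more
    vertex, whose [s] neighbours span a Turan graph with one class less. *)
Theorem edges_bound_cliques (T : finType) (G : sgraph T) (A : {set T}) r t N s :
  omega_le G A r -> 1 < t -> cl G A 2 <= turan_cl 2 r N + s ->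
  s <= back_deg r N -> cl G A t <= turan_cl t r N + turan_cl t.-1 r.-1 s.
Proof. exact: (@edges_bound_cliques_all #|A|.+1). Qed.

(** * Edge bounds from vertices of low degree *)

Section LowDegree.
Variables (T : finType) (G : sgraph T).
Implicit Types (A L X : {set T}).

Lemma low_degree_edges A L h : L \subset A ->
  {in L, forall v, #|nbh G A v| <= h} -> cl G A 2 <= #|L| * h + cl G (A :\: L) 2.
Proof.
elim: {L}_.+1 {-2}L (ltnSn #|L|) A => // n IH L hL A LA low.
have [->|/set0Pn[v vL]] := eqVneq L set0; first by rewrite cards0 setD0.
have cL : #|L| = #|L :\ v|.+1 by rewrite (cardsD1 v) vL.
rewrite (edgeS G (subsetP LA v vL)) cL mulSn.
have := low v vL; have := IH (L :\ v) _ (A :\ v).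
have -> : (A :\ v) :\: (L :\ v) = A :\: L.
  by apply/setP => x; rewrite !inE; case: (x =P v) => [->|] //=; rewrite vL.
rewrite -ltnS -cL setSD // => /(_ hL isT) h1 h2.
suff : cl G (A :\ v) 2 <= #|L :\ v| * h + cl G (A :\: L) 2 by lia.
apply: h1 => u /setD1P[_ uL]; apply: leq_trans (low u uL).
exact/subset_leq_card/nbhS/subD1set.
Qed.

Lemma subset_of_card X i : i <= #|X| -> exists2 L : {set T}, L \subset X & #|L| = i.
Proof.
move=> iX; exists [set x in take i (enum X)].
  by apply/subsetP => x; rewrite inE => /mem_take; rewrite mem_enum.
rewrite cardsE (card_uniqP (take_uniq _ (enum_uniq _))).
by rewrite size_takel // -cardE.
Qed.

(** Erdos's degree majorisation: the degrees of a [K_(r+1)]-free graph are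
    bounded by those of a complete [r]-partite graph. One class consists of
    the non-neighbours of a vertex of maximum degree. *)
Lemma degree_majorisation A r : omega_le G A r -> exists f : T -> nat,
  {in A, forall v, f v < r} /\
  {in A, forall v, #|nbh G A v| + #|color_class f A (f v)| <= #|A|}.
Proof.
elim: r A => [|r IH] A om.
  by exists (fun=> 0); rewrite (omega0 om); split=> v; rewrite inE.
have [->|/set0Pn[v0 v0A]] := eqVneq A set0.
  by exists (fun=> 0); split=> v; rewrite inE.
have [v vA vmax] : exists2 v, v \in A & {in A, forall u, #|nbh G A u| <= #|nbh G A v|}.
  pose w := [arg max_(x > v0 in A) #|nbh G A x|].
  by exists w; rewrite /w; case: arg_maxnP => // x xA h y; apply: h.
have [_ omN] := omega_nbh om vA.
have [g [gr gd]] := IH _ omN.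
have NA := nbh_sub G A v; move: gr gd omN NA vmax.
move: (nbh G A v) => N gr gd omN NA vmax.
exists (fun u => if u \in N then g u else r); split.
  by move=> u uA; case: ifP => // uN; apply: ltnW; apply: gr.
move=> u uA; case: ifP => uN.
  have -> : color_class (fun u => if u \in N then g u else r) A (g u) = color_class g N (g u).
    apply/setP => x; rewrite !inE; case xN: (x \in N).
      by rewrite (subsetP NA).
    by rewrite /= gtn_eqF ?andbF // gr.
  have : #|nbh G A u| <= #|nbh G N u| + #|A :\: N|.
    apply: leq_trans (leq_card_setU _ _); apply: subset_leq_card.
    by apply/subsetP => x; rewrite [in nbh G N u]/nbh !inE => /andP[-> ->]; case: (x \in N).
  by have := gd u uN; rewrite cardsDS //; have := subset_leq_card NA; lia.
have -> : color_class (fun u => if u \in N then g u else r) A r = A :\: N.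
  apply/setP => x; rewrite !inE andbC; case xN: (x \in N) => /=; rewrite ?eqxx //.
  by rewrite ltn_eqF // gr.
by rewrite cardsDS //; have := vmax u uA; have := subset_leq_card NA; lia.
Qed.

(** The vertices of [L] lie below the majorising degrees by at least the
    distance from [h] to the smallest of these. *)
Lemma majorisation_low_degree A L h r p (f : T -> nat) :
  {in A, forall v, f v < r} ->
  {in A, forall v, #|nbh G A v| + #|color_class f A (f v)| <= #|A|} ->
  (forall c, #|color_class f A c| <= p) -> L \subset A ->
  {in L, forall v, #|nbh G A v| <= h} ->
  2 * cl G A 2 + #|L| * (#|A| - p - h) <=
  \sum_(c < r) #|color_class f A c| * (#|A| - #|color_class f A c|).
Proof.
move=> fr fd fp LA low.
have -> : \sum_(c < r) #|color_class f A c| * (#|A| - #|color_class f A c|)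
    = \sum_(v in A) (#|A| - #|color_class f A (f v)|).
  rewrite (eq_bigr (fun c : 'I_r => \sum_(v in color_class f A c) (#|A| - #|color_class f A c|))); last first.
    by move=> c _; rewrite sum_nat_const.
  rewrite (exchange_big_dep (fun v => v \in A)) /=; last first.
    by move=> c v _; rewrite inE => /andP[].
  apply: eq_bigr => v vA.
  rewrite (bigD1 (Ordinal (fr v vA))) /=; last by rewrite inE vA eqxx.
  rewrite big1 ?addn0 // => c /andP[]; rewrite inE => /andP[_ /eqP e].
  by case/eqP; apply: val_inj.
have -> : #|L| * (#|A| - p - h) = \sum_(v in L) (#|A| - p - h) by rewrite sum_nat_const.
rewrite -handshake (big_setID L) /= (setIidPr LA) addnAC -big_split /=.
rewrite [leqRHS](big_setID L) /= (setIidPr LA); apply: leq_add.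
  by apply: leq_sum => v vL; have := low v vL; have := fp (f v); have := fd v (subsetP LA v vL); lia.
by apply: leq_sum => v /setDP[vA _]; have := fd v vA; lia.
Qed.

End LowDegree.

(** Since [back_deg] grows with the number of classes, lower bounds on the growth
    of Turan numbers carry over from [q] classes to [r]. *)
Lemma turan_gap_mono q r m d : 0 < q <= r ->
  turan_cl 2 q (m + d) + turan_cl 2 r m <= turan_cl 2 r (m + d) + turan_cl 2 q m.
Proof.
move=> qr; elim: d => [|d IH]; first by rewrite !addn0; lia.
by rewrite !addnS !turan_edgesS; have := leq_back_degr (m + d) qr; lia.
Qed.

(** The deviation from the quadratic is [j * (r - j)] with [r = p.+1] and [j] the
    remainder of [m] modulo [r], which is at most [r ^ 2 / 4]. *)
Lemma turan_edges_quadratic p m :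
  [/\ 2 * p.+1 * turan_cl 2 p.+1 m <= p * (m * m) &
      4 * p * (m * m) <= 8 * p.+1 * turan_cl 2 p.+1 m + p.+1 * p.+1].
Proof.
have em := divn_eq m p.+1; have := ltn_pmod m (ltn0Sn p); move: em.
set q := m %/ p.+1; set j := m %% p.+1; rewrite ltnS => em jp.
have := @turan_edgesE p q j (leqW jp); rewrite -em => e2.
have e3 : 2 * p.+1 * turan_cl 2 p.+1 m + j * (p.+1 - j) = p * (m * m).
  rewrite -mulnA mulnCA e2 em.
  have -> : p.+1 - j = (p - j).+1 by lia.
  have -> : p = j + (p - j) by lia.
  rewrite addKn; move: (p - j) => w; case: (j) => [|j'] /=; clear; lia.
split; first by lia.
have : 4 * (j * (p.+1 - j)) <= p.+1 * p.+1.
  by case: (nat_AGM2 j (p.+1 - j)) => + _; rewrite subnKC ?(leqW jp) // -mulnn.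
by lia.
Qed.

Lemma turan_gap_linear p m d :
  p * (d * (2 * m + d.-1)) <=
  2 * p.+1 * (turan_cl 2 p.+1 (m + d) - turan_cl 2 p.+1 m).
Proof.
have mono x : turan_cl 2 p.+1 m <= turan_cl 2 p.+1 (m + x) by rewrite leq_turan_cl ?leq_addr.
elim: d => [|d IH]; first by rewrite muln0.
rewrite addnS turan_edgesS -addnBAC ?mono // [leqRHS]mulnDr.
suff : p * (2 * (m + d)) <= 2 * p.+1 * back_deg p.+1 (m + d).
  move=> h; apply: leq_trans (leq_add IH h); rewrite -mulnDr leq_mul2l.
  by case: (d) => [|d'] /=; lia.
rewrite mulnCA -mulnA leq_mul2l /= /back_deg mulnBr mulSn.
by have := leq_trunc_div (m + d) p.+1; lia.
Qed.

(** Below eight classes the rounding term is less than a full edge, so that the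
    quadratic estimates decide the comparison. *)
Lemma gap_quadratic p m a s : p.+1 < 8 -> 2 * p.+1 * (a.+1 + s) <= p * (2 * m + a) ->
  turan_cl 2 p.+1 m + a.+1 * (a + s) <= turan_cl 2 p.+1 (m + a) + s.
Proof.
move=> p8 h.
have [_ lo] := turan_edges_quadratic p (m + a).
have [up _] := turan_edges_quadratic p m.
have h' : 2 * p.+1 * (a.+1 + s) * a <= p * (2 * m + a) * a by rewrite leq_mul2r h orbT.
suff : turan_cl 2 p.+1 m + a * (a.+1 + s) <= turan_cl 2 p.+1 (m + a) by lia.
rewrite -ltnS -(ltn_pmul2l (_ : 0 < 8 * p.+1)) //.
have : p.+1 * p.+1 < 8 * p.+1 by rewrite ltn_pmul2r.
move: lo up h'; set X := turan_cl 2 _ _; set Y := turan_cl 2 _ _; clear; lia.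
Qed.

Lemma gap_linear p m a s : 2 * p.+1 * (a.+1 + s) <= p * (2 * m + a.-1) ->
  turan_cl 2 p.+1 m + a.+1 * (a + s) <= turan_cl 2 p.+1 (m + a) + s.
Proof.
move=> h; have lo := turan_gap_linear p m a.
have mono : turan_cl 2 p.+1 m <= turan_cl 2 p.+1 (m + a) by rewrite leq_turan_cl ?leq_addr.
suff : a * (a.+1 + s) <= turan_cl 2 p.+1 (m + a) - turan_cl 2 p.+1 m by lia.
rewrite -(leq_pmul2l (_ : 0 < 2 * p.+1)) //; apply: leq_trans lo.
by rewrite mulnCA [leqRHS]mulnCA leq_mul2l h orbT.
Qed.

(** With [E] the Turan numbers, the function [i |-> E (n - i) + i * (i + s - 1)]
    is convex, so over [1 <= i <= (n - s) / 2] it is largest at an end. These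
    conditions on the parameters make that end [i = 1]. *)
Definition large_enough r n s : bool :=
  [|| (r == 4) && (5 * s + 6 <= n),
      (5 <= r <= 7) && (3 * s + 4 <= n),
      [&& 8 <= r, s + 4 <= n & 4 * (s + 3) <= (r - 4) * (n - s - 4)],
      (s == 0) && (4 <= r), (s == 1) && (5 <= r) | (s == 2) && (6 <= r)].

Lemma large_enough_gap r n s a : large_enough r n s -> 0 < a -> 2 * a.+1 + s <= n ->
  turan_cl 2 r (n - a.+1) + a.+1 * (a + s) <= turan_cl 2 r n.-1 + s.
Proof.
move=> H a0 hn; have -> : n.-1 = n - a.+1 + a by lia.
set m := n - a.+1; have en : n = m + a.+1 by rewrite /m; lia.
move: {m}(m) en => m en; rewrite {}en in H hn *.
have reduce q : 0 < q <= r ->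
    turan_cl 2 q m + a.+1 * (a + s) <= turan_cl 2 q (m + a) + s ->
    turan_cl 2 r m + a.+1 * (a + s) <= turan_cl 2 r (m + a) + s.
  by move=> /(turan_gap_mono m a); lia.
have small q k : 0 < q <= r -> a = 1 -> back_deg q m >= k -> 2 + s <= k ->
    turan_cl 2 r m + a.+1 * (a + s) <= turan_cl 2 r (m + a) + s.
  move=> qr a1 hk hs; apply: (reduce _ qr); rewrite a1 addn1 turan_edgesS; lia.
case/or4P: H => [/andP[/eqP-> h]|/andP[r57 h]|/and3P[r8 h1 h2]|/or3P[]].
- by apply: gap_quadratic => //; lia.
- have : r = 5 \/ r = 6 \/ r = 7 by lia.
  by case=> [->|[->|->]]; apply: gap_quadratic => //; lia.
- have [w ew] : exists w, r = w + 4 by exists (r - 4); lia.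
  have [z ez] : exists z, m + a.+1 = s + 4 + z by exists (m + a.+1 - s - 4); lia.
  have -> : r = (w + 3).+1 by lia.
  apply: gap_linear; have -> : 2 * m + a.-1 = 2 * s + 2 * z + 5 - a by lia.
  have {h2} h2 : 4 * (s + 3) <= w * z.
    by move: h2; rewrite ew ez addnK (_ : s + 4 + z - s - 4 = z) //; lia.
  have az : 2 * a <= z + 2 by lia.
  have waz : w * (2 * a) <= w * (z + 2) by rewrite leq_mul2l az orbT.
  have [y ey] : exists y, 2 * s + 2 * z + 5 = a + y by exists (2 * s + 2 * z + 5 - a); lia.
  rewrite ey addKn; have ewy := congr1 (muln w) ey; clear - h2 az waz ey ewy; lia.
- case/andP=> /eqP s0 r4; subst s.
  have [n6|n6] := leqP 6 (m + a.+1).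
    by apply: (reduce 4) => //; apply: gap_quadratic => //; lia.
  by apply: (small 4 2) => //; [lia | apply: (@leq_back_deg 4 2); lia].
- case/andP=> /eqP s1 r5; subst s.
  have [n7|n7] := leqP 7 (m + a.+1).
    by apply: (reduce 5) => //; apply: gap_quadratic => //; lia.
  by apply: (small 5 3) => //; [lia | apply: (@leq_back_deg 5 3); lia].
- case/andP=> /eqP s2 r6; subst s.
  have [n8|n8] := leqP 8 (m + a.+1).
    by apply: (reduce 6) => //; apply: gap_quadratic => //; lia.
  by apply: (small 6 4) => //; [lia | apply: (@leq_back_deg 6 4); lia].
Qed.

(** For three classes of sizes [p], [c1], [c2], the degree sum is largest when
    the two smaller classes are equal. *)
Lemma three_class_sum p c1 c2 n : p + c1 + c2 = n ->
  2 * (p * (n - p) + c1 * (n - c1) + c2 * (n - c2)) <= (n - p) * (n + 3 * p).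
Proof.
move=> <-.
have -> : p + c1 + c2 - p = c1 + c2 by lia.
have -> : p + c1 + c2 - c1 = p + c2 by lia.
have -> : p + c1 + c2 - c2 = p + c1 by lia.
by case: (nat_AGM2 c1 c2) => + _; rewrite -mulnn; lia.
Qed.

Section Tripartite.
Variables (T : finType) (G : sgraph T) (A : {set T}) (n s : nat).
Hypotheses (om : omega_le G A 3) (cA : #|A| = n) (ns : 6 * s + 20 <= n).

(** Low degrees on nearly half of the vertices of a [K_4]-free graph. Deleting
    them and applying Turan's theorem to the rest would give up too much; instead
    the degree sum of a complete tripartite graph is corrected on the low
    vertices, and the sizes of its classes are optimised. *)
Lemma tripartite_many_low i (L : {set T}) : 1 < i -> 2 * i + s <= n ->
  2 * n <= 4 * i + 3 * s -> L \subset A -> #|L| = i ->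
  {in L, forall v, #|nbh G A v| <= i + s - 1} ->
  cl G A 2 <= turan_cl 2 3 n.-1 + s.
Proof using om cA ns.
move=> i1 i2 i3 LA cL low; set h := i + s - 1 in low.
have [f [fr fd]] := degree_majorisation om.
have eA : n = #|color_class f A 0| + #|color_class f A 1| + #|color_class f A 2|.
  rewrite -cA (@card_classes _ f A (iota 0 3)) ?iota_uniq //.
    by rewrite !big_cons big_nil /=; lia.
  by move=> x xA; rewrite mem_iota add0n /= fr.
pose c k := #|color_class f A k|.
have [b [c1 [c2 [eb hb hb']]]] : exists b c1 c2, [/\ b + c1 + c2 = n, 
    c 0 <= b /\ c 1 <= b /\ c 2 <= b &
    \sum_(k < 3) c k * (n - c k) = b * (n - b) + c1 * (n - c1) + c2 * (n - c2)].
  rewrite !big_ord_recr big_ord0 /= -![c _]/(#|color_class f A _|); rewrite /c.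
  move: eA; set x := #|color_class f A 0|; set y := #|color_class f A 1|.
  set z := #|color_class f A 2| => eA.
  rewrite add0n; have [h1|h1] := leqP y x; have [h2|h2] := leqP z x.
  - by exists x, y, z; split; [lia|lia|].
  - by exists z, x, y; split; [lia|lia|rewrite -[RHS]addnA addnC].
  - by exists y, x, z; split; [lia|lia|rewrite [y * _ + _]addnC].
  have [h3|h3] := leqP z y.
    by exists y, x, z; split; [lia|lia|rewrite [y * _ + _]addnC].
  by exists z, x, y; split; [lia|lia|rewrite -[RHS]addnA addnC].
have hc k : c k <= b.
  case: k => [|[|[|k]]]; [by case: hb|by case: hb => _ []|by case: hb => _ []|].
  suff -> : c k.+3 = 0 by [].
  apply/eqP; rewrite cards_eq0; apply/eqP/setP => x; rewrite !inE.
  by apply/negP => /andP[xA /eqP e]; have := fr x xA; rewrite e.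
have := majorisation_low_degree fr fd hc LA low.
rewrite cA hb' cL -/c => key.
have := three_class_sum eb => key2.
have {key key2 hb' hb hc} key : 4 * cl G A 2 + 2 * i * (n - b - h) <= (n - b) * (n + 3 * b) by lia.
have [_ lo] := turan_edges_quadratic 2 n.-1.
have bn : b <= n by lia.
(* Scaled by 24, the errors in [lo] and in this bound are 9 and 14, less than 24
   together. *)
suff : 12 * cl G A 2 <= 4 * (n.-1 * n.-1) + 12 * s + 7 by lia.
have [g eg] : exists g, n = b + g by exists (n - b); lia.
have {key} key : 4 * cl G A 2 + 2 * i * (g - h) <= g * (4 * n - 3 * g).
  by move: key; rewrite eg addKn (_ : 4 * (b + g) - 3 * g = b + g + 3 * b) //; lia.
have hU : 2 * h + 2 <= n + s by rewrite /h; lia.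
have [m em] : exists m, 4 * n = 6 * h + m by exists (4 * n - 6 * h); lia.
have hm : m <= 2 * i + 6 by rewrite /h in em; lia.
(* As a function of [g], the bound [key] is largest near [g = h]: up to there
   the subtracted term vanishes, beyond it that term outweighs the growth
   up to an error of 3. *)
have {}key : 4 * cl G A 2 <= h * (3 * h + m) + 3.
  apply: (@leq_trans (g * (4 * n - 3 * g) - 2 * i * (g - h))); first by lia.
  rewrite em; clearbody h; clear - hm; have [gh|hg] := leqP g h.
    have [z ->] : exists z, h = g + z by exists (h - g); lia.
    have -> : 6 * (g + z) + m - 3 * g = 3 * g + 6 * z + m by lia.
    have -> : g - (g + z) = 0 by lia.
    by lia.
  have [y ->] : exists y, g = h + y by exists (g - h); lia.
  have [le|lt] := leqP (3 * y) (3 * h + m); last first.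
    have -> : 6 * h + m - 3 * (h + y) = 0 by lia.
    by lia.
  have [w ew] : exists w, 3 * h + m = 3 * y + w by exists (3 * h + m - 3 * y); lia.
  have -> : 6 * h + m - 3 * (h + y) = w by lia.
  have -> : h + y - h = y by lia.
  have e1 := congr1 (muln h) ew; have e2 := congr1 (muln y) ew.
  have e3 := leq_mul (leqnn y) hm.
  have e4 : 2 * y <= y * y + 1 by case: (nat_AGM2 y 1) => + _; rewrite -mulnn; lia.
  by lia.
have [x ex] : exists x, 2 * h + x + 1 = n.-1 + s by exists (n + s - 2 - 2 * h); lia.
have [v ev] : exists v, h + 2 * x = v + 2 * s + 4 by exists (h + 2 * x - 2 * s - 4); lia.
have v2 : 3 * s + 10 <= 2 * v by lia.
have v3 := leq_mul v2 v2.
have e4 : 4 * n.-1 + 4 = 6 * h + m by lia.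
clearbody h; clear - key ex ev v3 e4; move: n.-1 ex e4 => k ex e4.
have p1 := congr1 (muln h) e4; have p2 := congr1 (muln h) ex.
have p3 := congr1 (muln s) ex; have p4 := congr1 (fun z => z * z) ex.
have p5 := congr1 (muln s) ev; have p6 := congr1 (fun z => z * z) ev.
by simpl in p4, p6; lia.
Qed.

End Tripartite.

(** Vertices of degree at most [h], in the number that the Chvatal-type
    conditions provide, force few edges: deleting them leaves a Turan-bounded
    graph. For [r = 3] this count is not enough when they are nearly half of all
    vertices, and the degree majorisation takes over. *)
Theorem low_degrees_few_edges (T : finType) (G : sgraph T) (A : {set T}) r s h :
  omega_le G A r -> large_enough r #|A| s \/ r = 3 /\ 6 * s + 20 <= #|A| ->
  2 * h + 1 < #|A| + s -> 0 < #|[set v in A | #|nbh G A v| <= h]| ->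
  h + 1 - s <= #|[set v in A | #|nbh G A v| <= h]| ->
  cl G A 2 <= turan_cl 2 r #|A|.-1 + s.
Proof.
set X := [set v in A | _] => om big hn /card_gt0P[v vX] hX.
have [hs|sh] := leqP h s.
  have [vA dv] : v \in A /\ #|nbh G A v| <= h by move: vX; rewrite inE => /andP.
  have cA : #|A|.-1 = #|A :\ v| by rewrite (cardsD1 v) vA.
  rewrite (edgeS G vA) cA; apply: leq_add; last exact: leq_trans dv hs.
  by apply: zykov; apply: omega_sub om; apply: subD1set.
have [L LX cL] := subset_of_card hX.
have LA : L \subset A by apply: subset_trans LX _; apply/subsetP => x; rewrite inE => /andP[].
have low : {in L, forall u, #|nbh G A u| <= h}.
  by move=> u /(subsetP LX); rewrite inE => /andP[].
have simple : turan_cl 2 r (#|A| - #|L|) + #|L| * h <= turan_cl 2 r #|A|.-1 + s ->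
    cl G A 2 <= turan_cl 2 r #|A|.-1 + s.
  apply: leq_trans; apply: leq_trans (low_degree_edges LA low) _.
  rewrite addnC leq_add2r -cardsDS //; apply: zykov.
  exact: omega_sub (subsetDl _ _) om.
have eh : h = (h - s) + s by lia.
have ei : h + 1 - s = (h - s).+1 by lia.
case: big => [big|[r3 ns]].
  by apply: simple; rewrite cL ei {3}eh; apply: large_enough_gap => //; lia.
subst r; have [many|few] := leqP (2 * #|A|) (4 * (h + 1 - s) + 3 * s).
  apply: (tripartite_many_low om erefl ns _ _ many LA cL); try lia.
  by move=> u uL; have := low u uL; lia.
apply: simple; rewrite cL ei {3}eh.
have -> : #|A|.-1 = #|A| - (h - s).+1 + (h - s) by lia.
by apply: gap_quadratic => //; lia.
Qed.

(** * Degree conditions from stability *)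

Section Stability.
Variable (T : finType).
Implicit Types (G : sgraph T) (u v : T).

Definition deg G v : nat := #|nbh G setT v|.

Definition low_vertices G h : {set T} := [set v in setT | deg G v <= h].

(** The failure of Chvatal's degree condition. The parameter [s] shifts the
    threshold: 0 for Hamiltonian paths, 1 for Hamiltonian cycles, 2 for
    Hamiltonian connectedness. *)
Definition low_degrees G s : bool :=
  [exists h : 'I_(#|T| + s), [&& 2 * h + 1 < #|T| + s,
     0 < #|low_vertices G h| & h + 1 - s <= #|low_vertices G h|]].

Lemma low_degreesP G s : reflect (exists h, [/\ 2 * h + 1 < #|T| + s,
    0 < #|low_vertices G h| & h + 1 - s <= #|low_vertices G h|]) (low_degrees G s).
Proof.
apply: (iffP existsP) => [[h /and3P[h1 h2 h3]]|[h [h1 h2 h3]]]; first by exists h.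
have hh : h < #|T| + s by lia.
by exists (Ordinal hh); apply/and3P.
Qed.

Section AddEdge.
Variables (G : sgraph T) (u v : T).
Let ae_adj : rel T := fun x y => G x y ||
  ((x != y) && (((x == u) && (y == v)) || ((x == v) && (y == u)))).
Fact ae_sym : symmetric ae_adj.
Proof.
move=> x y; rewrite /ae_adj (adj_sym G) eq_sym; congr (_ || (_ && _)).
by rewrite orbC ![_ && (y == _)]andbC.
Qed.
Fact ae_irr : irreflexive ae_adj.
Proof. by move=> x; rewrite /ae_adj adj_irr eqxx. Qed.
Definition add_edge : sgraph T := SGraph ae_sym ae_irr.
End AddEdge.

Lemma add_edgeP G u v x y : add_edge G u v x y ->
  ~~ G x y -> (x = u /\ y = v) \/ (x = v /\ y = u).
Proof.
rewrite /= => /orP[->//|/andP[_ /orP[]/andP[/eqP-> /eqP->]]] _; [by left|by right].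
Qed.

Lemma low_verticesS (G H : sgraph T) h : (forall x y, G x y -> H x y) ->
  #|low_vertices H h| <= #|low_vertices G h|.
Proof.
move=> GH; apply/subset_leq_card/subsetP => x; rewrite !inE /=; apply: leq_trans.
by apply/subset_leq_card/subsetP => y; rewrite !inE /=; apply: GH.
Qed.

Lemma card_non_nbh G v : #|[set w | (w != v) && ~~ G v w]| = #|T|.-1 - deg G v.
Proof.
have -> : [set w | (w != v) && ~~ G v w] = [set~ v] :\: nbh G setT v.
  by apply/setP => w; rewrite !inE andbC.
rewrite cardsDS ?cardsC1 //; apply/subsetP => w; rewrite !inE /=.
by apply: contraL => /eqP->; rewrite adj_irr.
Qed.

(** The closure argument of Bondy and Chvatal. As long as some non-adjacent
    pair has a large degree sum, an edge can be added. Afterwards the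
    non-neighbours of the larger vertex [v] of a non-adjacent pair with maximum
    degree sum all have degree at most that of the smaller vertex. *)
Theorem stable_low_degrees (P : sgraph T -> Prop) s :
  (forall G, (forall x y, x != y -> G x y) -> P G) ->
  (forall G u v, u != v -> ~~ G u v -> #|T| + s <= (deg G u + deg G v).+1 ->
    P (add_edge G u v) -> P G) ->
  forall G, ~~ low_degrees G s -> P G.
Proof.
move=> Pc Ps G; pose M G := [set p : T * T | (p.1 != p.2) && ~~ G p.1 p.2].
elim: {G}_.+1 {-2}G (ltnSn #|M G|) => // m IH G hm low.
have [M0|/set0Pn[p0 p0M]] := eqVneq (M G) set0.
  apply: Pc => x y nxy; apply: contraT => ngxy.
  by have := in_set0 (x, y); rewrite -M0 inE /= nxy ngxy.
case: (@arg_maxnP _ p0 (mem (M G)) (fun p => deg G p.1 + deg G p.2) p0M) => -[u v] /=.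
rewrite inE /= => /andP[nuv nguv] umax.
have [big|small] := leqP (#|T| + s) (deg G u + deg G v).+1.
  apply: (Ps G u v nuv nguv big); apply: IH.
    apply: leq_trans (_ : #|M G| <= m) => //; apply: proper_card; apply/properP; split.
      by apply/subsetP => -[x y]; rewrite !inE /= negb_or => /andP[-> /andP[->]].
    by exists (u, v); rewrite !inE /= nuv ?nguv // !eqxx orbT.
  apply: contra low => /low_degreesP[h [h1 h2 h3]]; apply/low_degreesP; exists h.
  have := @low_verticesS G (add_edge G u v) h.
  have sub x y : G x y -> add_edge G u v x y by rewrite /= => ->.
  by move=> /(_ sub); split; lia.
case/negP: low; apply/low_degreesP.
wlog uv : u v nuv nguv umax small / deg G u <= deg G v.
  move=> W; case/orP: (leq_total (deg G u) (deg G v)) => uv; first exact: (W u v).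
  apply: (W v u) => //; [by rewrite eq_sym|by rewrite adj_sym| |by rewrite addnC].
  by move=> p hp; rewrite [deg G v + _]addnC; apply: umax.
exists (deg G u); split; first by lia.
  by apply/card_gt0P; exists u; rewrite !inE leqnn.
apply: (@leq_trans #|[set w | (w != v) && ~~ G v w]|); first by rewrite card_non_nbh; lia.
apply/subset_leq_card/subsetP => w; rewrite !inE => /andP[nwv ngvw].
by have := umax (w, v); rewrite inE /= nwv adj_sym ngvw => /(_ isT); lia.
Qed.

End Stability.

(** * Exchanging segments of paths *)

Section Lists.
Variables (T : finType) (e : rel T).
Hypothesis esym : symmetric e.
Implicit Types (p q : seq T).

Lemma path_rev x p : path e x p -> path e (last x p) (rev (belast x p)).
Proof. by rewrite rev_path; apply: sub_path => y z; rewrite esym. Qed.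

Lemma last_rev_belast x p : last (last x p) (rev (belast x p)) = x.
Proof. by case: p => [|y p] //=; rewrite rev_cons last_rcons. Qed.

Lemma rev_consE x p : rev (x :: p) = last x p :: rev (belast x p).
Proof. by rewrite lastI rev_rcons. Qed.

Lemma cycle_swap a p1 w p2 : path e a (p1 ++ w :: p2) -> e a w ->
  e (last w p2) (last a p1) -> cycle e (rev (a :: p1) ++ w :: p2).
Proof.
rewrite cat_path /= => /and3P[h1 h2 h3] aw h.
rewrite rev_consE /= rcons_cat cat_path path_rev // last_rev_belast /= aw.
by rewrite rcons_path h3.
Qed.

Lemma path_swap x q1 m mm t q2 : path e x q1 -> path e m mm -> path e t q2 ->
  e (last x q1) (last m mm) -> e m t -> path e x (q1 ++ rev (m :: mm) ++ t :: q2).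
Proof.
move=> h1 h2 h3 h4 h5; rewrite cat_path h1 rev_consE /= h4 cat_path path_rev //=.
by rewrite last_rev_belast h5.
Qed.

Lemma split_succ x p z : z \in x :: p -> z != last x p ->
  exists r1 w r2, p = r1 ++ w :: r2 /\ last x r1 = z.
Proof.
move=> zp; case/splitPl: zp => r1 [|w r2] <-; first by rewrite cats0 eqxx.
by move=> _; exists r1, w, r2.
Qed.

Lemma next_split (l1 : seq T) z w l2 : uniq (l1 ++ z :: w :: l2) ->
  next (l1 ++ z :: w :: l2) z = w.
Proof.
move=> u; rewrite -(next_rot (size l1) u) rot_size_cat /= eqxx //.
Qed.

Lemma next_inj (p : seq T) : uniq p -> injective (next p).
Proof. by move=> u; apply: can_inj (prev_next u). Qed.

Lemma all_in_uniq (p : seq T) x : uniq p -> size p = #|T| -> x \in p.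
Proof.
move=> u sp; have : [set y in p] = setT.
  by apply/eqP; rewrite eqEcard subsetT cardsT cardsE (card_uniqP u) sp leqnn.
by move/setP/(_ x); rewrite !inE.
Qed.

End Lists.

(** * Hamiltonian paths and cycles under edge addition *)

Section HamStable.
Variable (T : finType).
Implicit Types (G : sgraph T) (u v x y : T) (p q : seq T).

Lemma path_away G u v x p : path (add_edge G u v) x p ->
  u \notin x :: p \/ v \notin x :: p -> path G x p.
Proof.
move=> h away; apply: (sub_in_path (P := mem (x :: p)) _ _ h); last by apply/allP.
move=> a b /= ap bp hab; apply: contraT => nab.
by case: (add_edgeP hab nab) => -[ea eb]; case: away; rewrite -?ea -?eb ?ap ?bp.
Qed.

Lemma new_edge_split G u v x p : path (add_edge G u v) x p -> uniq (x :: p) ->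
  ~~ path G x p -> exists b q1 q2, [/\ p = q1 ++ b :: q2, path G x q1, path G b q2,
    ~~ G (last x q1) b & (last x q1 = u /\ b = v) \/ (last x q1 = v /\ b = u)].
Proof.
elim: p x => [//|y p IH] x /= /andP[hxy hp] /andP[xp up].
have [gxy|ngxy] /= := boolP (G x y).
  move/(IH y hp up) => [b [q1 [q2 [-> h1 h2 h3 h4]]]].
  by exists b, (y :: q1), q2; rewrite /= gxy.
move=> _; exists y, [::], p; split=> //; last exact: add_edgeP hxy ngxy.
by apply: path_away hp _; case: (add_edgeP hxy ngxy) => -[<- _]; [left|right].
Qed.

(** Pigeonhole; the value [b], missed by both sets, improves the bound by one. *)
Lemma inj_meet (f : T -> T) (A B : {set T}) b : injective f -> b \notin f @: A ->
  b \notin B -> #|T| <= #|A| + #|B| -> exists2 z, z \in A & f z \in B.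
Proof.
move=> fi bA bB big.
have : f @: A :&: B != set0.
  apply: contraL big => /eqP e0; rewrite -ltnNge -(card_imset _ fi).
  rewrite -cardsUI e0 cards0 addn0 -cardsT; apply: proper_card.
  by apply/properP; split; [apply: subsetT | exists b; rewrite ?inE // negb_or bA].
by case/set0Pn=> w; rewrite inE => /andP[/imsetP[z zA ->] zB]; exists z.
Qed.

Lemma deg_nbh G v : deg G v = #|nbh G setT v|. Proof. by []. Qed.

Lemma in_nbhT G v w : (w \in nbh G setT v) = G v w.
Proof. by rewrite !inE. Qed.

Lemma next_path x r1 w r2 : uniq (x :: r1 ++ w :: r2) ->
  next (x :: r1 ++ w :: r2) (last x r1) = w.
Proof. by rewrite -cat_cons lastI cat_rcons => /next_split. Qed.

Lemma next_last x p : uniq (x :: p) -> next (x :: p) (last x p) = x.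
Proof.
case/lastP: p => [|p l] up; first by rewrite /=; case: ifP.
rewrite last_rcons -(next_rot (size (x :: p)) up) -cats1 -cat_cons rot_size_cat /=.
by rewrite eqxx.
Qed.

(** Ore's exchange for a path with fixed ends: some neighbour [z] of [a],
    other than the final vertex, has a successor that is adjacent to [b]; the
    segment between the missing edge [ab] and the edge after [z] is
    reversed. *)
Lemma ham_path_stable G u v x y : u != v -> ~~ G u v ->
  #|T| + 2 <= (deg G u + deg G v).+1 ->
  (exists2 p, ham_path (add_edge G u v) x p & last x p = y) ->
  exists2 p, ham_path G x p & last x p = y.
Proof.
move=> nuv nguv big [p /andP[/andP[hp up] sp] ly].
have [hG|nG] := boolP (path G x p); first by exists p; rewrite // /ham_path /is_path hG up.
have [b [q1 [q2 [ep h1 h2 nab abE]]]] := new_edge_split hp up nG.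
set a := last x q1 in nab abE; set s := x :: p in up sp.
have nxab : next s a = b by rewrite /s ep next_path // -ep.
have fi : injective (next s) := next_inj up.
have [z] : exists2 z, z \in nbh G setT a :\ y & next s z \in nbh G setT b.
  apply: (@inj_meet _ _ _ b fi).
  - apply/imsetP => -[z]; rewrite !inE /= => /andP[_ gaz] e.
    by rewrite -nxab in e; rewrite -(fi _ _ e) adj_irr in gaz.
  - by rewrite in_nbhT adj_irr.
  - have : deg G a + deg G b = deg G u + deg G v.
      by case: abE => -[-> ->] //; rewrite addnC.
    rewrite !deg_nbh => e; have := cardsD1 y (nbh G setT a); move: big e.
    by rewrite !deg_nbh; case: (y \in _) => /=; lia.
rewrite 2!inE in_nbhT in_nbhT => /andP[zy gaz] gbw.
have zs : z \in s by apply: all_in_uniq up (eqP sp).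
suff [p' hp' [lp' pp']] : exists2 p', path G x p' & last x p' = y /\ perm_eq p' p.
  exists p' => //; rewrite /ham_path /is_path hp' /=.
  have perm : perm_eq (x :: p') (x :: p) by rewrite perm_cons.
  by rewrite -/(uniq (x :: p')) (perm_uniq perm) up /= (perm_size pp').
have ly2 : last b q2 = y by rewrite -ly ep last_cat.
rewrite /s ep -cat_cons mem_cat in zs; case/orP: zs => zs.
  have za : z != last x q1 by apply: contraTneq gaz => ->; rewrite adj_irr.
  have [r1 [w [r2 [eq1 lz]]]] := split_succ zs za.
  have es : s = x :: r1 ++ w :: (r2 ++ b :: q2) by rewrite /s ep eq1 -catA.
  have nz : next s z = w by rewrite es -lz next_path // -es.
  rewrite eq1 cat_path /= in h1; case/and3P: h1 => k1 k2 k3.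
  have ea : a = last w r2 by rewrite /a eq1 last_cat.
  exists (r1 ++ rev (w :: r2) ++ b :: q2).
    apply: path_swap => //; first exact: adj_sym.
    - by rewrite lz -ea adj_sym.
    - by rewrite -nz adj_sym.
  split; first by rewrite !last_cat.
  by rewrite ep eq1 -catA perm_cat2l perm_cat2r perm_rev.
have zb : z != last b q2 by rewrite ly2.
have [r1 [w [r2 [eq2 lz]]]] := split_succ zs zb.
have es : s = x :: (q1 ++ b :: r1) ++ w :: r2 by rewrite /s ep eq2 -catA.
have nz : next s z = w.
  have -> : z = last x (q1 ++ b :: r1) by rewrite last_cat.
  by rewrite es next_path // -es.
rewrite eq2 cat_path /= in h2; case/and3P: h2 => k1 k2 k3.
exists (q1 ++ rev (b :: r1) ++ w :: r2).
  apply: path_swap => //; first exact: adj_sym.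
  - by rewrite lz.
  - by rewrite -nz.
split; first by rewrite !last_cat /= -ly2 eq2 last_cat.
by rewrite ep eq2 perm_cat2l -cat_cons perm_cat2r perm_rev.
Qed.

(** Ore's exchange for cycles: some neighbour [z] of the last vertex has a
    successor that is adjacent to the first; reversing the part up to [z] closes
    the path to a cycle. *)
Lemma hamiltonian_of_path G a p : path G a p -> uniq (a :: p) -> size (a :: p) = #|T| ->
  2 < #|T| -> ~~ G a (last a p) -> #|T| <= deg G a + deg G (last a p) -> hamiltonian G.
Proof.
move=> hp up sp n2 nab big; set s := a :: p in up sp; set b := last a p in nab big.
have fi : injective (next s) := next_inj up.
have nxb : next s b = a by apply: next_last.
have [z] : exists2 z, z \in nbh G setT b & next s z \in nbh G setT a.
  apply: (@inj_meet _ _ _ a fi).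
  - apply/imsetP => -[z]; rewrite in_nbhT => gbz e.
    by rewrite -nxb in e; rewrite -(fi _ _ e) adj_irr in gbz.
  - by rewrite in_nbhT adj_irr.
  - by rewrite addnC.
rewrite !in_nbhT => gbz gaw.
have zb : z != last a p by apply: contraTneq gbz => ->; rewrite adj_irr.
have [r1 [w [r2 [eq1 lz]]]] := split_succ (all_in_uniq z up sp) zb.
have nz : next s z = w by rewrite /s eq1 -lz next_path // -eq1.
have perm : perm_eq (rev (a :: r1) ++ w :: r2) s.
  by rewrite /s eq1 -cat_cons perm_cat2r perm_rev.
exists (rev (a :: r1) ++ w :: r2); apply/andP; split; last by rewrite (perm_size perm) sp.
rewrite /is_cycle (perm_size perm) sp n2 (perm_uniq perm) up andbT.
apply: cycle_swap; first exact: adj_sym.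
- by rewrite -eq1.
- by rewrite -nz.
- by rewrite lz; move: gbz; rewrite /b eq1 last_cat.
Qed.

(** Rotated so that the added edge closes it, a Hamiltonian cycle becomes a
    Hamiltonian path of [G] between the ends of that edge. *)
Lemma hamiltonian_stable G u v : u != v -> ~~ G u v -> 2 < #|T| ->
  #|T| + 1 <= (deg G u + deg G v).+1 ->
  hamiltonian (add_edge G u v) -> hamiltonian G.
Proof.
move=> nuv nguv n2 big [c /andP[/and3P[c2 cc uc] sc]].
have [hG|] := boolP (cycle G c).
  by exists c; rewrite /ham_cycle /is_cycle c2 hG uc sc.
have [/hasP[b bc nba]|/hasPn all] := boolP (has (fun w => ~~ G w (next c w)) c); last first.
  case/negP; apply: cycle_from_next => // w wc.
  by have := all w wc; rewrite negbK.
move=> _; set a := next c b in nba.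
have abE := add_edgeP (next_cycle cc bc) nba; rewrite -/a in abE.
have ac : a \in c by rewrite mem_next.
case: (rot_to ac) => i p ep.
have up : uniq (a :: p) by rewrite -ep rot_uniq.
have cp : cycle (add_edge G u v) (a :: p) by rewrite -ep rot_cycle.
have szp : size (a :: p) = #|T| by rewrite -ep size_rot (eqP sc).
have lb : last a p = b.
  by apply: (next_inj up); rewrite -[in RHS]ep next_rot // next_last.
have hp : path G a p.
  case: p ep up cp szp lb => [|y p] ep up //= cp szp lb.
  case/andP: cp => hay; rewrite rcons_path => /andP[hyp _].
  case/andP: (up) => na uyp.
  have -> : path G y p by apply: path_away hyp _; case: abE => -[_ <-]; [right|left].
  rewrite andbT; apply: contraT => nay.
  have yb : y = b.
    have nab : a != b by case: abE => -[-> ->]; rewrite // eq_sym.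
    case: abE (add_edgeP hay nay) => -[eb ea] [] [e1 e2]; rewrite ?e2 -?eb //.
    - by rewrite e1 -eb eqxx in nab.
    - by rewrite e1 -eb eqxx in nab.
  case: p uyp lb szp {hyp up na ep} => [|y' p] uyp lb szp; first by rewrite -szp in n2.
  by move: uyp; rewrite yb -lb /= mem_last.
apply: (hamiltonian_of_path hp up szp n2); rewrite lb.
  by rewrite adj_sym.
move: big; rewrite addn1 ltnS; case: abE => -[-> ->] //.
by rewrite addnC.
Qed.

End HamStable.

(** * Properties forced by the absence of many low degrees *)

Section Properties.
Variable (T : finType).
Implicit Types (G : sgraph T) (x y : T) (p : seq T).

Lemma complete_path G x p : (forall x y, x != y -> G x y) -> uniq (x :: p) -> path G x p.
Proof.
move=> Gc; elim: p x => //= y p IH x /andP[xp up]; rewrite IH // andbT.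
by apply: Gc; apply: contraNneq xp => ->; rewrite mem_head.
Qed.

(** Chvatal's theorem, from the complete graph by Ore's exchange. *)
Lemma hamiltonian_low_degrees G : 2 < #|T| -> ~~ low_degrees G 1 -> hamiltonian G.
Proof.
move=> n2; apply: stable_low_degrees => [{}G Gc|{}G u v nuv nguv]; last exact: hamiltonian_stable.
exists (enum T); rewrite /ham_cycle /is_cycle -cardE n2 enum_uniq eqxx !andbT /=.
case: (enum T) (enum_uniq T) n2 (cardE T) => [|x p] up n2 cT; first by rewrite cT in n2.
rewrite /= rcons_path complete_path //=; apply: Gc.
case: p up cT => [|y p] up cT; first by rewrite cT in n2.
by apply: contraTneq up => /= <-; rewrite -[last y p \in _]/(_ \in y :: p) mem_last.
Qed.

Lemma ham_connected_low_degrees G : ~~ low_degrees G 2 -> ham_connected G.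
Proof.
move=> low x y nxy; move: G low.
apply: stable_low_degrees => [{}G Gc|{}G u v nuv nguv]; last exact: ham_path_stable.
pose q := [seq z <- enum T | (z != x) && (z != y)].
have up : uniq (x :: rcons q y).
  rewrite /= rcons_uniq mem_rcons inE (negPf nxy) !mem_filter !eqxx /= andbF /=.
  by rewrite filter_uniq ?enum_uniq.
exists (rcons q y); last by rewrite last_rcons.
rewrite /ham_path /is_path complete_path // up /=.
rewrite -[#|T|]cardsT; have -> : [set: T] = [set z in x :: rcons q y].
  apply/setP => z; rewrite !inE mem_rcons inE mem_filter mem_enum /=.
  by case: eqP => //= _; case: eqP.
by rewrite cardsE (card_uniqP up).
Qed.

Lemma cone_deg G x : deg (add_vertex G setT) (Some x) = (deg G x).+1.
Proof.
rewrite /deg (cardsD1 None) !inE /= inE add1n; congr _.+1.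
rewrite -(card_imset (mem (nbh G setT x)) Some_inj); apply: eq_card => -[y|]; rewrite !inE /=.
  by rewrite mem_imset ?inE //; apply: Some_inj.
by apply/esym/negP => /imsetP[].
Qed.

Lemma cone_deg_apex G : deg (add_vertex G setT) None = #|T|.
Proof.
rewrite /deg -cardsT -(card_imset (mem [set: T]) Some_inj); apply: eq_card => -[y|]; rewrite !inE /=.
  by rewrite inE mem_imset ?inE //; apply: Some_inj.
by apply/esym/negP => /imsetP[].
Qed.

End Properties.

(** Apply Chvatal's theorem to the cone, whose Hamiltonian cycles pass through
    the apex; all other degrees grow by one. *)
Lemma traceable_low_degrees (T : finType) (G : sgraph T) : 0 < #|T| -> ~~ low_degrees G 0 -> traceable G.
Proof.
move=> n0 low; have [n1|n1] := leqP #|T| 1.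
  have /card_gt0P[x _] := n0; exists x, [::].
  by rewrite /ham_path /is_path /= eqn_leq n0 n1.
have cT : #|{: option T}| = #|T|.+1 by rewrite card_option.
have : hamiltonian (add_vertex G setT).
  apply: hamiltonian_low_degrees; first by rewrite cT.
  apply: contra low => /low_degreesP[h]; rewrite cT => -[h1 h2 h3].
  apply/low_degreesP; exists h.-1; case: h h1 h2 h3 => [|h] h1 h2 h3 /=.
    case/card_gt0P: h2 => -[x|]; first by rewrite !inE cone_deg.
    by rewrite !inE cone_deg_apex; lia.
  have e : #|low_vertices (add_vertex G setT) h.+1| = #|low_vertices G h|.
    rewrite -(card_imset (mem (low_vertices G h)) Some_inj).
    apply: eq_card => -[y|]; rewrite !inE /=.
      by rewrite cone_deg ltnS mem_imset ?inE //; apply: Some_inj.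
    rewrite cone_deg_apex; apply/idP/imsetP => [|[]//]; lia.
  by rewrite -e; simpl in *; split; lia.
case=> c /andP[/and3P[c2 cc uc] /eqP sc].
have Nc : None \in c by apply: all_in_uniq.
case: (rot_to Nc) => i p ep.
have : cycle (add_vertex G setT) (None :: p) by rewrite -ep rot_cycle.
have : uniq (None :: p) by rewrite -ep rot_uniq.
have : size (None :: p) = #|T|.+1 by rewrite -ep size_rot sc cT.
case: p {ep} => [|[x|] p] /= sp; [|idtac|by []].
  by case: sp n1 => <-.
case/andP=> Np /andP[xp up]; rewrite rcons_path => /and3P[_ hp _].
have [q ep] : exists q, p = map Some q.
  exists (pmap id p); elim: p Np {xp up hp sp} => //= -[z|] p IH //=.
  by rewrite inE /= => /IH {1}->.
subst p; exists x, q; rewrite /ham_path /is_path.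
rewrite path_map in hp; rewrite (mem_map Some_inj) in xp.
rewrite (map_inj_uniq Some_inj) in up; rewrite size_map in sp.
rewrite /= xp up /= andbT; apply/andP; split; last by case: sp => ->.
by apply: sub_path hp.
Qed.

(** * Deleting vertices *)

Section DeletedDegrees.
Variables (T : finType) (G : sgraph T) (S : {set T}).

Lemma card_deleted : #|{: {x : T | x \notin S}}| = #|T| - #|S|.
Proof.
rewrite card_sig; have -> : #|[pred x | x \notin S]| = #|~: S|.
  by apply: eq_card => x; rewrite !inE.
by rewrite cardsCs setCK.
Qed.

(** Restoring [S] raises degrees by at most [#|S|], so the threshold [h] becomes
    [h + #|S|]. *)
Lemma deleted_low_degrees s : low_degrees (del_verts G S) s -> low_degrees G (s + #|S|).
Proof.
move=> /low_degreesP[h]; rewrite card_deleted => -[h1 h2 h3].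
have SG : #|S| <= #|T| by apply: max_card.
have le : #|low_vertices (del_verts G S) h| <= #|low_vertices G (h + #|S|)|.
  rewrite -(card_imset (mem (low_vertices (del_verts G S) h)) val_inj).
  apply/subset_leq_card/subsetP => _ /imsetP[x hx ->]; move: hx; rewrite !inE /= => hx.
  apply: (@leq_trans #|(val @: nbh (del_verts G S) setT x) :|: S|).
    apply/subset_leq_card/subsetP => y; rewrite !inE /= => gxy.
    have [yS|yS] := boolP (y \in S); first by rewrite orbT.
    by rewrite orbF; apply/imsetP; exists (Sub y yS) => //; rewrite !inE.
  apply: leq_trans (leq_card_setU _ _) _; rewrite leq_add2r.
  by rewrite card_imset //; apply: val_inj.
apply/low_degreesP; exists (h + #|S|); split; first by simpl in *; lia.
- exact: leq_trans le.
- by apply: leq_trans le; apply: leq_trans h3; lia.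
Qed.

End DeletedDegrees.

(** A small component consists of vertices of low degree. *)
Lemma connected_low_degrees (T : finType) (G : sgraph T) : ~~ low_degrees G 0 -> connected G.
Proof.
move=> low x y; apply: contraR low => nxy.
have csym : connect_sym G.
  by apply: sym_connect_sym; apply: adj_sym.
wlog half : x y nxy / 2 * #|[set z | connect G x z]| <= #|T|.
  move=> W; have [|big] := leqP (2 * #|[set z | connect G x z]|) #|T|; first exact: (W x y).
  apply: (W y x); first by rewrite csym.
  have : [disjoint [set z | connect G x z] & [set z | connect G y z]].
    rewrite disjoint_subset; apply/subsetP => z; rewrite !inE => xz.
    by apply: contra nxy => yz; apply: connect_trans xz _; rewrite csym.
  move=> /disjoint_setI0 dis.
  have := cardsUI [set z | connect G x z] [set z | connect G y z].
  rewrite dis cards0 addn0 => e.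
  have := subset_leq_card (subsetT ([set z | connect G x z] :|: [set z | connect G y z])).
  by rewrite cardsT; move: big e; clear; simpl in *; lia.
set A := [set z | connect G x z] in half.
have A0 : 0 < #|A| by apply/card_gt0P; exists x; rewrite inE.
have Alow : A \subset low_vertices G #|A|.-1.
  apply/subsetP => z zA; rewrite !inE /= /deg.
  rewrite -ltnS prednK //; apply: proper_card; apply/properP; split.
    apply/subsetP => w; rewrite !inE /= => gzw; move: zA; rewrite inE => xz.
    exact: connect_trans xz (connect1 gzw).
  by exists z; rewrite // !inE adj_irr.
have := subset_leq_card Alow => le.
apply/low_degreesP; exists #|A|.-1; split; lia.
Qed.

Section DeletionProperties.
Variables (T : finType) (G : sgraph T).
Implicit Types (S : {set T}).

Lemma hamiltonian_deleted k : k + 2 < #|T| ->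
  (forall s, s <= k.+1 -> ~~ low_degrees G s) -> k_hamiltonian G k.
Proof.
move=> nk low S Sk; apply: hamiltonian_low_degrees.
  by rewrite card_deleted; lia.
by apply: contra (low (1 + #|S|) _); [apply: deleted_low_degrees | lia].
Qed.

Lemma ham_connected_deleted k :
  (forall s, s <= k.+1 -> ~~ low_degrees G s) -> k_ham_connected G k.
Proof.
move=> low S Sk; apply: ham_connected_low_degrees.
by apply: contra (low (2 + #|S|) _); [apply: deleted_low_degrees | lia].
Qed.

Lemma connected_deleted k :
  (forall s, s < k -> ~~ low_degrees G s) -> k_connected G k.
Proof.
move=> low S Sk; apply: connected_low_degrees.
by apply: contra (low (0 + #|S|) _); [apply: deleted_low_degrees | lia].
Qed.

Lemma path_prefix_cycle (x : T) (p r : seq T) : uniq (x :: p ++ r) -> path (cycle_edge (x :: p ++ r)) x p.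
Proof.
move=> u; apply/(pathP x) => i ip; apply/and3P; split.
- rewrite -cat_cons mem_cat (mem_nth x) //=; exact: leqW.
- by rewrite -cat_cons mem_cat orbC /= inE [nth x p i \in p]mem_nth ?orbT.
- apply/orP; left; rewrite next_nth.
  have e : nth x (x :: p) i = nth x (x :: p ++ r) i.
    by rewrite -cat_cons nth_cat /= ltnS ltnW.
  have isz : i < size (x :: p ++ r) by rewrite /= size_cat; lia.
  by rewrite e mem_nth // index_uniq // nth_cat ip.
Qed.

(** A path with at least one edge is closed up by a Hamiltonian path between
    its ends in the graph without its interior. *)
Lemma path_hamiltonian_deleted k : 2 < #|T| -> hamiltonian G -> k_ham_connected G k ->
  path_hamiltonian G k.
Proof.
move=> n2 hG hC x p /andP[hp up] pk.
case/lastP: p hp up pk => [|q y] hp up pk.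
  case: hG => c hc; exists c; split=> //; case/andP: hc => /and3P[_ _ uc] /eqP sc.
  exact: all_in_uniq.
have [xq yq nxy uq] : [/\ x \notin q, y \notin q, x != y & uniq q].
  move: up; rewrite /= rcons_uniq mem_rcons inE negb_or.
  by case/andP=> /andP[-> ->] /andP[-> ->].
pose S := [set z in q].
have cS : #|S| = size q by rewrite cardsE; apply/card_uniqP.
have xS : x \notin S by rewrite inE.
have yS : y \notin S by rewrite inE.
rewrite size_rcons in pk.
have Sk : #|S| < k by rewrite cS.
pose x' : {x : T | x \notin S} := Sub x xS; pose y' : {x : T | x \notin S} := Sub y yS.
have nyx : y' != x' by rewrite -val_eqE /= eq_sym.
have [l /andP[/andP[hl ul] sl] ll] := hC S Sk y' x' nyx.
case/lastP: l hl ul sl ll => [|l x2] hl ul sl; rewrite ?last_rcons /=.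
  by move=> e; rewrite e eqxx in nyx.
move=> e2; rewrite {x2}e2 in hl ul sl.
exists (x :: rcons q y ++ map val l).
have uc : uniq (x :: rcons q y ++ map val l).
  rewrite -cat_cons cat_uniq up (map_inj_uniq val_inj).
  move: ul; rewrite /= rcons_uniq mem_rcons inE negb_or => /andP[/andP[_ nyl] /andP[nxl ->]].
  rewrite andbT /=; apply/hasPn => _ /mapP[z zl ->].
  rewrite /= inE mem_rcons inE !negb_or; apply/and3P; split.
  - by apply: contraNneq nxl => /= e; rewrite (_ : x' = z) //; apply: val_inj.
  - by apply: contraNneq nyl => /= e; rewrite (_ : y' = z) //; apply: val_inj.
  - by have := valP z; rewrite inE.
have sc : size (x :: rcons q y ++ map val l) = #|T|.
  rewrite /= size_cat size_rcons size_map.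
  move: sl; rewrite card_deleted /= size_rcons cS => /eqP.
  have : #|x |: S| <= #|T| by rewrite -cardsT; apply/subset_leq_card/subsetT.
  rewrite cardsU1 xS.
  by rewrite cS; clear; simpl; lia.
split; last exact: path_prefix_cycle.
- apply/andP; split; last by rewrite sc.
  apply/and3P; split; [by rewrite sc| |exact: uc].
  rewrite /= rcons_cat cat_path hp last_rcons /=.
  have -> : rcons (map val l) x = map val (rcons l x') by rewrite map_rcons.
  by rewrite -[y]/(val y') path_map.
- exact: mem_head.
Qed.

End DeletionProperties.

(** * Cycles of all lengths *)

Lemma split_segment (T : Type) (x0 : T) (l : seq T) f j : f <= j -> j < size l ->
  exists seg, [/\ l = take f l ++ nth x0 l f :: seg ++ drop j.+1 l, size seg = j - f &
    last (nth x0 l f) seg = nth x0 l j].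
Proof.
move=> fj jl; have fl : f < size l by apply: leq_ltn_trans jl.
exists (take (j - f) (drop f.+1 l)).
have sz : size (take (j - f) (drop f.+1 l)) = j - f.
  by rewrite size_takel // size_drop; lia.
split=> //.
  have -> : drop j.+1 l = drop (j - f) (drop f.+1 l) by rewrite drop_drop; congr drop; lia.
  by rewrite cat_take_drop -drop_nth // cat_take_drop.
rewrite (last_nth x0) sz; case e: (j - f) => [|k] /=; first by congr nth; lia.
by rewrite nth_take // nth_drop; congr nth; lia.
Qed.

Section Bondy.
Variables (T : finType) (G : sgraph T).
Implicit Types (c l : seq T) (p : nat).

(** Along a Hamiltonian cycle [a, b, l], a chord from [a] to [l_j] and one from
    [b] to [l_(j + n + 1 - p)], indices modulo [n - 2], close up a cycle of
    length [p]. *)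
Lemma two_chords_cycle a b l p j : cycle G (a :: b :: l) -> uniq (a :: b :: l) ->
  3 < p -> p < (size l).+2 -> j < size l -> G a (nth a l j) ->
  G b (nth a l ((j + (size l + 3 - p)) %% size l)) ->
  exists c, is_cycle G c /\ size c = p.
Proof.
move=> hc ul p3 pl jl gaj gbj.
move: hc => /= /andP[gab]; rewrite rcons_path => /andP[hl la].
have m0 : 0 < size l by apply: leq_ltn_trans jl.
have [jp|jp] := leqP p (j + 3).
  have e : (j + (size l + 3 - p)) %% size l = j + 3 - p.
    have -> : j + (size l + 3 - p) = size l + (j + 3 - p) by lia.
    by rewrite modnDl modn_small //; lia.
  rewrite {}e in gbj; set f := j + 3 - p in gbj.
  have fj : f <= j by rewrite /f; lia.
  have [seg [el sz ls]] := split_segment a fj jl.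
  set s := nth a l f in el ls gbj.
  have szp : size (a :: b :: s :: seg) = p by rewrite /= sz /f; lia.
  exists (a :: b :: s :: seg); split=> //; apply/and3P; split; first by rewrite szp; lia.
    rewrite /= gab gbj rcons_path ls (adj_sym G _ a) gaj andbT /=.
    by move: hl; rewrite el cat_path /= cat_path => /and4P[].
  apply: (subseq_uniq _ ul); rewrite /= !eqxx el -cat_cons.
  by apply: subseq_trans (suffix_subseq _ _); apply: prefix_subseq.
have e : (j + (size l + 3 - p)) %% size l = j + (size l + 3 - p).
  by rewrite modn_small //; lia.
rewrite {}e in gbj; set f := j + (size l + 3 - p) in gbj.
have jf : j < f by rewrite /f; lia.
have fl : f < size l by rewrite /f; lia.
have [seg [el sz ls]] := split_segment a (leq0n j) jl.
have m1 : (size l).-1 < size l by lia.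
have fm : f <= (size l).-1 by lia.
have [seg' [el' sz' ls']] := split_segment a fm m1.
rewrite take0 /= in el; rewrite prednK // drop_size cats0 in el'.
set s0 := nth a l 0 in el ls; set t := nth a l f in el' ls' gbj.
have lt : last t seg' = last b l.
  by rewrite ls' (last_nth a) -[in RHS](prednK m0).
have szp : size (b :: (s0 :: seg) ++ a :: rev (t :: seg')) = p.
  by rewrite /= size_cat /= size_rev /= sz sz'; lia.
exists (b :: (s0 :: seg) ++ a :: rev (t :: seg')); split=> //.
apply/and3P; split; first by rewrite szp; lia.
  rewrite /= rcons_cat cat_path /= rev_consE rcons_path.
  move: (hl); rewrite {1}el /= cat_path => /and3P[-> -> _] /=.
  rewrite ls (adj_sym G _ a) gaj /= last_rev_belast (adj_sym G t) gbj andbT.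
  rewrite path_rev; [by rewrite lt (adj_sym G a) la|exact: adj_sym|].
  by move: hl; rewrite {1}el' cat_path => /= /and3P[].
have -> : s0 :: seg = take j.+1 l.
  by rewrite {1}el -cat_cons take_size_cat //= sz subn0.
have -> : t :: seg' = drop f l.
  by rewrite {1}el' drop_size_cat // size_takel // ltnW.
have perm : perm_eq (b :: take j.+1 l ++ a :: rev (drop f l)) (a :: b :: take j.+1 l ++ drop f l).
  rewrite -[X in perm_eq X _]/((b :: take j.+1 l) ++ [:: a] ++ rev (drop f l)) perm_catCA /=.
  by rewrite !perm_cons perm_cat2l perm_rev.
rewrite (perm_uniq perm); apply: (subseq_uniq _ ul); rewrite /= !eqxx.
rewrite -[X in subseq _ X](cat_take_drop j.+1 l); apply: cat_subseq => //.
have -> : drop f l = drop (f - j.+1) (drop j.+1 l) by rewrite drop_drop subnK.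
exact: drop_subseq.
Qed.

(** By [two_chords_cycle] the shift of indices by [n + 1 - p] modulo [n - 2] maps
    neighbours of [a] to non-neighbours of [b]. *)
Lemma consecutive_deg_sum c p : ham_cycle G c -> 3 < p -> p < #|T| ->
  (forall c', is_cycle G c' -> size c' <> p) ->
  {in c, forall a, deg G a + deg G (next c a) <= #|T|}.
Proof.
move=> /andP[/and3P[c2 cc uc] /eqP sc] p3 pn noc a ac.
case: (rot_to ac) => i l0 el0.
have ul0 : uniq (a :: l0) by rewrite -el0 rot_uniq.
have cl0 : cycle G (a :: l0) by rewrite -el0 rot_cycle.
have sl0 : size (a :: l0) = #|T| by rewrite -el0 size_rot.
have nb : next c a = next (a :: l0) a by rewrite -el0 next_rot.
case: l0 ul0 cl0 sl0 nb {el0} => [|b l] ul cl sl; first by rewrite -sc in sl; case: c c2 sl {ac cc uc sc} => [|? [|]].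
rewrite /= eqxx => ->.
have slT : (size l).+2 = #|T| by [].
pose X := [set j : 'I_(size l) | G a (nth a l j)].
pose Y := [set j : 'I_(size l) | G b (nth a l j)].
have dega v : v \in a :: b :: l -> v \notin l ->
   deg G v <= #|[set j : 'I_(size l) | G v (nth a l j)]|.+1.
  move=> vab vl; set Z := [set j | _].
  pose o := if v == a then b else a.
  apply: (@leq_trans #|o |: [set nth a l (val j) | j in Z]|); last first.
    by apply: leq_trans (leq_card_setU _ _) _; rewrite cards1 add1n ltnS leq_imset_card.
  apply/subset_leq_card/subsetP => w; rewrite in_nbhT => gvw; rewrite !inE.
  have wT : w \in a :: b :: l by apply: all_in_uniq.
  have [wl|wl] := boolP (w \in l).
    apply/orP; right; apply/imsetP.
    have iw : index w l < size l by rewrite index_mem.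
    by exists (Ordinal iw); rewrite ?inE /= nth_index.
  apply/orP; left; move: wT vab; rewrite !inE (negPf wl) (negPf vl) !orbF /o.
  case/orP=> /eqP ew; case/orP=> /eqP ev; move: gvw; rewrite ew ev.
  - by rewrite adj_irr.
  - by move=> _; case: ifP => [/eqP->|_]; rewrite eqxx.
  - by move=> _; rewrite !eqxx.
  - by rewrite adj_irr.
have [nal nbl] : a \notin l /\ b \notin l.
  by move: ul; rewrite /= inE negb_or => /andP[/andP[_ ->] /andP[->]].
have da : deg G a <= #|X|.+1 by apply: dega; rewrite // mem_head.
have db : deg G b <= #|Y|.+1 by apply: dega; rewrite // !inE eqxx orbT.
have m0 : 0 < size l by lia.
pose g (j : 'I_(size l)) : 'I_(size l) := Ordinal (ltn_pmod (j + (size l + 3 - p)) m0).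
have ginj : injective g.
  move=> i1 i2 /(congr1 val) /= /eqP; rewrite eqn_modDr !modn_small // => /eqP; exact: val_inj.
have dis : g @: X :&: Y = set0.
  apply/setP => k; rewrite !inE; apply/negP => /andP[/imsetP[j]].
  rewrite inE => gaj -> /= gbj.
  have pl : p < (size l).+2 by rewrite slT.
  have [c' [h1 h2]] := two_chords_cycle cl ul p3 pl (ltn_ord j) gaj gbj.
  exact: noc h1 h2.
have : #|X| + #|Y| <= size l.
  rewrite -(card_imset _ ginj) -cardsUI dis cards0 addn0 -[leqRHS]card_ord.
  exact: max_card.
by rewrite -slT; lia.
Qed.

(** Bondy's argument: the degree sums over the edges of the cycle add up to four
    times the number of edges. *)
Theorem bondy_cycle c p : ham_cycle G c -> 3 < p -> p < #|T| ->
  #|T| * #|T| < 4 * cl G setT 2 ->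
  exists c', is_cycle G c' /\ size c' = p.
Proof.
move=> hc p3 pn big.
have [/existsP[c' h]|/existsPn no] := boolP [exists c' : p.-tuple T, is_cycle G c'].
  by exists c'; rewrite size_tuple.
have noc c' : is_cycle G c' -> size c' <> p.
  by move=> h /eqP e; have := no (Tuple e); rewrite h.
have := consecutive_deg_sum hc p3 pn noc.
case/andP: hc => /and3P[_ _ uc] /eqP sc => le.
have : \sum_(a : T) (deg G a + deg G (next c a)) <= \sum_(a : T) #|T|.
  by apply: leq_sum => a _; apply: le; apply: all_in_uniq.
rewrite big_split /= -(reindex_inj (next_inj uc) (P := xpredT) (F := deg G)) /=.
have -> : \sum_(i : T) #|T| = #|T| * #|T|.
  by rewrite -[RHS]sum_nat_const; apply: eq_bigl.
have -> : \sum_(i : T) deg G i = 2 * cl G setT 2.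
  by rewrite -handshake; apply: eq_bigl => i; rewrite inE.
by move: big; simpl; lia.
Qed.

End Bondy.

(** * Chords *)

Section Chords.
Variables (T : finType) (G : sgraph T).
Implicit Types (A B : {set T}) (c : seq T) (a b d x y w : T).

Lemma edges_setU A B : [disjoint A & B] ->
  cl G (A :|: B) 2 = cl G A 2 + \sum_(w in B) #|nbh G A w| + cl G B 2.
Proof.
elim/setD1_ind: B => [|B v vB IH] dis.
  by rewrite setU0 big_set0 cl_set0 !addn0.
have vA : v \notin A by rewrite (disjointFl dis).
have vAB : v \in A :|: B by rewrite inE vB orbT.
rewrite (edgeS G vAB) (edgeS G vB) (big_setD1 v vB) /=.
have -> : (A :|: B) :\ v = A :|: (B :\ v).
  by apply/setP => x; rewrite !inE; case: eqP => [->|] //=; rewrite (negPf vA).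
rewrite IH; last by apply: disjointWr dis; apply: subD1set.
have -> : #|nbh G (A :|: B) v| = #|nbh G A v| + #|nbh G B v|.
  have -> : nbh G (A :|: B) v = nbh G A v :|: nbh G B v.
    by apply/setP => x; rewrite !inE andb_orl.
  rewrite cardsU disjoint_setI0 ?cards0 ?subn0 //.
  by apply: disjointWl (nbh_sub _ _ _) _; apply: disjointWr (nbh_sub _ _ _) _.
lia.
Qed.

Lemma edges_few_outside A r k m : omega_le G setT r -> #|A| = k ->
  {in ~: A, forall w, #|nbh G A w| <= m} ->
  cl G setT 2 <= cl G A 2 + (#|T| - k) * m + turan_cl 2 r (#|T| - k).
Proof.
move=> om cA few; have cC : #|~: A| = #|T| - k by rewrite cardsCs setCK cA.
rewrite -(setUCr A) edges_setU; last by rewrite -setI_eq0 setICr.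
rewrite -cC; apply: leq_add.
  by rewrite leq_add2l -sum_nat_const; apply: leq_sum.
by apply: zykov; apply: omega_sub om; apply: subsetT.
Qed.

Definition chordless c : bool :=
  [forall x, forall y, [&& x \in c, y \in c & G x y] ==> cycle_edge c x y].

Lemma chordlessPn c : ~~ chordless c -> has_chord G c.
Proof.
rewrite negb_forall => /existsP[x]; rewrite negb_forall => /existsP[y].
by rewrite negb_imply => /andP[/and3P[xc yc gxy] n]; exists x, y.
Qed.

Lemma chordless_edge c x y : uniq c -> chordless c -> x \in c -> y \in c -> G x y ->
  y = next c x \/ y = prev c x.
Proof.
move=> uc /forallP/(_ x)/forallP/(_ y) h xc yc gxy; move: h; rewrite xc yc gxy /=.
by case/and3P=> _ _ /orP[] /eqP <-; [left | right; rewrite prev_next].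
Qed.

Lemma chordless_degree c x : uniq c -> chordless c -> x \in c ->
  #|nbh G [set z in c] x| <= 2.
Proof.
move=> uc ch xc; apply: (@leq_trans #|[set next c x; prev c x]|).
  apply/subset_leq_card/subsetP => y; rewrite !inE => /andP[yc gxy].
  by case: (chordless_edge uc ch xc yc gxy) => ->; rewrite eqxx ?orbT.
by rewrite cards2; case: (_ != _).
Qed.

Lemma chordless_edges c : uniq c -> chordless c -> cl G [set z in c] 2 <= size c.
Proof.
move=> uc ch; rewrite -(leq_pmul2l (isT : 0 < 2)) -handshake.
have -> : 2 * size c = \sum_(v in [set z in c]) 2.
  by rewrite sum_nat_const cardsE (card_uniqP uc) mulnC.
by apply: leq_sum => v; rewrite inE; apply: chordless_degree.
Qed.

(** If [w] is adjacent to two vertices at distance two on a chordless cycle, it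
    can replace the vertex [y] between them. The new cycle is chordless as well,
    so [y] is the only further neighbour of [w]. Otherwise the neighbours of [w]
    and their shifts by two along the cycle are disjoint sets. *)
Lemma chordless_outside p c w : 5 < p ->
  (forall c', is_cycle G c' -> size c' = p -> chordless c') ->
  is_cycle G c -> size c = p -> w \notin c -> #|nbh G [set z in c] w| <= p %/ 2.
Proof.
move=> p5 all hc sc wc; have /and3P[c2 cc uc] := hc.
set N := nbh G [set z in c] w; have Nc : {subset N <= c}.
  by move=> x; rewrite !inE => /andP[].
have NG x : x \in N -> G w x by rewrite inE => /andP[].
pose f := next c \o next c; have fi : injective f by apply: inj_comp; apply: next_inj.
have [e0|/set0Pn[z]] := eqVneq (f @: N :&: N) set0.
  have : #|f @: N| + #|N| <= p.
    rewrite -cardsUI e0 cards0 addn0 -sc -(card_uniqP uc).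
    apply/subset_leq_card/subsetP => x /setUP[/imsetP[y /Nc yc ->]|/Nc //].
    by rewrite !mem_next.
  by rewrite card_imset // leq_divRL //; lia.
rewrite inE => /andP[/imsetP[x xN ez] zN].
have wz := NG _ zN; have wx := NG _ xN; have xc := Nc _ xN.
case: (rot_to xc) => i c' ec.
have hc' : is_cycle G (x :: c').
  by rewrite /is_cycle -ec size_rot c2 rot_cycle cc rot_uniq.
have nr v : next (x :: c') v = next c v by rewrite -ec next_rot.
have szc : size (x :: c') = p by rewrite -ec size_rot.
have memc v : (v \in c) = (v \in x :: c') by rewrite -ec mem_rot.
case: c' ec hc' nr szc memc => [|y [|z' s]] ec hc' nr szc memc.
- by rewrite -szc in p5.
- by rewrite -szc in p5.
have /and3P[_ _ ux] := hc'.
have ez' : z = z'.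
  have nx : next (x :: y :: z' :: s) x = y by apply: (@next_split _ [::]).
  have ny : next (x :: y :: z' :: s) y = z' by apply: (@next_split _ [:: x]).
  by rewrite ez /f [LHS]/= -(nr x) nx -(nr y) ny.
rewrite ez' in wz.
have wL : w \notin x :: y :: z' :: s by rewrite -memc.
have hw : is_cycle G (x :: w :: z' :: s).
  move: hc'; rewrite /is_cycle /= => /andP[/and3P[_ _ hp] /and4P[k1 k2 k3 k4]].
  move: wL k1; rewrite !inE !negb_or => /and4P[n1 n2 n3 n4] /and3P[_ k5 k6].
  by rewrite (adj_sym G x) wx wz hp eq_sym n1 n3 n4 k3 k4 k5 k6.
have sw : size (x :: w :: z' :: s) = p by [].
have chw := all _ hw sw; have /and3P[_ _ uw] := hw.
have win : w \in x :: w :: z' :: s by rewrite !inE eqxx orbT.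
have nw : next (x :: w :: z' :: s) w = z'.
  by rewrite (@next_split _ [:: x]).
have pw : prev (x :: w :: z' :: s) w = x.
  by apply: (next_inj uw); rewrite next_prev //= eqxx.
apply: (@leq_trans 3); last by rewrite leq_divRL.
apply: (@leq_trans #|[set x; y; z']|).
  apply/subset_leq_card/subsetP => v vN; have := Nc v vN; rewrite memc !inE.
  case: (v =P y) => [->|_]; first by rewrite orbT.
  rewrite /= orbF => vL.
  have vin : v \in x :: w :: z' :: s by rewrite !inE; case/or3P: vL => ->; rewrite ?orbT.
  by case: (chordless_edge uw chw win vin (NG v vN)) => ->; rewrite ?nw ?pw eqxx ?orbT.
by apply: leq_trans (leq_card_setU _ _) _; rewrite cards2 cards1; case: (_ != _).
Qed.

(** If all cycles of length [p] are chordless, one of them spans [p] edges, and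
    every other vertex has at most [p / 2] neighbours on it: too few edges. *)
Lemma long_chorded_cycle r p : 2 < r -> omega_le G setT r -> 5 < p -> p <= #|T| ->
  turan_cl 2 r #|T|.-1 + 1 < cl G setT 2 ->
  (exists c, is_cycle G c /\ size c = p) ->
  exists c, [/\ is_cycle G c, size c = p & has_chord G c].
Proof.
move=> r3 om p5 pn big [c [hc sc]].
have [/existsP[c' /andP[h1 h2]]|/existsPn no] :=
  boolP [exists c' : p.-tuple T, is_cycle G c' && ~~ chordless c'].
  by exists c'; rewrite size_tuple; split=> //; apply: chordlessPn.
have all c' : is_cycle G c' -> size c' = p -> chordless c'.
  by move=> h /eqP e; have := no (Tuple e); rewrite h /= negbK.
have /and3P[_ _ uc] := hc.
have cA : #|[set z in c]| = p by rewrite cardsE (card_uniqP uc).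
have := @edges_few_outside [set z in c] r p (p %/ 2) om cA.
have few : {in ~: [set z in c], forall w, #|nbh G [set z in c] w| <= p %/ 2}.
  by move=> w; rewrite !inE => wc; apply: chordless_outside.
move=> /(_ few); have := chordless_edges uc (all c hc sc); rewrite sc.
have [m em] : exists m, #|T| = m + p by exists (#|T| - p); rewrite subnK.
have := @turan_gap_mono 3 r m p.-1 ltac:(by rewrite r3).
have [up _] := turan_edges_quadratic 2 m.
have [_ lo] := turan_edges_quadratic 2 (m + p.-1).
have half : 2 * (p %/ 2) <= p by rewrite mulnC leq_trunc_div.
have half2 : 2 * (p %/ 2) * m <= p * m by rewrite leq_mul2r half orbT.
have em1 : #|T|.-1 = m + p.-1 by lia.
move: big; rewrite em1 em addnK => big h1 h2 h3.
exfalso; move: big h1 h2 h3 up lo half2; clear - p5; case: p p5 => // p p5 /=.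
move: (_ %/ 2) (turan_cl 2 r m) (turan_cl 2 3 m) (turan_cl 2 r _) (turan_cl 2 3 _).
move: (cl G setT 2) (cl G _ 2) => e1 e2 h E1 E2 E3 E4 big h1 h2 h3 up lo half2.
have m1 : 5 * m <= p * m by rewrite leq_mul2r -ltnS p5 orbT.
have m2 : 5 * p <= p * p by rewrite leq_mul2r -ltnS p5 orbT.
by lia.
Qed.

Definition diamond a b d d' : Prop :=
  uniq [:: a; b; d; d'] /\ [/\ G a b, G a d, G b d, G a d' & G b d'].

Lemma exists_triangle r : 2 < r -> turan_cl 2 r #|T|.-1 + 1 < cl G setT 2 ->
  exists a b d, [/\ G a b, G a d & G b d].
Proof.
move=> r3 big; have [/existsP[a /existsP[b /existsP[d /and3P[h1 h2 h3]]]]|no] :=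
  boolP [exists a, exists b, exists d, [&& G a b, G a d & G b d]].
  by exists a, b, d.
have om2 : omega_le G setT 2.
  move=> S _ /is_cliqueP qS; rewrite leqNgt; apply: contra no => S3.
  have [a [b [d [[aS bS dS] [nab nbd nda]]]]] := card_gt2P S3.
  apply/existsP; exists a; apply/existsP; exists b; apply/existsP; exists d.
  by rewrite (qS a b) // (qS b d) // (qS a d) // eq_sym.
have := zykov 2 om2; rewrite cardsT => h.
have [up _] := turan_edges_quadratic 1 #|T|.
have [_ lo] := turan_edges_quadratic 2 #|T|.-1.
have := @turan_gap_mono 3 r 0 #|T|.-1 ltac:(by rewrite r3).
rewrite !add0n !turan_cl0 !addn0 => gap; exfalso.
move: big h up lo gap; case: #|T| => [|n] /=; first by rewrite !turan_cl0; lia.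
move: (cl G setT 2) (turan_cl 2 2 _) (turan_cl 2 r _) (turan_cl 2 3 _) => e E1 E2 E3.
move=> h1 h2 h3 h4 h5; case: (nat_AGM2 n 3) => + _; rewrite -mulnn.
by clear - h1 h2 h3 h4 h5; lia.
Qed.

(** Otherwise every vertex outside a triangle has at most one neighbour on it,
    and Turan's theorem outside the triangle bounds the number of edges. *)
Lemma exists_diamond r : 2 < r -> omega_le G setT r -> 4 < #|T| ->
  turan_cl 2 r #|T|.-1 + 1 < cl G setT 2 -> exists a b d d', diamond a b d d'.
Proof.
move=> r3 om n5 big; have [a [b [d [gab gad gbd]]]] := exists_triangle r3 big.
have ne x y : G x y -> x != y by move=> g; apply: contraTneq g => ->; rewrite adj_irr.
have [nab nad nbd] : [/\ a != b, a != d & b != d] by split; apply: ne.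
pose A := [set a; b; d].
have cA : #|A| = 3 by rewrite /A setUC cardsU1 cards2 !inE negb_or nab eq_sym nad eq_sym nbd.
have cl3 : cl G A 2 <= 3.
  rewrite -(leq_pmul2l (isT : 0 < 2)) -handshake -[2 * 3]/(3 * 2) -cA -sum_nat_const.
  by apply: leq_sum => v vA; have := nbh_card G vA; rewrite cA.
have [/existsP[w /andP[wA wN]]|/existsPn few] := boolP [exists w, (w \notin A) && (1 < #|nbh G A w|)].
  have [x [y [xN yN nxy]]] := card_gt1P wN.
  move: wA xN yN; rewrite !inE !negb_or => /andP[/andP[wa wb] wd] /andP[xA gwx] /andP[yA gwy].
  have mk u1 u2 u3 : G u1 u2 -> G u1 u3 -> G u2 u3 -> w != u1 -> w != u2 -> w != u3 ->
     G w u1 -> G w u2 -> exists a b d d', diamond a b d d'.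
    move=> g12 g13 g23 w1 w2 w3 gw1 gw2; exists u1, u2, u3, w; split.
      rewrite /= !inE !negb_or (ne _ _ g12) (ne _ _ g13) (ne _ _ g23) /=.
      by rewrite ![_ == w]eq_sym w1 w2 w3.
    by split=> //; rewrite adj_sym.
  move: nxy; case/orP: xA => [/orP[]|] /eqP ex; case/orP: yA => [/orP[]|] /eqP ey; rewrite ex ey ?eqxx // => _; rewrite ex in gwx; rewrite ey in gwy.
  - by apply: (mk a b d).
  - by apply: (mk a d b); rewrite // adj_sym.
  - by apply: (mk a b d).
  - by apply: (mk b d a); rewrite // adj_sym.
  - by apply: (mk a d b); rewrite // adj_sym.
  - by apply: (mk b d a); rewrite // adj_sym.
exfalso.
have := @edges_few_outside A r 3 1 om cA.
have few' : {in ~: A, forall w, #|nbh G A w| <= 1}.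
  by move=> w wA; have := few w; rewrite -in_setC wA /= -leqNgt.
move=> /(_ few') h.
have [m em] : exists m, #|T| = m + 3 by exists (#|T| - 3); rewrite subnK // ltnW // ltnW.
have := @turan_gap_mono 3 r m 2 ltac:(by rewrite r3).
have em1 : #|T|.-1 = m + 2 by rewrite em addn3 addn2.
move: big h; rewrite em1 em addnK.
have e3 : turan_cl 2 3 (m + 2) = turan_cl 2 3 m + back_deg 3 m + back_deg 3 m.+1.
  by rewrite addn2 !turan_edgesS.
have b3 : m + 2 <= back_deg 3 m + back_deg 3 m.+1 by rewrite /back_deg; move: n5; rewrite em; clear; lia.
move: e3 b3 cl3; clear.
move: (cl G setT 2) (cl G A 2) (turan_cl 2 r m) (turan_cl 2 3 m) (turan_cl 2 r _) (turan_cl 2 3 _).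
by clear; lia.
Qed.

Lemma nbh_count (s : seq T) w : uniq s -> #|nbh G [set z in s] w| = count (G w) s.
Proof.
move=> us; rewrite -size_filter -(card_uniqP (filter_uniq _ us)).
by apply: eq_card => z; rewrite !inE mem_filter andbC.
Qed.

Lemma not_cycle_edge c x y : next c x != y -> next c y != x -> ~~ cycle_edge c x y.
Proof. by move=> /negPf xy /negPf yx; rewrite /cycle_edge /= xy yx !andbF. Qed.

Lemma diamond_cycle a b d d' : diamond a b d d' ->
  exists c, [/\ is_cycle G c, size c = 4 & has_chord G c].
Proof.
case=> u [gab gad gbd gad' gbd']; have u' : uniq [:: a; d; b; d'].
  by move: u; rewrite /= !inE !negb_or (eq_sym d b) => /and4P[/and3P[-> -> ->] /andP[-> ->] ->].
exists [:: a; d; b; d']; split=> //.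
  by apply/and3P; split=> //; rewrite /= gad (adj_sym G d) gbd gbd' (adj_sym G d') gad'.
move: u; rewrite /= !inE !negb_or => /and4P[/and3P[ab ad ad'] /andP[bd bd'] dd' _].
exists a, b; split; rewrite ?inE ?eqxx ?orbT //; apply: not_cycle_edge.
  by rewrite (@next_split _ [::]) // eq_sym.
by rewrite (@next_split _ [:: a; d]) // eq_sym.
Qed.

Lemma chorded_five x1 x2 x3 x4 x5 : uniq [:: x1; x2; x3; x4; x5] ->
  [/\ G x1 x2, G x2 x3, G x3 x4, G x4 x5 & G x5 x1] -> G x1 x3 ->
  exists c, [/\ is_cycle G c, size c = 5 & has_chord G c].
Proof.
move=> u [g1 g2 g3 g4 g5] g; exists [:: x1; x2; x3; x4; x5]; split=> //.
  by rewrite /is_cycle /= g1 g2 g3 g4 g5.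
exists x1, x3; rewrite !inE !eqxx ?orbT; split=> //.
have n1 : next [:: x1; x2; x3; x4; x5] x1 = x2 := @next_split _ [::] _ _ _ u.
have n3 : next [:: x1; x2; x3; x4; x5] x3 = x4 := @next_split _ [:: x1; x2] _ _ _ u.
move: u; rewrite /= !inE !negb_or => /and4P[/and4P[_ _ h14 _] /and3P[h23 _ _] _ _].
by apply: not_cycle_edge; rewrite ?n1 ?n3 // eq_sym.
Qed.

Ltac perm_small := apply/permP => z /=;
  repeat match goal with |- context [nat_of_bool ?b] => move: (nat_of_bool b) end;
  clear; lia.

(** Suppose that no 5-cycle has a chord. A vertex outside a diamond then has at
    most one neighbour on it, or exactly the neighbours [a] and [b] while [d] and
    [d'] are not adjacent. The edge count leaves only the case in which all
    outside vertices are of the second kind. As an edge between two of them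
    would give a chorded 5-cycle, they are independent, which contradicts the
    edge count again. *)
Lemma chorded_five_cycle r : 2 < r -> omega_le G setT r -> 5 < #|T| ->
  turan_cl 2 r #|T|.-1 + 1 < cl G setT 2 ->
  exists c, [/\ is_cycle G c, size c = 5 & has_chord G c].
Proof.
move=> r3 om n6 big.
have [a [b [d [d' dia]]]] := exists_diamond r3 om (ltnW n6) big.
have [u [gab gad gbd gad' gbd']] := dia.
have [/existsP[c' /andP[h1 h2]]|/existsPn no] :=
  boolP [exists c' : 5.-tuple T, is_cycle G c' && ~~ chordless c'].
  by exists c'; rewrite size_tuple; split=> //; apply: chordlessPn.
have {}no c : is_cycle G c -> size c = 5 -> has_chord G c -> False.
  move=> h /eqP e [x [y [xc yc gxy nxy]]]; have := no (Tuple e); rewrite h /= negbK.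
  by move/forallP/(_ x)/forallP/(_ y); rewrite xc yc gxy (negPf nxy).
have five x1 x2 x3 x4 x5 : uniq [:: x1; x2; x3; x4; x5] ->
    [/\ G x1 x2, G x2 x3, G x3 x4, G x4 x5 & G x5 x1] -> G x1 x3 -> False.
  by move=> h1 h2 h3; have [c []] := chorded_five h1 h2 h3; apply: no.
have sym x y : G x y -> G y x by rewrite adj_sym.
pose s := [:: a; b; d; d']; pose A := [set z in s].
have us : uniq s by case: dia.
have cA : #|A| = 4 by rewrite cardsE (card_uniqP us).
have gba := sym _ _ gab; have gda := sym _ _ gad; have gdb := sym _ _ gbd.
have gd'a := sym _ _ gad'; have gd'b := sym _ _ gbd'.
have perm_u t w : w \notin s -> perm_eq t (w :: s) -> uniq t.
  by move=> ws pt; rewrite (perm_uniq pt) cons_uniq ws us.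
have only w : w \notin s -> [&& G w a, G w b, ~~ G d d' & count (G w) s <= 2] || (count (G w) s <= 1).
  move=> ws; have P t := perm_u t w ws.
  have n1 : ~~ (G w a && G w d).
    apply/negP => /andP[wa wd]; apply: (five a d' b d w) => //.
      by apply: P; perm_small.
    by split=> //; apply: sym.
  have n2 : ~~ (G w b && G w d).
    apply/negP => /andP[wa wd]; apply: (five b d' a d w) => //.
      by apply: P; perm_small.
    by split=> //; apply: sym.
  have n3 : ~~ (G w a && G w d').
    apply/negP => /andP[wa wd]; apply: (five a d b d' w) => //.
      by apply: P; perm_small.
    by split=> //; apply: sym.
  have n4 : ~~ (G w b && G w d').
    apply/negP => /andP[wa wd]; apply: (five b d a d' w) => //.
      by apply: P; perm_small.
    by split=> //; apply: sym.
  have n5 : ~~ (G w d && G w d').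
    apply/negP => /andP[wa wd]; apply: (five a b d w d') => //.
      by apply: P; perm_small.
    by split=> //; apply: sym.
  have n6' : ~~ [&& G w a, G w b & G d d'].
    apply/negP => /and3P[wa wb dd]; apply: (five b w a d d') => //.
      by apply: P; perm_small.
    by split=> //; apply: sym.
  move: n1 n2 n3 n4 n5 n6'; rewrite /s /=.
  by case: (G w a); case: (G w b); case: (G w d); case: (G w d'); case: (G d d').
have clA : cl G A 2 <= 5 + G d d'.
  rewrite -(leq_pmul2l (isT : 0 < 2)) -handshake.
  have -> : \sum_(v in A) #|nbh G A v| = \sum_(v <- s) count (G v) s.
    rewrite [RHS]big_uniq //=; apply: eq_big => [v|v _]; first by rewrite inE.
    exact: nbh_count.
  rewrite !big_cons big_nil /= !adj_irr gab gad gad' gba gbd gbd' gda gdb gd'a gd'b.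
  by rewrite (adj_sym G d'); case: (G d d').
have memA w : (w \in ~: A) = (w \notin s) by rewrite in_setC inE.
have cR : #|~: A| = #|T| - 4 by rewrite cardsCs setCK cA.
have split_e : cl G setT 2 = cl G A 2 + \sum_(w in ~: A) count (G w) s + cl G (~: A) 2.
  rewrite -{1}(setUCr A) edges_setU; last by rewrite -setI_eq0 setICr.
  by congr (_ + _ + _); apply: eq_bigr => w _; apply: nbh_count.
have eR : cl G (~: A) 2 <= turan_cl 2 r (#|T| - 4).
  by rewrite -cR; apply: zykov; apply: omega_sub om; apply: subsetT.
have [m em] : exists m, #|T| = m + 4 by exists (#|T| - 4); rewrite subnK // ltnW // ltnW.
have em1 : #|T|.-1 = m + 3 by rewrite em addnS.
have := @turan_gap_mono 3 r m 3 ltac:(by rewrite r3).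
have e3 : turan_cl 2 3 (m + 3) = turan_cl 2 3 m + (2 * m + 3).
  rewrite addn3 !turan_edgesS /back_deg; clear; lia.
have small : 1 <= turan_cl 2 r m.
  apply: (@leq_trans (turan_cl 2 r 2)); last by apply: leq_turan_cl; rewrite -(leq_add2r 4) -em.
  by rewrite !turan_edgesS turan_cl0 /back_deg div0n divn_small // ltnW.
rewrite e3; move: big split_e eR; rewrite em1 em addnK => big split_e eR gap.
have cRm : #|~: A| = m by rewrite cR em addnK.
exfalso; have [dd|ndd] := boolP (G d d').
  have : \sum_(w in ~: A) count (G w) s <= \sum_(w in ~: A) 1.
    by apply: leq_sum => w; rewrite memA => /only; rewrite dd !andbF.
  rewrite dd in clA; rewrite sum_nat_const cRm; move: big split_e eR gap clA n6.
  by rewrite em; clear; lia.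
rewrite (negPf ndd) in clA.
have two w : w \in ~: A -> count (G w) s <= 2.
  by rewrite memA => /only /orP[/and4P[]//|/leqW].
have [/existsP[w /andP[wA w1]]|all2] := boolP [exists w, (w \in ~: A) && (count (G w) s <= 1)].
  have : \sum_(w in ~: A) count (G w) s + 1 <= \sum_(w in ~: A) 2.
    rewrite (bigD1 w wA) [leqRHS](bigD1 w wA) /= addnAC; apply: leq_add; first by rewrite addn1.
    by apply: leq_sum => v /andP[vA _]; apply: two.
  rewrite sum_nat_const cRm; move: big split_e eR gap clA; clear; lia.
have both w : w \in ~: A -> G w a /\ G w b.
  move=> wA; move: all2; rewrite negb_exists => /forallP/(_ w); rewrite wA /= => nw.
  by move: wA; rewrite memA => /only; rewrite (negPf nw) orbF => /and4P[].
have R0 : cl G (~: A) 2 = 0.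
  apply/eqP; rewrite -leqn0 -(leq_pmul2l (isT : 0 < 2)) -handshake muln0 leqn0 sum_nat_eq0.
  apply/forall_inP => w wA; rewrite cards_eq0; apply/eqP/setP => w'; rewrite !inE.
  apply/negP => /andP[w'A gww'].
  have w'A' : w' \in ~: A by rewrite !inE.
  have [wa wb] := both w wA; have [w'a w'b] := both w' w'A'.
  apply: (five b d a w w') => //; last by split=> //; apply: sym.
  have nww : w != w' by apply: contraTneq gww' => ->; rewrite adj_irr.
  have us' : uniq (w :: w' :: [:: a; b; d]).
    rewrite memA in wA; rewrite memA in w'A'.
    rewrite !cons_uniq inE negb_or nww /=; apply/and3P; split.
    - by move: wA; rewrite !inE !negb_or => /and4P[-> -> ->].
    - by move: w'A'; rewrite !inE !negb_or => /and4P[-> -> ->].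
    - by move: us; rewrite /= !inE !negb_or => /and4P[/and3P[-> -> _] /andP[-> _]].
  have pe : perm_eq [:: b; d; a; w; w'] (w :: w' :: [:: a; b; d]).
    by perm_small.
  by rewrite (perm_uniq pe).
have : \sum_(w in ~: A) count (G w) s <= \sum_(w in ~: A) 2 by apply: leq_sum.
rewrite sum_nat_const cRm; move: big split_e R0 gap clA small; clear; lia.
Qed.

(** A Hamiltonian cycle has a chord since there are more than [n] edges. Cycles of
    the other lengths come from diamonds for lengths 4 and 5 and from
    [bondy_cycle] for the longer ones. *)
Theorem chorded_pancyclic_of_edges r : 2 < r -> omega_le G setT r -> hamiltonian G ->
  turan_cl 2 r #|T|.-1 + 1 < cl G setT 2 -> chorded_pancyclic G.
Proof.
move=> r3 om [c0 hc0] big p /andP[p4 pn].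
have [k ek] : exists k, #|T| = k.+1 by exists #|T|.-1; rewrite prednK // (leq_trans _ pn) // ltnW // ltnW // ltnW.
have E3k : turan_cl 2 3 k <= turan_cl 2 r k.
  have := @turan_gap_mono 3 r 0 k ltac:(by rewrite r3).
  by rewrite !turan_cl0 !addn0.
have [_ lo] := turan_edges_quadratic 2 k.
move: pn; rewrite leq_eqVlt => /orP[/eqP pn|pn].
  have /andP[cyc /eqP sc] := hc0; have /and3P[_ _ uc] := cyc.
  exists c0; split=> //; first by rewrite pn.
  apply: chordlessPn; apply/negP => ch; have := chordless_edges uc ch.
  have -> : [set z in c0] = setT by apply/setP => z; rewrite !inE; apply: all_in_uniq.
  move: big p4; rewrite sc pn ek /= => big k3.
  have : 3 * k <= k * k by rewrite leq_mul2r -ltnS k3 orbT.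
  by move: big E3k lo; clear; lia.
have [p6|p5] := ltnP 5 p; last first.
  have [e4|n4] := eqVneq p 4.
    have [a [b [d [d' dia]]]] := exists_diamond r3 om (leq_ltn_trans p4 pn) big.
    by rewrite e4; apply: diamond_cycle dia.
  have e5 : p = 5 by move: p4 p5 n4; clear; case: p => [|[|[|[|[|[|p]]]]]].
  by rewrite e5 in pn *; apply: chorded_five_cycle big.
apply: (long_chorded_cycle r3 om p6 (ltnW pn) big).
apply: (bondy_cycle hc0 p4 pn).
move: big; rewrite ek /= => big; case: (nat_AGM2 k 3) => + _; rewrite -mulnn.
by move: big E3k lo; clear; lia.
Qed.

End Chords.

(** * Structure of the colex Turan graph *)

Lemma isomorphic_nb_cliques (T U : finType) (G : sgraph T) (H : sgraph U) t :
  isomorphic G H -> nb_cliques G t = nb_cliques H t.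
Proof.
case=> f fb hf; rewrite !clique_nb_cliques -(cl_inj (G := G) (H := H) (f := f)) //.
  congr (cl H _ t); apply/setP => y; rewrite inE; case: fb => g fg gf.
  by apply/imsetP; exists (g y); rewrite ?inE ?gf.
exact: bij_inj.
Qed.

Lemma isomorphic_sym (T U : finType) (G : sgraph T) (H : sgraph U) :
  isomorphic G H -> isomorphic H G.
Proof.
case=> f [g fg gf] hf; exists g; first by exists f.
by move=> x y; rewrite -hf !gf.
Qed.

Lemma isomorphic_trans (T U V : finType) (G : sgraph T) (H : sgraph U) (K : sgraph V) :
  isomorphic G H -> isomorphic H K -> isomorphic G K.
Proof.
case=> f fb hf [g gb hg]; exists (g \o f); first exact: bij_comp.
by move=> x y /=; rewrite hg hf.
Qed.

Lemma edges_cliques (T : finType) (G : sgraph T) :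
  edges G = [set S : {set T} | (#|S| == 2) && is_clique G S].
Proof.
apply/setP => S; rewrite inE; apply/imsetP/andP => [[[u v]]|[/cards2P[u [v [nuv ->]]] qS]].
  rewrite inE /= => guv ->; have nuv : u != v by apply: contraTneq guv => ->; rewrite adj_irr.
  rewrite cards2 nuv; split=> //; apply/is_cliqueP => x y.
  by case/set2P=> -> /set2P[] ->; rewrite ?eqxx // adj_sym.
exists (u, v) => //; rewrite inE /=.
by move/is_cliqueP: qS; apply; rewrite ?inE ?eqxx ?orbT.
Qed.

Lemma card_edges (T : finType) (G : sgraph T) : #|edges G| = cl G setT 2.
Proof. by rewrite edges_cliques -clique_nb_cliques. Qed.

(** On increasing pairs colex order is lexicographic order with the larger
    elements compared first. *)
Lemma colex_pair n (a b i j : 'I_n) : a < b -> i < j ->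
  colex_lt [set a; b] [set i; j] = (b < j) || ((b == j) && (a < i)).
Proof.
move=> ab ij; apply/exists_inP/idP => [[x]|].
  rewrite !inE negb_or => /andP[/andP[xa xb] /orP[]/eqP ex] /forall_inP mx; rewrite {x}ex in xa xb mx.
    have bj : b = j.
      apply/eqP; apply: contraT => nbj.
      have := mx j; rewrite !inE eqxx orbT andbT negb_or [j == b]eq_sym nbj andbT.
      case: eqP => [ja|_] /=; last by move=> /(_ isT); lia.
      have := mx b; rewrite !inE eqxx orbT /= negb_or [b == i]eq_sym xb nbj => /(_ isT).
      by rewrite ja in ij; lia.
    rewrite bj ltnn eqxx /=; have := mx a; rewrite !inE eqxx /= andbT negb_or [a == i]eq_sym xa /=.
    have -> : a == j = false by apply/negbTE; rewrite -bj; apply: contraTneq ab => ->; rewrite ltnn.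
    by move=> /(_ isT); rewrite leq_eqVlt => /orP[/eqP/val_inj e|//]; rewrite e eqxx in xa.
  have [bi|nbi] := eqVneq b i; first by rewrite bi ij.
  have := mx b; rewrite !inE eqxx orbT /= negb_or nbi [b == j]eq_sym xb => /(_ isT).
  by rewrite leq_eqVlt => /orP[/eqP/val_inj e|->//]; rewrite e eqxx in xb.
case/orP=> [bj|/andP[/eqP bj ai]].
  exists j.
    rewrite !inE eqxx orbT andbT negb_or; apply/andP; split; apply/eqP => e; subst j; lia.
  apply/forall_inP => y; rewrite !inE => /orP[]/andP[_ /orP[]/eqP ->] //; lia.
subst j; exists i.
  rewrite !inE eqxx andbT negb_or; apply/andP; split; apply/eqP => e; subst i; lia.
apply/forall_inP => y; rewrite !inE !negb_or.
case/orP=> /andP[/andP[h1 h2] /orP[]/eqP e]; subst y; rewrite ?eqxx // in h1 h2 *; lia.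
Qed.

Lemma turanE n r (i j : 'I_n) : turan n r i j = (i %% r != j %% r).
Proof. by []. Qed.

Section Colex.
Variables (m r : nat) (l : int).
Hypothesis r0 : 0 < r.
Let s := `|(l + 1)%R|%N.
Let C := colex_turan m.+1 r l.
Let L := turan m.+1 r.

(** The vertices that precede [i] among the possible neighbours of the last
    vertex. *)
Let rank (i : nat) : nat := #|[set k : 'I_m | (k < i) && (k %% r != m %% r)]|.

Let low : {set {set 'I_m.+1}} := [set A in edges L | ord_max \notin A].

Lemma colexE (i j : 'I_m.+1) : C i j = (i %% r != j %% r) &&
  (#|[set A in edges L | colex_lt A [set i; j]]| < #|edges (turan m r)| + s).
Proof. by []. Qed.

Lemma edge_pair (A : {set 'I_m.+1}) : A \in edges L ->
  exists a b : 'I_m.+1, [/\ a < b, A = [set a; b] & a %% r != b %% r].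
Proof.
case/imsetP=> -[a b]; rewrite inE /= => nab ->.
case: (ltngtP a b) => [ab|ba|/val_inj e]; last by rewrite e eqxx in nab.
  by exists a, b.
by exists b, a; rewrite setUC eq_sym.
Qed.

Lemma pair_edge (a b : 'I_m.+1) : a %% r != b %% r -> [set a; b] \in edges L.
Proof. by move=> h; apply/imsetP; exists (a, b); rewrite ?inE. Qed.

Lemma card_low : #|low| = #|edges (turan m r)|.
Proof.
rewrite card_edges -(cl_inj (G := turan m r) (H := L) (f := lift ord_max)) //; first last.
- by move=> i j _ _; rewrite !turanE !lift_max.
- exact: lift_inj.
apply: eq_card => A; rewrite !inE edges_cliques inE andbC; congr (_ && _).
apply/idP/subsetP => [Am x xA|sub].
  have [y ->|e] := unliftP ord_max x; first by apply: imset_f.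
  by rewrite -e xA in Am.
by apply/negP => /sub /imsetP[i _ /eqP]; rewrite (negPf (neq_lift _ _)).
Qed.

Lemma ltn_max (b : 'I_m.+1) : (b < m) = (b != ord_max).
Proof. by rewrite -val_eqE /= ltn_neqAle -ltnS ltn_ord andbT. Qed.

(** A pair avoiding the last vertex precedes every pair containing it, so fewer
    pairs precede it than the smaller Turan graph has edges. *)
Lemma colex_lower (i j : 'I_m) : C (lift ord_max i) (lift ord_max j) = turan m r i j.
Proof.
wlog ij : i j / i < j.
  move=> W; case: (ltngtP i j) => [|ji|/val_inj ->]; first exact: W.
    by rewrite (adj_sym C) W // (adj_sym (turan m r)).
  by rewrite !adj_irr.
rewrite colexE turanE !lift_max; case: eqP => //= /eqP nij.
rewrite -card_low ltn_addr //; apply: proper_card; apply/properP.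
have hij : [set lift ord_max i; lift ord_max j] \in low.
  rewrite inE pair_edge ?lift_max // !inE negb_or.
  by rewrite !neq_lift.
have lij : (lift ord_max i : 'I_m.+1) < lift ord_max j by rewrite !lift_max.
split; last first.
  by exists [set lift ord_max i; lift ord_max j]; rewrite // inE colex_pair // !ltnn andbF andbF.
apply/subsetP => A; rewrite !inE => /andP[AE]; rewrite AE /=.
have [a [b [ab -> _]]] := edge_pair AE; rewrite colex_pair // !inE negb_or lift_max => h.
have bm : b < m by case/orP: h => [/ltn_trans -> //|/andP[/eqP -> _]]; rewrite lift_max.
by apply/andP; split; rewrite eq_sym -ltn_max // (ltn_trans ab).
Qed.

Lemma colex_last (i : 'I_m) :
  C ord_max (lift ord_max i) = (i %% r != m %% r) && (rank i < s).
Proof.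
rewrite (adj_sym C) colexE lift_max; case: eqP => //= /eqP nim.
set B := [set A in edges L | _].
pose R := [set [set lift ord_max k; ord_max] | k in [set k : 'I_m | (k < i) && (k %% r != m %% r)]].
have lm (k : 'I_m) : (lift ord_max k : 'I_m.+1) < (@ord_max m) by rewrite lift_max /=.
have -> : B = low :|: R.
  apply/setP => A; rewrite inE [in RHS]inE; apply/andP/orP => [[AE]|[|/imsetP[k]]].
  - have [a [b [ab -> nab]]] := edge_pair AE; rewrite colex_pair // => h.
    have [ebm|nb] := eqVneq b ord_max; last first.
      left; rewrite inE pair_edge //= !inE negb_or ![ord_max == _]eq_sym -!ltn_max.
      by rewrite -ltn_max in nb; rewrite nb (ltn_trans ab).
    rewrite ebm ltnn eqxx lift_max in ab nab h; right; have ai : a < i by [].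
    have am : a < m by [].
    apply/imsetP; exists (Ordinal am).
      by rewrite inE /= ai.
    by rewrite ebm (_ : lift ord_max (Ordinal am) = a) //; apply: ord_inj; apply: (lift_max (Ordinal am)).
  - rewrite inE => /andP[AE Am]; split=> //.
    have [a [b [ab eA _]]] := edge_pair AE; rewrite eA colex_pair //; apply/orP; left.
    by rewrite -[X in _ < X]/m ltn_max; apply: contraNneq Am => <-; rewrite eA !inE eqxx orbT.
  - rewrite inE => /andP[ki nkm] ->; split; first by rewrite pair_edge ?lift_max.
    by rewrite colex_pair // ltnn eqxx !lift_max.
have cR : #|R| = rank i.
  apply: card_in_imset => k1 k2 _ _ /setP/(_ (lift ord_max k1)); rewrite !inE eqxx /=.
  rewrite ![lift _ _ == ord_max]eq_sym !(negPf (neq_lift _ _)) orbF => /esym/eqP.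
  exact: lift_inj.
have dis : low :&: R = set0.
  apply/setP => A; rewrite !inE; apply/negP => /andP[/andP[_ Am] /imsetP[k _ eA]].
  by rewrite eA !inE eqxx orbT in Am.
by rewrite cardsU dis cards0 subn0 cR card_low ltn_add2l.
Qed.

Definition initial_segment (b : nat) : {set 'I_m} :=
  [set i : 'I_m | (i < b) && (i %% r != m %% r)].

Lemma colex_add_vertex b :
  (forall i : 'I_m, i %% r != m %% r -> (rank i < s) = (i < b)) ->
  isomorphic C (add_vertex (turan m r) (initial_segment b)).
Proof.
move=> hb; exists (unlift ord_max).
  exists (fun o => if o is Some i then lift ord_max i else ord_max).
    by move=> x; case: unliftP => [j ->|->] //.
  by case=> [i|]; rewrite ?liftK ?unlift_none.
have adjE (i : 'I_m) : (i \in initial_segment b) = C ord_max (lift ord_max i).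
  by rewrite colex_last inE andbC; case: eqP => //= /eqP h; rewrite hb.
move=> x y; case: (unliftP ord_max x) => [i ->|->]; case: (unliftP ord_max y) => [j ->|->].
- by rewrite -[LHS]/(turan m r i j) -colex_lower.
- by rewrite -[LHS]/(i \in initial_segment b) adjE (adj_sym C).
- by rewrite -[LHS]/(j \in initial_segment b) adjE.
- by rewrite !adj_irr.
Qed.

Lemma rank_last : rank m = back_deg r m.
Proof.
have := cardsID [set k : 'I_m | k %% r == m %% r] setT.
rewrite cardsT card_ord setTI count_residue ?ltn_mod // => e.
have -> : rank m = #|setT :\: [set k : 'I_m | k %% r == m %% r]|.
  by apply: eq_card => k; rewrite !inE ltn_ord andbT.
have q : (m + r.-1 - m %% r) %/ r = m %/ r.
  have {1}-> : m + r.-1 - m %% r = m %/ r * r + r.-1.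
    by have := divn_eq m r; have := ltn_pmod m r0; lia.
  by rewrite divnMDl // (@divn_small r.-1) ?addn0 //; move: r0; clear; lia.
by rewrite /back_deg -q; move: e; clear; lia.
Qed.

Lemma rankS b : b < m -> rank b.+1 = rank b + (b %% r != m %% r).
Proof.
move=> bm; rewrite /rank (cardsD1 (Ordinal bm)) inE ltnSn /= addnC; congr (_ + _).
by apply: eq_card => k; rewrite !inE -val_eqE /= ltnS ltn_neqAle; case: eqP.
Qed.

Lemma leq_rank a b : a <= b -> rank a <= rank b.
Proof.
move=> ab; apply/subset_leq_card/subsetP => k; rewrite !inE => /andP[ka ->].
by rewrite (leq_trans ka ab).
Qed.

(** The [s] smallest possible neighbours of the last vertex form an initial
    segment, which is a balanced complete multipartite graph with [r - 1]
    classes. *)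
Lemma colex_structure : s <= back_deg r m -> exists b, [/\ b <= m,
  #|initial_segment b| = s & isomorphic C (add_vertex (turan m r) (initial_segment b))].
Proof.
rewrite -rank_last => sm.
have ex : exists b, s <= rank b by exists m.
case: (ex_minnP ex) => b sb bmin.
have bm : b <= m by apply: bmin.
have rb : rank b = s.
  apply/eqP; rewrite eqn_leq sb andbT; case: b sb bmin bm => [|b] sb bmin bm.
    by apply: leq_trans (leq0n s); rewrite leqn0 cards_eq0; apply/eqP/setP => k; rewrite !inE.
  have rbs : rank b < s by rewrite ltnNge; apply/negP => /bmin; rewrite ltnn.
  by rewrite rankS // (leq_trans _ rbs) // -addn1 leq_add2l leq_b1.
exists b; split=> //.
apply: colex_add_vertex => i ni; apply/idP/idP => [h|ib].
  by rewrite ltnNge; apply: contraL h => bi; rewrite -leqNgt -rb leq_rank.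
by rewrite -rb; apply: leq_trans (leq_rank ib); rewrite rankS // ni addn1.
Qed.

End Colex.

(** * Clique counts of the colex Turan graph *)

Lemma card_residue_segment m r b c : b <= m ->
  #|[set i : 'I_m | (i < b) && (i %% r == c)]| = #|[set i : 'I_b | i %% r == c]|.
Proof.
move=> bm; have wi : injective (widen_ord bm) by move=> i j [e]; apply: val_inj.
rewrite -(card_imset _ wi).
apply: eq_card => i; rewrite !inE; apply/andP/imsetP => [[ib ic]|[j]].
  by exists (Ordinal ib); [rewrite inE | apply: val_inj].
by rewrite inE => jc ->; rewrite /= ltn_ord.
Qed.

Lemma initial_segment_cl m r b t : 0 < r -> b <= m ->
  cl (turan m r) (initial_segment m r b) t = turan_cl t r.-1 #|initial_segment m r b|.
Proof.
move=> r0 bm; set A := initial_segment m r b.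
have mr : m %% r \in iota 0 r by rewrite mem_iota add0n ltn_mod.
rewrite (@balanced_cl _ _ (fun i : 'I_m => i %% r) _ (rem (m %% r) (iota 0 r))).
  by rewrite size_rem // size_iota.
have hC c : c \in rem (m %% r) (iota 0 r) -> c < r /\ c != m %% r.
  by rewrite mem_rem_uniq ?iota_uniq // !inE mem_iota add0n => /and3P[-> _ ->].
have hA c : c \in rem (m %% r) (iota 0 r) ->
    #|color_class (fun i : 'I_m => i %% r) A c| = #|[set i : 'I_b | i %% r == c]|.
  move=> /hC[_ nc]; rewrite -(card_residue_segment _ _ bm); apply: eq_card => i.
  by rewrite !inE; case: (i %% r =P c) => [->|]; rewrite ?andbF // nc !andbT.
split=> //.
- by rewrite rem_uniq ?iota_uniq.
- by move=> i; rewrite mem_rem_uniq ?iota_uniq // !inE mem_iota add0n ltn_mod r0 => /andP[_ ->].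
- by move=> c d hc hd; rewrite !hA // leq_residue //; [case/hC: hc | case/hC: hd].
Qed.

(** Cliques avoiding the last vertex are cliques of the Turan graph; the others
    are cliques of the initial segment spanned by its neighbours. *)
Lemma colex_nb_cliques m r l t : 0 < r -> `|(l + 1)%R| <= back_deg r m ->
  nb_cliques (colex_turan m.+1 r l) t.+1 =
    turan_cl t.+1 r m + turan_cl t r.-1 `|(l + 1)%R|.
Proof.
move=> r0 sm; have [b [bm <- iso]] := colex_structure r0 sm.
rewrite (isomorphic_nb_cliques _ iso) clique_nb_cliques (clS _ _ (in_setT None)).
have -> : [set: option 'I_m] :\ None = Some @: [set: 'I_m].
  apply/setP => -[i|]; rewrite !inE /=; first by rewrite imset_f ?inE.
  by apply/esym/negbTE/imsetP => -[].
have -> : nbh (add_vertex (turan m r) (initial_segment m r b)) setT None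
    = Some @: initial_segment m r b.
  apply/setP => -[i|]; rewrite !inE /= ?andbT.
    by rewrite mem_imset ?inE //; apply: Some_inj.
  by apply/esym/negbTE/imsetP => -[].
rewrite !(cl_inj (G := turan m r) (f := Some)) //; try exact: Some_inj.
rewrite -clique_nb_cliques turan_nb_cliques ?initial_segment_cl //.
by move=> e; rewrite e in r0.
Qed.

(** * The extremal graphs lack the properties *)

(** Skipping one residue class makes steps of length one or two, both less than
    [r]. *)
Lemma sorted_skip_residue r c x a k : 2 < r -> x %% r != c ->
  (x.+1 == a) || (x.+2 == a) && (x.+1 %% r == c) ->
  path (fun i j => i %% r != j %% r) x [seq i <- iota a k | i %% r != c].
Proof.
move=> r2; elim: k x a => //= k IH x a nx hx; have hS i : i.+1 %% r != i %% r.
  apply/eqP => e; have : i + 1 == i + 0 %[mod r] by rewrite addn0 addn1 e.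
  by rewrite eqn_modDl !modn_small //; lia.
have hSS i : i.+2 %% r != i %% r.
  apply/eqP => e; have : i + 2 == i + 0 %[mod r] by rewrite addn0 addn2 e.
  by rewrite eqn_modDl !modn_small //; lia.
case: ifPn => [na|]; last rewrite negbK => /eqP ac.
  rewrite /= IH ?eqxx // andbT eq_sym.
  by case/orP: hx => [/eqP <-|/andP[/eqP <- _]].
apply: IH => //; case/orP: hx => [/eqP xa|/andP[/eqP xa /eqP xc]].
  by rewrite -xa eqxx xa ac eqxx orbT.
by have := hS x.+1; rewrite xa ac xc eqxx.
Qed.

Lemma sorted_initial_segment m r b : 2 < r -> b <= m ->
  sorted (turan m r) (enum (initial_segment m r b)).
Proof.
move=> r2 bm; pose e i j := i %% r != j %% r.
rewrite -[sorted _ _]/(sorted (relpre val e) _) -sorted_map.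
have -> : map val (enum (initial_segment m r b)) = [seq i <- iota 0 b | i %% r != m %% r].
  have -> : enum (initial_segment m r b)
      = filter (preim val (fun k => (k < b) && (k %% r != m %% r))) (enum 'I_m).
    by rewrite enumT {1}/enum_mem; apply: eq_filter => x; rewrite /= inE.
  rewrite -filter_map val_enum_ord -(subnKC bm) iotaD filter_cat add0n.
  rewrite [X in _ ++ X](eq_in_filter (a2 := pred0)) ?filter_pred0 ?cats0; last first.
    by move=> i; rewrite mem_iota => /andP[/leq_gtF ->].
  by apply: eq_in_filter => i; rewrite mem_iota add0n subnKC // => /andP[_ ->].
have [a [k ->]] : exists a k, iota 0 b = iota a k by exists 0, b.
elim: k a => //= k IH a; case: ifP => //= na.
by apply: sorted_skip_residue; rewrite ?eqxx ?na.
Qed.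

(** Consecutive vertices of the initial segment lie in different classes, so the
    neighbours of the extra vertex [w], in this order, form a path [L]. *)
Lemma colex_pendant (T : finType) (G : sgraph T) m r l : 2 < r ->
  `|(l + 1)%R| <= back_deg r m -> isomorphic G (colex_turan m.+1 r l) ->
  exists w (L : seq T), [/\ uniq (w :: L), size L = `|(l + 1)%R|,
    forall y, G w y = (y \in L) & sorted G L].
Proof.
move=> r2 sm; have r0 : 0 < r by lia.
have [b [bm cN iso]] := colex_structure r0 sm.
move=> /isomorphic_trans/(_ iso)/isomorphic_sym[f fb hf].
have fi := bij_inj fb; have fsi : injective (f \o Some) by move=> i j /fi [].
exists (f None), (map (f \o Some) (enum (initial_segment m r b))); split.
- rewrite /= map_inj_uniq // enum_uniq andbT; apply/mapP => -[x _ /= /fi //].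
- by rewrite size_map -cardE.
- move=> y; case: fb => g fg gf; rewrite -(gf y) hf; case: (g y) => [i|] /=.
    by rewrite -[f (Some i)]/((f \o Some) i) mem_map // mem_enum.
  by apply/esym/mapP => -[x _ /= /fi].
- rewrite sorted_map -(eq_sorted (e := turan m r)) ?sorted_initial_segment // => x y.
  by rewrite /= hf.
Qed.

Section NonProperties.
Variables (T : finType) (G : sgraph T).
Implicit Types (w x y z : T) (c p q L : seq T).

Lemma ham_path_mem x p y : ham_path G x p -> y \in x :: p.
Proof. by case/andP=> /andP[_ u] /eqP s; apply: all_in_uniq. Qed.

Lemma isolated_not_traceable w : 1 < #|T| -> (forall y, ~~ G w y) -> ~ traceable G.
Proof.
move=> n1 iso [x [p hp]]; have := ham_path_mem w hp.
case/andP: hp => /andP[pp up] /eqP sp.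
rewrite inE => /orP[/eqP e|wp]; last first.
  case/splitPr: p / wp pp up sp => p1 p2 + _ _; rewrite cat_path /= => /and3P[_ h _].
  by have := iso (last x p1); rewrite adj_sym h.
case: p pp up sp => [|y p] /= pp up sp; first by rewrite -sp in n1.
by case/andP: pp => h _; have := iso y; rewrite e h.
Qed.

Lemma ham_cycle_at w c : ham_cycle G c -> exists s,
  [/\ path G w (rcons s w), uniq (w :: s), size (w :: s) = #|T|, 2 < #|T| &
      next c =1 next (w :: s)].
Proof.
case/andP=> /and3P[s2 cc uc] /eqP sc.
have wc : w \in c by apply: all_in_uniq.
have [i s e] := rot_to wc; exists s; split.
- by move: cc; rewrite -(rot_cycle i) e.
- by rewrite -e rot_uniq.
- by rewrite -e size_rot.
- by rewrite -sc.
- by move=> x; rewrite -e next_rot.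
Qed.

Lemma pendant_not_hamiltonian w u : (forall y, G w y -> y = u) -> ~ hamiltonian G.
Proof.
move=> hw [c /(ham_cycle_at w)[s [ps us ss n2 _]]]; rewrite -ss in n2.
case: s ps us {ss} n2 => [|a s] //=; case/lastP: s => [|s b] //=.
rewrite rcons_path last_rcons (adj_sym G b) => /and3P[wa _ /hw eb].
by rewrite (hw _ wa) eb mem_rcons mem_head /= andbF.
Qed.

Lemma chorded_pancyclic_hamiltonian : 3 < #|T| -> chorded_pancyclic G -> hamiltonian G.
Proof.
move=> n3 /(_ #|T|); rewrite n3 leqnn => /(_ isT)[c [hc sc _]].
by exists c; rewrite /ham_cycle hc sc eqxx.
Qed.

(** A Hamiltonian path from [u] to [v] would pass through [w] directly after [u]
    and directly before [v]. *)
Lemma two_neighbours_not_connected w u v : 3 < #|T| -> uniq [:: w; u; v] ->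
  (forall y, G w y -> y \in [:: u; v]) -> ~ ham_connected G.
Proof.
move=> n3 /and3P[]; rewrite !inE negb_or => /andP[wu wv] uv _ hw /(_ u v uv)[p hp lp].
have := ham_path_mem w hp; rewrite inE (negPf wu) /= => wp.
case/andP: hp => /andP[pp up] /eqP sp.
case/splitPr: p / wp pp up sp lp => p1 p2 pp up sp lp.
case: p2 => [|y p2] in pp up sp lp *.
  by move: lp; rewrite last_cat /= => e; rewrite e eqxx in wv.
move: pp; rewrite cat_path /= (adj_sym G _ w) => /and4P[_ /hw hz /hw hy _].
move: lp; rewrite last_cat /= => lp.
move: up; rewrite /= mem_cat cat_uniq !inE /= !negb_or.
case/andP=> /and4P[up1 _ uy up2] /and3P[u1 /and3P[_ y1 hp2] /and3P[_ yp2 _]].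
have ey : y = v by move: hy; rewrite !inE [y == u]eq_sym (negPf uy) => /eqP.
subst y.
have p2n : p2 = [::].
  case/lastP: p2 lp yp2 {sp hp2 up2} => // p2 z; rewrite last_rcons => ->.
  by rewrite mem_rcons mem_head.
have p1n : p1 = [::].
  case/lastP: p1 hz up1 y1 {sp u1 hp2} => // p1 z; rewrite last_rcons !inE.
  by case/orP=> /eqP ->; rewrite !mem_rcons !inE eqxx.
by move: n3; rewrite -sp p1n p2n.
Qed.

Section Orientation.
Variable f : T -> T.
Hypothesis fi : injective f.

(** A path all of whose edges join some [x] to [f x] is followed by [f] in one
    of the two directions: an injection cannot merge them in the middle. *)
Lemma oriented_path x q : uniq (x :: q) ->
  path [rel a b | (f a == b) || (f b == a)] x q ->
  fpath f x q \/ fpath f (last x q) (rev (belast x q)).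
Proof.
elim: q x => [|y q IH] x; first by left.
rewrite [uniq _]/= inE negb_or => /andP[/andP[xy xq] uq] /andP[/= hxy pq].
have [fq|bq] := IH y uq pq.
  case/orP: hxy => [h|h]; first by left; rewrite h.
  case: q fq xq {IH uq pq} => [|z q]; first by right; rewrite /= h.
  by move=> /andP[/= /eqP <- _]; rewrite (eqP h) mem_head.
case/orP: hxy => [h|h].
  case: q bq xq {IH uq pq} => [|z q]; first by left; rewrite /= h.
  move=> /=; rewrite rev_cons rcons_path last_rev_belast => /andP[_ /eqP e].
  by rewrite -(eqP h) in e; rewrite (fi e) mem_head.
by right; rewrite /= rev_cons rcons_path bq last_rev_belast /= h.
Qed.

Lemma fpath_preimage x q y : fpath f x q -> y \in q -> exists2 z, z \in x :: q & f z = y.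
Proof.
elim: q x => //= a q IH x /andP[/eqP fx /IH h]; rewrite inE => /orP[/eqP ->|/h[z zq <-]].
  by exists x; rewrite ?mem_head.
by exists z; rewrite // inE zq orbT.
Qed.

Lemma fpath_image x q y : fpath f x q -> y \in x :: q -> y = last x q \/ f y \in q.
Proof.
elim: q x => [|a q IH] x /=; first by rewrite inE => _ /eqP; left.
case/andP=> /eqP fx /IH h; rewrite inE => /orP[/eqP ->|/h[->|h']]; [|by left|].
  by right; rewrite fx mem_head.
by right; rewrite inE h' orbT.
Qed.

Lemma fpath_closes w x q b : w \notin x :: q -> fpath f x q -> f w \in x :: q ->
  b \in x :: q -> f b = w -> fcycle f (w :: x :: q).
Proof.
move=> wq pq hw hb fb; rewrite /= rcons_path pq /=; apply/andP; split.
  move: hw; rewrite inE => /orP[/eqP ->|/(fpath_preimage pq)[z zq /fi e]] //.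
  by rewrite e (negPf wq) in zq.
case: (fpath_image pq hb) => [<-|]; first by rewrite fb.
by rewrite fb => h; rewrite inE h orbT in wq.
Qed.

End Orientation.

(** A Hamiltonian cycle containing the path [L] reaches [w] from the ends of
    [L], so that [w :: L] is already the whole cycle. *)
Lemma neighbour_path_not_hamiltonian w x q : uniq (w :: x :: q) ->
  path G x q -> (forall y, G w y -> y \in x :: q) -> size (w :: x :: q) < #|T| ->
  ~ path_hamiltonian G (size q).
Proof.
move=> uL pL hw sL /(_ x q); rewrite /is_path pL => /(_ _ (leqnn _)); case.
  by case/andP: uL.
move=> c [hc _ pc]; have [s [ps us ss n2 hn]] := ham_cycle_at w hc.
have uc : uniq c by case/andP: hc => /and3P[].
have fi : injective (next c) by apply: next_inj.
have fs : fcycle (next c) (w :: s).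
  by rewrite (eq_fcycle hn) cycle_next.
have {}pc : path [rel a b | (next c a == b) || (next c b == a)] x q.
  by apply: sub_path pc => a b /and3P[].
have fw : next c w \in x :: q.
  apply: hw; rewrite hn; apply: (next_cycle (e := G)); rewrite ?mem_head //.
have [b hb fb] : exists2 b, b \in x :: q & next c b = w.
  exists (last w s); last first.
    by move: fs; rewrite /= rcons_path => /andP[_ /eqP].
  by apply: hw; move: ps; rewrite rcons_path adj_sym => /andP[].
have close L : L =i w :: x :: q -> size L = size (w :: x :: q) -> uniq L ->
    fcycle (next c) L -> False.
  move=> hL cL uL' cyc; have wL : w \in L by rewrite hL mem_head.
  have := fconnect_cycle cyc wL => h1.
  have := fconnect_cycle fs (mem_head w s) => h2.
  have : perm_eq L (w :: s) by apply: uniq_perm => // z; rewrite -h1 -h2.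
  by move/perm_size; rewrite ss cL => e; rewrite e ltnn in sL.
have wq : w \notin x :: q by case/andP: uL.
have uq : uniq (x :: q) by case/andP: uL.
have [pq|pq] := oriented_path fi uq pc.
  by apply: (close (w :: x :: q)) => //; apply: (fpath_closes fi wq pq fw hb fb).
have er : last x q :: rev (belast x q) = rev (x :: q) by rewrite rev_consE.
have mr : last x q :: rev (belast x q) =i x :: q by move=> z; rewrite er mem_rev.
apply: (close (w :: last x q :: rev (belast x q))).
- by move=> z; rewrite [in LHS]inE [in RHS]inE mr.
- by rewrite er /= size_rev.
- by rewrite cons_uniq mr wq er rev_uniq.
- by apply: (fpath_closes fi _ pq _ _ fb); rewrite mr.
Qed.

End NonProperties.

Section DeletedNonProperties.
Variables (T : finType) (G : sgraph T).
Implicit Types (w x y z : T) (q L : seq T).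

(** Deleting all neighbours of [w] but one leaves [w] with degree one. *)
Lemma neighbour_path_not_k_hamiltonian w x q : uniq (w :: x :: q) ->
  (forall y, G w y -> y \in x :: q) -> ~ k_hamiltonian G (size q).
Proof.
move=> /and3P[wq xq uq] hw /(_ [set z in q]); rewrite cardsE (card_uniqP uq) => /(_ (leqnn _)).
have wS : w \notin [set z in q] by rewrite inE; apply: contra wq; rewrite inE orbC => ->.
have xS : x \notin [set z in q] by rewrite inE.
apply: (@pendant_not_hamiltonian _ _ (Sub w wS) (Sub x xS)) => y /hw.
rewrite inE => /orP[/eqP e|yq]; first exact: val_inj.
by have := valP y; rewrite inE yq.
Qed.

(** Deleting all neighbours of [w] but two reduces to
    [two_neighbours_not_connected]. *)
Lemma neighbours_not_k_ham_connected w x y q : uniq (w :: x :: y :: q) ->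
  (forall z, G w z -> z \in x :: y :: q) -> size (w :: x :: y :: q) < #|T| ->
  ~ k_ham_connected G (size q).+1.
Proof.
move=> uL hw sL /(_ [set z in q]).
have uq : uniq q by case/and4P: uL.
rewrite cardsE (card_uniqP uq) => /(_ (leqnn _)).
have nS z : z \in [:: w; x; y] -> z \notin [set z in q].
  move=> hz; rewrite inE; apply/negP => zq; move: uL.
  rewrite -[_ :: _]/([:: w; x; y] ++ q) cat_uniq => /and3P[_ /hasPn/(_ _ zq)/negP + _].
  by apply.
pose w' : {z | z \notin [set z in q]} := Sub w (nS w (mem_head _ _)).
have hx : x \in [:: w; x; y] by rewrite !inE eqxx orbT.
have hy : y \in [:: w; x; y] by rewrite !inE eqxx !orbT.
pose x' : {z | z \notin [set z in q]} := Sub x (nS x hx).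
pose y' : {z | z \notin [set z in q]} := Sub y (nS y hy).
apply: (@two_neighbours_not_connected _ _ w' x' y').
- by rewrite card_deleted cardsE (card_uniqP uq); move: sL; simpl; clear; lia.
- rewrite -(map_inj_uniq val_inj) /=; move: uL.
  by rewrite -[_ :: _]/([:: w; x; y] ++ q) cat_uniq => /and3P[].
move=> z /hw; rewrite !inE -!val_eqE /= orbA => /orP[//|zq].
by have := valP z; rewrite inE zq.
Qed.

(** Deleting all neighbours isolates [w]. *)
Lemma neighbours_not_k_connected w L : uniq (w :: L) ->
  (forall y, G w y -> y \in L) -> size (w :: L) < #|T| -> ~ k_connected G (size L).+1.
Proof.
move=> uL hw sL /(_ [set z in L]).
case/andP: (uL) => wL uq; rewrite cardsE (card_uniqP uq) => /(_ (leqnn _)).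
have wS : w \notin [set z in L] by rewrite inE.
have [v] : exists v, v \notin w :: L.
  apply/existsP; apply: contraLR sL; rewrite negb_exists => /forallP h.
  rewrite -leqNgt -(card_uniqP uL) -cardsT; apply/subset_leq_card/subsetP => z _.
  by have := h z; rewrite negbK.
rewrite inE negb_or => /andP[vw vL].
have vS : v \notin [set z in L] by rewrite inE.
move=> /(_ (Sub w wS) (Sub v vS)) /connectP[[|y p] /=].
  by move=> _ /(congr1 val) /= e; rewrite e eqxx in vw.
by case/andP=> /hw yL _ _; have := valP y; rewrite inE yL.
Qed.

End DeletedNonProperties.

(** * The clique bounds *)

Lemma clique_free_omega (T : finType) (G : sgraph T) r :
  clique_free G r.+1 -> omega_le G setT r.
Proof.
move=> free S _ qS; rewrite leqNgt; apply/negP => /subset_of_card[L LS].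
exact: free (sub_clique LS qS).
Qed.

(** The two alternatives are the two ways in which [low_degrees_few_edges] bounds
    the number of edges. *)
Definition size_condition r n s : Prop :=
  large_enough r n s \/ r = 3 /\ 6 * s + 20 <= n.

Lemma size_conditionS r n s s' : s' <= s -> size_condition r n s -> size_condition r n s'.
Proof.
move=> ss [|[r3 hn]]; last by right; split=> //; lia.
rewrite /large_enough => /or4P[/andP[rr hn]|/andP[rr hn]|/and3P[rr h1 h2]|/orP[/andP[/eqP s0 rr]|/orP[]/andP[/eqP s0 rr]]].
- by left; apply/or4P/Or41; rewrite rr; lia.
- by left; apply/or4P/Or42; rewrite rr; lia.
- left; apply/or4P/Or43; rewrite rr; apply/andP; split; first by lia.
  have : (r - 4) * (n - s - 4) <= (r - 4) * (n - s' - 4) by rewrite leq_mul2l; lia.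
  by lia.
- by left; apply/or4P/Or44; lia.
- by left; apply/or4P/Or44; lia.
- by left; apply/or4P/Or44; lia.
Qed.

(** The last vertex of the colex Turan graph can have [s] neighbours. *)
Lemma size_condition_back_deg r n s : 2 < r -> s < n -> size_condition r n s ->
  s <= back_deg r n.-1.
Proof.
move=> r2; case: n => // m sm; rewrite ltnS in sm; rewrite /= /back_deg => H.
have := divn_eq m r; have := leq_addr (m %% r) (m %/ r * r); set q := m %/ r => h1 h2.
have hq : q * r <= m by rewrite h2.
move: {h1 h2} q hq => q hq.
have [q0|q0] := posnP q; first by lia.
case: H => [|[r3 hn]]; last by subst r; lia.
rewrite /large_enough => /or4P[/andP[/eqP rr hn]|/andP[rr hn]|/and3P[rr h1 h2]|H].
- by subst r; lia.
- have : q * 5 <= q * r by rewrite leq_mul2l; lia.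
  by lia.
- have : q * 8 <= q * r by rewrite leq_mul2l; lia.
  rewrite leqNgt => h3; apply/negP => h4.
  have : (r - 4) * (m.+1 - s - 4) <= (r - 4) * q by rewrite leq_mul2l; lia.
  have : (r - 4) * q <= q * r by rewrite mulnC leq_mul2l; lia.
  by lia.
- have : q * 4 <= q * r by rewrite leq_mul2l; lia.
  by lia.
Qed.

Section Bound.
Variables (T : finType) (G : sgraph T) (r t n s : nat) (l : int).
Hypotheses (r3 : 2 < r) (t2 : 1 < t) (hn : #|T| = n) (free : clique_free G r.+1).
Hypotheses (hs : `|(l + 1)%R| = s) (sn : s < n) (size_ok : size_condition r n s).

Lemma few_edges_colex_bound : cl G setT 2 <= turan_cl 2 r n.-1 + s ->
  nb_cliques G t <= nb_cliques (colex_turan n r l) t.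
Proof.
move=> he; have sb := size_condition_back_deg r3 sn size_ok.
case: n sn he sb => // m _ he sb; case: t t2 => // t' t1.
rewrite colex_nb_cliques ?hs //; last exact: ltn_trans r3.
rewrite clique_nb_cliques.
exact: edges_bound_cliques (clique_free_omega free) t1 he sb.
Qed.

Lemma low_degrees_colex_bound s' : s' <= s -> low_degrees G s' ->
  nb_cliques G t <= nb_cliques (colex_turan n r l) t.
Proof.
move=> ss /low_degreesP[h [h1 h2 h3]]; apply: few_edges_colex_bound.
apply: (@leq_trans (turan_cl 2 r n.-1 + s')); last by rewrite leq_add2l.
rewrite -hn -cardsT.
apply: (low_degrees_few_edges (h := h)) => //; rewrite ?cardsT ?hn.
- exact: clique_free_omega.
- exact: size_conditionS size_ok.
- by rewrite -hn.
Qed.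

End Bound.

Lemma colex_copy (T : finType) (G : sgraph T) r n s l : 2 < r -> `|(l + 1)%R| = s ->
  s < n -> size_condition r n s -> isomorphic G (colex_turan n r l) ->
  exists w (L : seq T), [/\ uniq (w :: L), size L = s,
    forall y, G w y -> y \in L & sorted G L].
Proof.
move=> r3 hs sn /(size_condition_back_deg r3 sn); case: n sn => // m _ sb iso.
rewrite -hs in sb; have [w [L [uL cL nL sL]]] := colex_pendant r3 sb iso.
by exists w, L; split=> //; [rewrite cL | move=> y; rewrite nL].
Qed.

Lemma failure_low_degrees (T : finType) (G : sgraph T) s (P : Prop) :
  ((forall s', s' <= s -> ~~ low_degrees G s') -> P) -> ~ P ->
  exists2 s', s' <= s & low_degrees G s'.
Proof.
move=> hP nP.
have [/existsP[s' hs']|no] := boolP [exists s' : 'I_s.+1, low_degrees G s'].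
  by exists s'; rewrite // -ltnS.
case: nP; apply: hP => s' hs'; apply: contra no => h.
by apply/existsP; exists (Ordinal (hs' : s' < s.+1)).
Qed.

(** * The size hypotheses *)

Lemma rational_size_condition (k r n : nat) : 8 <= r ->
  (k%:R + 5 + 4 * (k%:R + 4) / (r%:R - 4) <= n%:R :> rat)%R ->
  k + 5 <= n /\ 4 * (k + 4) <= (r - 4) * (n - (k + 5)).
Proof.
move=> r8; have r4 : 0 < r - 4 by lia.
have er : (r%:R - 4 = (r - 4)%:R :> rat)%R by rewrite GRing.natrB //; lia.
have ek : (4 * (k%:R + 4) = (4 * (k + 4))%:R :> rat)%R by rewrite GRing.natrM GRing.natrD.
have e5 : (k%:R + 5 = (k + 5)%:R :> rat)%R by rewrite GRing.natrD.
rewrite er ek e5 => H.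
have kn : k + 5 <= n.
  rewrite -(Num.Theory.ler_nat rat); apply: Order.POrderTheory.le_trans H.
  by rewrite Num.Theory.lerDl Num.Theory.divr_ge0 ?Num.Theory.ler0n.
split=> //; move: H; rewrite GRing.addrC -Num.Theory.lerBrDr -GRing.natrB //.
rewrite Num.Theory.ler_pdivrMr ?Num.Theory.ltr0n // -GRing.natrM Num.Theory.ler_nat.
by rewrite [X in _ -> _ <= X]mulnC.
Qed.

Lemma path_size_condition (k r n : nat) : 2 < r ->
  (r = 3 -> 6 * k + 26 <= n) -> (r = 4 -> 5 * k + 11 <= n) ->
  (5 <= r <= 7 -> 3 * k + 7 <= n) ->
  (8 <= r -> (k%:R + 5 + 4 * (k%:R + 4) / (r%:R - 4) <= n%:R :> rat)%R) ->
  k + 2 < n /\ size_condition r n k.+1.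
Proof.
move=> r2 h3 h4 h5 h8; have [r7|r8] := ltnP r 8; last first.
  have [h6 h7] := rational_size_condition r8 (h8 r8); split; first by lia.
  left; apply/or4P/Or43; rewrite r8 /=; apply/andP; split; first by lia.
  have -> : n - k.+1 - 4 = n - (k + 5) by lia.
  by have -> : k.+1 + 3 = k + 4 by lia.
clear h8.
have [r3|r3] := eqVneq r 3; first by split; [lia | right; split=> //; lia].
have [r4|r4] := eqVneq r 4.
  by split; [lia | left; apply/or4P/Or41; rewrite r4 /=; lia].
by split; [lia | left; apply/or4P/Or42; lia].
Qed.

Lemma connected_size_condition (k r n : nat) : 2 < r -> 0 < k ->
  (r = 3 -> 6 * k + 14 <= n) -> (4 <= r <= 7 -> 5 * k + 1 <= n) ->
  (8 <= r -> 2 * k + 5 <= n) -> k < n /\ size_condition r n k.-1.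
Proof.
move=> r2 k0 h3 h4 h8; have [r7|r8] := ltnP r 8; last first.
  split; first by lia.
  left; apply/or4P/Or43; rewrite r8 /=; apply/andP; split; first by lia.
  by apply: leq_mul; lia.
have [r3|r3] := eqVneq r 3; first by split; [lia | right; split=> //; lia].
have [r4|r4] := eqVneq r 4.
  by split; [lia | left; apply/or4P/Or41; rewrite r4 /=; lia].
by split; [lia | left; apply/or4P/Or42; lia].
Qed.

Theorem corollary7p9 (r t n : nat) (T : finType) (G : sgraph T)
    (hr : 3 <= r) (ht : 2 <= t) (hn : #|T| = n)
    (hfree : clique_free G r.+1) :
  (* (a) *)
  ((r = 3 -> 20 <= n) -> (4 <= r -> 1 <= n) ->
   [/\ ~ traceable G ->
         nb_cliques G t <= nb_cliques (colex_turan n r (-1)) t,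
       isomorphic G (colex_turan n r (-1)) ->
         (* the one-vertex graph is traceable *)
         (2 <= n -> ~ traceable G) /\
         nb_cliques G t = nb_cliques (colex_turan n r (-1)) t &
       isomorphic (colex_turan n r (-1)) (add_vertex (turan n.-1 r) set0)]) /\
  (* (b) *)
  ((r = 3 -> 26 <= n) -> (r = 4 -> 11 <= n) -> (5 <= r -> 2 <= n) ->
   [/\ ~ hamiltonian G \/ (4 <= n /\ ~ chorded_pancyclic G) ->
         nb_cliques G t <= nb_cliques (colex_turan n r 0) t,
       isomorphic G (colex_turan n r 0) ->
         [/\ ~ hamiltonian G, 4 <= n -> ~ chorded_pancyclic G &
             nb_cliques G t = nb_cliques (colex_turan n r 0) t] &
       exists u : 'I_n.-1,
         isomorphic (colex_turan n r 0)
                    (add_vertex (turan n.-1 r) [set u])]) /\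
  (* (c) *)
  ((r = 3 -> 32 <= n) -> (r = 4 -> 16 <= n) -> (r = 5 -> 10 <= n) ->
   (6 <= r -> 4 <= n) ->
   [/\ ~ ham_connected G ->
         nb_cliques G t <= nb_cliques (colex_turan n r 1) t,
       isomorphic G (colex_turan n r 1) ->
         ~ ham_connected G /\
         nb_cliques G t = nb_cliques (colex_turan n r 1) t &
       exists u v : 'I_n.-1,
         turan n.-1 r u v /\
         isomorphic (colex_turan n r 1)
                    (add_vertex (turan n.-1 r) [set u; v])]) /\
  (* (d) *)
  (forall k : nat,
   (r = 3 -> 6 * k + 26 <= n) -> (4 <= r <= 7 -> 5 * k + 11 <= n) ->
   (8 <= r ->
     (k%:R + 5 + 4 * (k%:R + 4) / (r%:R - 4) <= n%:R :> rat)%R) ->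
   (~ path_hamiltonian G k ->
      nb_cliques G t <= nb_cliques (colex_turan n r k%:Z) t) /\
   (isomorphic G (colex_turan n r k%:Z) ->
      ~ path_hamiltonian G k /\
      nb_cliques G t = nb_cliques (colex_turan n r k%:Z) t)) /\
  (* (e) *)
  (forall k : nat,
   (r = 3 -> 6 * k + 26 <= n) -> (4 <= r <= 7 -> 5 * k + 11 <= n) ->
   (8 <= r ->
     (k%:R + 5 + 4 * (k%:R + 4) / (r%:R - 4) <= n%:R :> rat)%R) ->
   (~ k_hamiltonian G k ->
      nb_cliques G t <= nb_cliques (colex_turan n r k%:Z) t) /\
   (isomorphic G (colex_turan n r k%:Z) ->
      ~ k_hamiltonian G k /\
      nb_cliques G t = nb_cliques (colex_turan n r k%:Z) t)) /\
  (* (f) *)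
  (forall k : nat, 1 <= k ->
   (r = 3 -> 6 * k + 26 <= n) -> (r = 4 -> 5 * k + 11 <= n) ->
   (5 <= r <= 7 -> 3 * k + 7 <= n) ->
   (8 <= r ->
     (k%:R + 5 + 4 * (k%:R + 4) / (r%:R - 4) <= n%:R :> rat)%R) ->
   (~ k_ham_connected G k ->
      nb_cliques G t <= nb_cliques (colex_turan n r k%:Z) t) /\
   (isomorphic G (colex_turan n r k%:Z) ->
      ~ k_ham_connected G k /\
      nb_cliques G t = nb_cliques (colex_turan n r k%:Z) t)) /\
  (* (g) *)
  (forall k : nat, 1 <= k ->
   (r = 3 -> 6 * k + 14 <= n) -> (4 <= r <= 7 -> 5 * k + 1 <= n) ->
   (8 <= r -> 2 * k + 5 <= n) ->
   (~ k_connected G k ->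
      nb_cliques G t <= nb_cliques (colex_turan n r (k%:Z - 2)) t) /\
   (isomorphic G (colex_turan n r (k%:Z - 2)) ->
      ~ k_connected G k /\
      nb_cliques G t = nb_cliques (colex_turan n r (k%:Z - 2)) t)).
Proof.
have nsize w (L : seq T) s : size L = s -> s.+1 < n -> size (w :: L) < #|T|.
  by move=> sL; rewrite /= sL hn.
split; [|split; [|split; [|split; [|split; [|split]]]]].
- move=> h3 h4.
  have n0 : 0 < n by have [/h3|/h4] : r = 3 \/ 4 <= r; lia.
  have ok : size_condition r n 0.
    have [r4|r4] := leqP 4 r; first by left; apply/or4P/Or44; rewrite eqxx r4.
    by right; lia.
  split.
  - move=> ntr; have [|s' s0 low] := failure_low_degrees (s := 0) (G := G) _ ntr.
      by move=> low; apply: traceable_low_degrees; rewrite ?hn ?low.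
    exact: (low_degrees_colex_bound hr ht hn hfree (s := 0) _ n0 ok s0 low).
  - move=> iso; split; last exact: isomorphic_nb_cliques.
    move=> n2; have [w [L [uL /size0nil eL nL _]]] := colex_copy (l := -1%R) hr (erefl 0) n0 ok iso.
    by apply: (isolated_not_traceable (w := w)); rewrite ?hn // => y; apply/negP => /nL; rewrite eL.
  - case: (n) n0 ok => // m _ _.
    have [b [_ /cards0_eq eb iso]] := @colex_structure m r (-1)%R (ltnW (ltnW hr)) isT.
    by rewrite -eb.
- move=> h3 h4 h5.
  have n1 : 1 < n by have [/h3|[/h4|/h5]] : r = 3 \/ r = 4 \/ 5 <= r; lia.
  have ok : size_condition r n 1.
    have [r5|r5] := leqP 5 r; first by left; apply/or4P/Or44; rewrite eqxx r5.
    have [r4|r4] := eqVneq r 4; last by right; lia.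
    by left; apply/or4P/Or41; rewrite r4; apply: h4.
  have lowB s' : s' <= 1 -> low_degrees G s' ->
      nb_cliques G t <= nb_cliques (colex_turan n r 0) t.
    exact: (low_degrees_colex_bound hr ht hn hfree (s := 1)).
  have fewB : cl G setT 2 <= turan_cl 2 r n.-1 + 1 ->
      nb_cliques G t <= nb_cliques (colex_turan n r 0) t.
    exact: (few_edges_colex_bound hr ht hfree (s := 1)).
  have om := clique_free_omega hfree.
  split.
  - case=> [nham|[n4 npan]].
      (* On two vertices the only possible edge is within the bound. *)
      have [n2|n2] := leqP n 2.
        apply: fewB; apply: leq_trans (zykov _ om) _; rewrite cardsT hn.
        have -> : n = 2 by lia.
        by rewrite turan_edgesS leq_add2l; apply: back_deg_le.
      have [|s' s1 low] := failure_low_degrees (s := 1) (G := G) _ nham.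
        by move=> low; apply: hamiltonian_low_degrees; rewrite ?hn ?low.
      exact: lowB s1 low.
    have [/fewB //|many] := leqP (cl G setT 2) (turan_cl 2 r n.-1 + 1).
    have [low|low] := boolP (low_degrees G 1); first exact: lowB low.
    case: npan; apply: (chorded_pancyclic_of_edges hr om); last by rewrite hn.
    by apply: hamiltonian_low_degrees; rewrite ?hn //; lia.
  - move=> iso; have [w [L [_ cL nL _]]] := colex_copy (l := 0%R) hr (erefl 1) n1 ok iso.
    case: L cL nL => [|u [|? ?]] // _ nL.
    have nham : ~ hamiltonian G.
      by apply: (pendant_not_hamiltonian (w := w) (u := u)) => y /nL; rewrite inE => /eqP.
    split; [by []| |exact: isomorphic_nb_cliques].
    by move=> n4 /chorded_pancyclic_hamiltonian; rewrite hn => /(_ n4).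
  - have := size_condition_back_deg hr n1 ok; case: (n) n1 => // m _ sb.
    have [b [_ /eqP/cards1P[u eu] iso]] := @colex_structure m r 0%R (ltnW (ltnW hr)) sb.
    by exists u; rewrite -eu.
- move=> h3 h4 h5 h6.
  have n3 : 3 < n.
    by have [/h3|[/h4|[/h5|/h6]]] : r = 3 \/ r = 4 \/ r = 5 \/ 6 <= r; lia.
  have n2 : 2 < n by exact: ltnW.
  have ok : size_condition r n 2.
    have [r6|r6] := leqP 6 r; first by left; apply/or4P/Or44; rewrite r6 orbT.
    have [r5|r5] := eqVneq r 5; first by left; apply/or4P/Or42; rewrite r5; apply: h5.
    have [r4|r4] := eqVneq r 4; last by right; lia.
    by left; apply/or4P/Or41; rewrite r4; apply: h4.
  split.
  - move=> nhc; have [|s' s2 low] := failure_low_degrees (s := 2) (G := G) _ nhc.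
      by move=> low; apply: ham_connected_low_degrees; apply: low.
    exact: (low_degrees_colex_bound hr ht hn hfree (s := 2) _ n2 ok s2 low).
  - move=> iso; split; last exact: isomorphic_nb_cliques.
    have [w [L [uL cL nL _]]] := colex_copy (l := 1%R) hr (erefl 2) n2 ok iso.
    case: L cL uL nL => [|u [|v [|? ?]]] // _ uL nL.
    by apply: (two_neighbours_not_connected _ uL nL); rewrite hn.
  - have := size_condition_back_deg hr n2 ok; case: (n) n2 => // m _ sb.
    have [b [bm cb iso]] := @colex_structure m r 1%R (ltnW (ltnW hr)) sb.
    have := sorted_initial_segment hr bm; rewrite cardE in cb.
    case eL : (enum _) cb => [|u [|v [|? ?]]] //= _ /andP[guv _].
    exists u, v; split=> //; suff <- : initial_segment m r b = [set u; v] by [].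
    by apply/setP => x; rewrite -mem_enum eL !inE.
- move=> k h3 h4 h8.
  have [kn ok] : k + 2 < n /\ size_condition r n k.+1.
    by apply: path_size_condition => // hr4; apply: leq_trans (h4 _); lia.
  have hs : `|(k%:Z + 1)%R| = k.+1 by lia.
  have sn : k.+1 < n by lia.
  split=> [nph|iso].
    have [|s' sk low] := failure_low_degrees (s := k.+1) (G := G) _ nph.
      move=> low; apply: path_hamiltonian_deleted; [by rewrite hn; lia| |].
        by apply: hamiltonian_low_degrees (low 1 isT); rewrite hn; lia.
      exact: ham_connected_deleted.
    exact: (low_degrees_colex_bound hr ht hn hfree hs sn ok sk low).
  split; last exact: isomorphic_nb_cliques.
  have [w [L [uL cL nL pL]]] := colex_copy hr hs sn ok iso.
  case: L cL uL nL pL => [|x q] // [cL] uL nL pL.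
  rewrite -cL; apply: (neighbour_path_not_hamiltonian uL pL nL).
  by rewrite hn /= cL; lia.
- move=> k h3 h4 h8.
  have [kn ok] : k + 2 < n /\ size_condition r n k.+1.
    by apply: path_size_condition => // hr4; apply: leq_trans (h4 _); lia.
  have hs : `|(k%:Z + 1)%R| = k.+1 by lia.
  have sn : k.+1 < n by lia.
  split=> [nph|iso].
    have [|s' sk low] := failure_low_degrees (s := k.+1) (G := G) _ nph.
      by apply: hamiltonian_deleted; rewrite hn.
    exact: (low_degrees_colex_bound hr ht hn hfree hs sn ok sk low).
  split; last exact: isomorphic_nb_cliques.
  have [w [L [uL cL nL pL]]] := colex_copy hr hs sn ok iso.
  case: L cL uL nL pL => [|x q] // [cL] uL nL pL.
  by rewrite -cL; apply: (neighbour_path_not_k_hamiltonian uL nL).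
- move=> k k0 h3 h4 h5 h8.
  have [kn ok] := path_size_condition hr h3 h4 h5 h8.
  have hs : `|(k%:Z + 1)%R| = k.+1 by lia.
  have sn : k.+1 < n by lia.
  split=> [nph|iso].
    have [|s' sk low] := failure_low_degrees (s := k.+1) (G := G) _ nph.
      exact: ham_connected_deleted.
    exact: (low_degrees_colex_bound hr ht hn hfree hs sn ok sk low).
  split; last exact: isomorphic_nb_cliques.
  have [w [L [uL cL nL pL]]] := colex_copy hr hs sn ok iso.
  case: L cL uL nL pL => [|x [|y q]] // [cL] uL nL pL; first by rewrite -cL in k0.
  rewrite -cL; apply: (neighbours_not_k_ham_connected uL nL).
  by rewrite hn /= cL; lia.
- move=> k k0 h3 h4 h8.
  have [kn ok] := connected_size_condition hr k0 h3 h4 h8.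
  have hs : `|(k%:Z - 2 + 1)%R| = k.-1 by lia.
  have sn : k.-1 < n by lia.
  split=> [nph|iso].
    have [|s' sk low] := failure_low_degrees (s := k.-1) (G := G) _ nph.
      by move=> low; apply: connected_deleted => s' s'k; apply: low; lia.
    exact: (low_degrees_colex_bound hr ht hn hfree hs sn ok sk low).
  split; last exact: isomorphic_nb_cliques.
  have [w [L [uL cL nL pL]]] := colex_copy hr hs sn ok iso.
  rewrite -(prednK k0) -cL; apply: (neighbours_not_k_connected uL nL).
  by rewrite hn /= cL; lia.
Qed.
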